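(* Let $\lambda,\mu,\omega,l\in\mathbb C$, $\lambda+\mu^2=\frac1{4\omega^2}$, $\omega\neq0$, $\mu\neq0$, $n=l+1$, $l\notin2\mathbb Z$. The monodromy operator of the equation $$z^2E''+(nz+\mu(1-z^2))E'+(\lambda-\mu nz)E=0$$ has eigenvalue $e^{-\pi il}$ if and only if $$R_{0,21}\pm\omega l(R_{0,21}-R_{0,11})=0$$ with some choice of sign.
   Context: The monodromy operator of the equation acts on germs of its solutions at a nonzero point by analytic continuation along a counterclockwise circuit around zero. The matrices are $$M_k=\begin{pmatrix}1+\frac{\lambda}{k^2-\frac{l^2}4} & \frac{\mu^2}{k^2-\frac{l^2}4}\\ 1&0\end{pmatrix},\qquad R_k=M_kM_{k+1}\cdots$$ (the infinite products converge), and $R_{0,ij}$ denote the matrix elements of $R_0$. *)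

(* Defs.v *)
From Stdlib Require Import Reals ZArith.
From Coquelicot Require Import Coquelicot.
Local Open Scope C_scope.

Definition Cexp (z : C) : C :=
  RtoC (exp (Re z)) * (RtoC (cos (Im z)) + Ci * RtoC (sin (Im z))).

(** * Infinite matrix products *)

(* Total limit operator: a junk value if the sequence does not converge. *)
Definition CLim_seq (u : nat -> C) : C :=
  (real (Lim_seq (fun N => Re (u N))), real (Lim_seq (fun N => Im (u N)))).

Definition M (lambda mu l : C) (k : nat) : matrix (T := C_Ring) 2 2 :=
  let d := RtoC (INR k) ^ 2 - l ^ 2 / RtoC 4 in
  mk_matrix 2 2 (fun i j : nat =>
    match i, j with
    | O, O => RtoC 1 + lambda / d
    | O, _ => mu ^ 2 / d
    | _, O => RtoC 1
    | _, _ => RtoC 0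
    end).

(* M_k M_{k+1} ... M_{k+N-1} *)
Fixpoint Mprod (lambda mu l : C) (k N : nat) : matrix (T := C_Ring) 2 2 :=
  match N with
  | O => Mone
  | S N' => Mmult (Mprod lambda mu l k N') (M lambda mu l (k + N'))
  end.

(* The entry in row i and column j of R_k = M_k M_{k+1} ..., where i and j
   are counted from 1, whereas coeff_mat counts from 0. *)
Definition Rinf (lambda mu l : C) (k i j : nat) : C :=
  CLim_seq (fun N =>
    coeff_mat (zero : C_Ring) (Mprod lambda mu l k N) (i - 1) (j - 1)).

(** * Germs, analytic continuation and monodromy *)

(* A germ at z0 is represented by any total function C -> C that agrees with
   it near z0. *)
Definition germ_eq (z0 : C) (f g : C -> C) : Prop :=
  locally (T := C_UniformSpace) z0 (fun z => f z = g z).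

Definition holomorphic_near (z0 : C) (f : C -> C) : Prop :=
  locally (T := C_UniformSpace) z0
    (fun z => ex_derive (K := C_AbsRing) (V := C_NormedModule) f z).

Definition solution_near (lambda mu n z0 : C) (E : C -> C) : Prop :=
  locally (T := C_UniformSpace) z0 (fun z =>
    ex_derive (K := C_AbsRing) (V := C_NormedModule) E z /\
    ex_derive (K := C_AbsRing) (V := C_NormedModule) (C_derive E) z /\
    z ^ 2 * C_derive (C_derive E) z
    + (n * z + mu * (RtoC 1 - z ^ 2)) * C_derive E z
    + (lambda - mu * n * z) * E z = RtoC 0).

(* The germ of g at gamma 1 is the result of the analytic continuation of the
   germ of f at gamma 0 along the path gamma : [0, 1] -> C. *)
Definition analytic_continuation (gamma : R -> C) (f g : C -> C) : Prop :=
  exists F : R -> C -> C,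
    (forall t : R, (0 <= t <= 1)%R -> holomorphic_near (gamma t) (F t)) /\
    (forall t : R, (0 <= t <= 1)%R ->
       locally t (fun s : R => (0 <= s <= 1)%R ->
         germ_eq (gamma s) (F s) (F t))) /\
    germ_eq (gamma 0%R) f (F 0%R) /\
    germ_eq (gamma 1%R) (F 1%R) g.

Definition circuit (z0 : C) (t : R) : C :=
  z0 * Cexp (RtoC (2 * PI * t) * Ci).

(* Graph of the monodromy operator on germs at z0. *)
Definition monodromy (z0 : C) (f g : C -> C) : Prop :=
  analytic_continuation (circuit z0) f g.

(* a is an eigenvalue of the monodromy operator acting on the space of germs
   at z0 of solutions of the equation. *)
Definition monodromy_eigenvalue (lambda mu n z0 a : C) : Prop :=
  exists E : C -> C,
    solution_near lambda mu n z0 E /\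
    ~ germ_eq z0 E (fun _ => RtoC 0) /\
    monodromy z0 E (fun z => a * E z).

(* Main.v *)
(** Put E = z^(-l/2) sum_k a_k z^k.  The equation becomes a three-term recurrence for (a_k), and an
    eigenfunction for e^(-i pi l) amounts to a nonzero bilateral solution of it that decays in both
    directions.  To the right the decaying solution is unique up to a factor: it is
    a_(k-1) = g_k x_k with g_(k+1) = mu g_k / (k - l/2), where x_k is the upper left entry of R_k, so
    that x_0 = R_(0,11) and x_1 = R_(0,21).  The involution
    E(z) -> 2 omega z^(-l-1) (E'(1/z) - mu E(1/z)) of the solution space exchanges the two directions;
    it squares to 1 because lambda + mu^2 = 1 / (4 omega^2).  Hence a bilateral decaying solution may
    be taken invariant or anti-invariant, and this property, read off at index 0, is the condition of
    the theorem with the corresponding sign.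

    In the other direction, an eigenfunction yields (a_k) as Fourier coefficients of its
    continuation along the circuit.  These are only known to be O(r^|k|), but this already makes their
    Casoratian with the decaying solution vanish.  That the continued germs keep solving the equation,
    and that the Fourier coefficients do not all vanish, follows from the Taylor expansion of complex
    differentiable functions: by Goursat's theorem in the coordinate log (z - c), the k-th Fourier
    coefficient of f on the circle of radius r around c is A_k r^k. *)
Require Import Defs.
From Stdlib Require Import Reals ZArith Lra Lia ClassicalEpsilon Classical_Prop.
From Coquelicot Require Import Coquelicot.
Local Open Scope C_scope.

(** Analytic continuation supplies only a family of holomorphic germs along one circle; it says
    neither that they solve the equation nor that they extend to an annulus. The coefficients of an
    eigenfunction are therefore integrals over that single circle, and other radii cannot be used to
    improve their growth bound. The bound O(r^|k|) is enough because, with h = l/2, g_k = mu^k / ((0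
    - h) ... (k - 1 - h)) decays faster than every geometric sequence.

    That l is not an even integer means that h is not an integer: the denominators k^2 - h^2 of M_k
    and, as mu is nonzero, the outer coefficients mu (k + 1 - h) and mu (k + h) of the recurrence
    never vanish, so two adjacent coefficients determine all others. The product R_0 describes the
    decaying solution on indices >= -1 only. The involution turns it into a solution on indices <=
    0, so no second infinite product occurs, and the two halves have to be compared only at -1 and
    0, where they overlap. *)

Local Notation Cderiv f z l :=
  (is_derive (K := C_AbsRing) (V := C_NormedModule) f z l).
Local Notation tpi := (RtoC (2 * PI) * Ci).
Local Notation "[ k ]" := (RtoC (IZR k)).

(** * Complex derivatives by explicit estimates *)

Lemma locally_Cmod (z : C) (P : C -> Prop) :
  locally (T := C_UniformSpace) z P <->
  exists d : R, (0 < d)%R /\ forall y, (Cmod (y - z) < d)%R -> P y.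
Proof.
split.
- intros H. apply locally_C in H. destruct H as [d Hd].
  exists d. split. apply cond_pos. intros y hy. apply Hd. exact hy.
- intros [d [hd Hd]]. apply locally_C. exists (mkposreal d hd).
  intros y hy. apply Hd. exact hy.
Qed.

Lemma Cderiv_iff (f : C -> C) (z l : C) :
  Cderiv f z l <->
  (forall eps : R, (0 < eps)%R -> exists d : R, (0 < d)%R /\
     forall y, (Cmod (y - z) < d ->
       Cmod (f y - f z - (y - z) * l) <= eps * Cmod (y - z))%R).
Proof.
split; intros H.
- intros e he. destruct H as [_ H].
  specialize (H z (fun P HP => HP) (mkposreal e he)).
  destruct H as [d Hd]. exists d. split. apply cond_pos.
  intros y hy. apply (Hd y). exact hy.
- split. apply is_linear_scal_l. intros x hx.
  apply (is_filter_lim_locally_unique (V := AbsRing_NormedModule C_AbsRing)) in hx.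
  subst x. intros e. destruct (H e (cond_pos e)) as [d [hd Hd]].
  exists (mkposreal d hd). exact Hd.
Qed.

(** The two normed module structures on C differ only as terms. The product and chain rules of the
    library speak of the second one, the definitions of the theorem of the first. *)
Lemma Cderiv_AbsRing (f : C -> C) (z l : C) :
  is_derive (K := C_AbsRing) (V := AbsRing_NormedModule C_AbsRing) f z l <->
  Cderiv f z l.
Proof.
split; intros [_ H]; (split; [apply is_linear_scal_l|exact H]).
Qed.

(** Most derivatives below that do not follow from the algebraic rules (inverse, exponential,
    logarithm, series) are obtained from such a quadratic remainder bound, because it survives
    summation of series. *)
Lemma Cderiv_quad (f : C -> C) (z l : C) (K d : R) :
  (0 < d)%R ->
  (forall h, Cmod h < d -> Cmod (f (z + h)%C - f z - h * l) <= K * Cmod h ^ 2)%R ->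
  Cderiv f z l.
Proof.
intros hd H. apply Cderiv_iff. intros eps he.
set (K' := (Rmax K 1)%R).
assert (hK : (1 <= K')%R) by apply Rmax_r.
assert (hK' : (K <= K')%R) by apply Rmax_l.
exists (Rmin d (eps / K')). split.
- apply Rmin_pos; [exact hd|]. apply Rdiv_lt_0_compat; lra.
- intros y hy.
  assert (h1 := Rmin_l d (eps / K')). assert (h2 := Rmin_r d (eps / K')).
  specialize (H (y - z)).
  replace (z + (y - z)) with y in H by ring.
  eapply Rle_trans. apply H. lra.
  assert (h3 := Cmod_ge_0 (y - z)).
  assert (h4 : (Cmod (y - z) * K' <= eps)%R).
  { apply Rle_trans with (eps / K' * K')%R; [apply Rmult_le_compat_r; lra|].
    right. field. lra. }
  nra.
Qed.

Lemma Cderiv_eq (f : C -> C) (z l m : C) : Cderiv f z l -> l = m -> Cderiv f z m.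
Proof. intros H <-. exact H. Qed.

Lemma Cderiv_const (c z : C) : Cderiv (fun _ => c) z (RtoC 0).
Proof. exact (is_derive_const (K := C_AbsRing) (V := C_NormedModule) c z). Qed.

Lemma Cderiv_id (z : C) : Cderiv (fun y => y) z (RtoC 1).
Proof.
apply (Cderiv_quad _ _ _ 0 1). lra. intros h _.
replace (z + h - z - h * RtoC 1) with (RtoC 0) by ring.
rewrite Cmod_0. lra.
Qed.

Lemma Cderiv_plus (f g : C -> C) (z l m : C) :
  Cderiv f z l -> Cderiv g z m -> Cderiv (fun y => f y + g y) z (l + m).
Proof. exact (is_derive_plus (K := C_AbsRing) (V := C_NormedModule) f g z l m). Qed.

Lemma Cderiv_opp (f : C -> C) (z l : C) :
  Cderiv f z l -> Cderiv (fun y => - f y) z (- l).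
Proof. exact (is_derive_opp (K := C_AbsRing) (V := C_NormedModule) f z l). Qed.

Lemma Cderiv_minus (f g : C -> C) (z l m : C) :
  Cderiv f z l -> Cderiv g z m -> Cderiv (fun y => f y - g y) z (l - m).
Proof. intros. apply Cderiv_plus; [|apply Cderiv_opp]; assumption. Qed.

Lemma Cderiv_mult (f g : C -> C) (z l m : C) :
  Cderiv f z l -> Cderiv g z m ->
  Cderiv (fun y => f y * g y) z (l * g z + f z * m).
Proof.
intros H1 H2.
apply Cderiv_AbsRing.
apply Cderiv_AbsRing in H1. apply Cderiv_AbsRing in H2.
exact (is_derive_mult (K := C_AbsRing) f g z l m H1 H2 Cmult_comm).
Qed.

Lemma Cderiv_comp (f g : C -> C) (z l m : C) :
  Cderiv f (g z) l -> Cderiv g z m -> Cderiv (fun y => f (g y)) z (m * l).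
Proof.
intros H1 H2. apply Cderiv_AbsRing in H2.
exact (is_derive_comp (K := C_AbsRing) (V := C_NormedModule) f g z l m H1 H2).
Qed.

Lemma Cderiv_ext_loc (f g : C -> C) (z l : C) (d : R) :
  (0 < d)%R -> (forall y, (Cmod (y - z) < d)%R -> f y = g y) ->
  Cderiv f z l -> Cderiv g z l.
Proof.
intros hd H. apply (is_derive_ext_loc (K := C_AbsRing) (V := C_NormedModule)).
exists (mkposreal d hd). exact H.
Qed.

Lemma Cderiv_unique (f : C -> C) (z l : C) : Cderiv f z l -> C_derive f z = l.
Proof. apply is_C_derive_unique. Qed.

Lemma Cmod_minus_sym (x y : C) : Cmod (x - y) = Cmod (y - x).
Proof. rewrite <- Cmod_opp. f_equal. ring. Qed.

Lemma Cmod_triangle_minus (x y : C) : (Cmod (x - y) <= Cmod x + Cmod y)%R.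
Proof. rewrite <- (Cmod_opp y). apply Cmod_triangle. Qed.

Lemma Cmod_triangle_inv (x y : C) : (Cmod x - Cmod y <= Cmod (x + y))%R.
Proof.
assert (h := Cmod_triangle_minus (x + y) y).
replace (x + y - y) with x in h by ring. lra.
Qed.

Lemma Cderiv_inv (z : C) : z <> RtoC 0 -> Cderiv (fun y => / y) z (- / (z * z)).
Proof.
intros hz. assert (hp := proj1 (Cmod_gt_0 z) hz).
apply (Cderiv_quad _ _ _ (2 / Cmod z ^ 3) (Cmod z / 2)). lra.
intros h hh.
assert (h1 := Cmod_triangle_inv z h).
assert (hzh : z + h <> RtoC 0) by (apply Cmod_gt_0; lra).
replace (/ (z + h) - / z - h * - / (z * z))
  with (h * h * (/ (z * z * (z + h)))) by (field; auto).
rewrite !Cmod_mult, Cmod_inv, !Cmod_mult by (repeat apply Cmult_neq_0; auto).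
replace (2 / Cmod z ^ 3 * Cmod h ^ 2)%R
  with (Cmod h * Cmod h * (/ (Cmod z * Cmod z * (Cmod z / 2))))%R by (field; lra).
apply Rmult_le_compat_l. apply Rmult_le_pos; apply Cmod_ge_0.
apply Rinv_le_contravar. apply Rmult_lt_0_compat; nra.
apply Rmult_le_compat_l; nra.
Qed.

Lemma Cderiv_Cmod_cont (f : C -> C) (z l : C) : Cderiv f z l ->
  forall eps : R, (0 < eps)%R -> exists d : R, (0 < d)%R /\
   forall y, (Cmod (y - z) < d -> Cmod (f y - f z) < eps)%R.
Proof.
intros H eps he. destruct (proj1 (Cderiv_iff f z l) H 1%R Rlt_0_1) as [d [hd Hd]].
assert (hl := Cmod_ge_0 l).
exists (Rmin d (eps / (2 + Cmod l))). split.
- apply Rmin_pos; [exact hd|]. apply Rdiv_lt_0_compat; lra.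
- intros y hy.
  assert (h1 := Rmin_l d (eps / (2 + Cmod l))). assert (h2 := Rmin_r d (eps / (2 + Cmod l))).
  specialize (Hd y ltac:(lra)).
  assert (h3 := Cmod_triangle (f y - f z - (y - z) * l) ((y - z) * l)).
  replace (f y - f z - (y - z) * l + (y - z) * l) with (f y - f z) in h3 by ring.
  rewrite Cmod_mult in h3.
  assert (h5 : (Cmod (y - z) * (2 + Cmod l) < eps)%R).
  { apply Rlt_le_trans with (eps / (2 + Cmod l) * (2 + Cmod l))%R;
      [apply Rmult_lt_compat_r; lra|]. right. field. lra. }
  nra.
Qed.

(** * The complex exponential *)

Lemma Cexp_pair (z : C) :
  Cexp z = ((exp (Re z) * cos (Im z))%R, (exp (Re z) * sin (Im z))%R).
Proof.
unfold Cexp, Ci, RtoC, Cmult, Cplus. simpl. f_equal; ring.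
Qed.

Lemma Cexp_R (x : R) : Cexp (RtoC x) = RtoC (exp x).
Proof. rewrite Cexp_pair. simpl. rewrite cos_0, sin_0. unfold RtoC. f_equal; ring. Qed.

Lemma Cexp_plus (x y : C) : Cexp (x + y) = Cexp x * Cexp y.
Proof.
rewrite !Cexp_pair. destruct x as [a b], y as [c d].
unfold Cmult, Cplus; simpl. rewrite exp_plus, cos_plus, sin_plus. f_equal; ring.
Qed.

Lemma Cexp_0 : Cexp (RtoC 0) = RtoC 1.
Proof. rewrite Cexp_pair. simpl. rewrite exp_0, cos_0, sin_0. unfold RtoC. f_equal; ring. Qed.

Lemma Cexp_opp_mult (x : C) : Cexp (- x) * Cexp x = RtoC 1.
Proof. rewrite <- Cexp_plus, <- Cexp_0. f_equal. ring. Qed.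

Lemma Cexp_neq_0 (x : C) : Cexp x <> RtoC 0.
Proof.
intros h. assert (e := Cexp_opp_mult x). rewrite h, Cmult_0_r in e.
apply C1_nz. rewrite e. reflexivity.
Qed.

Lemma Cexp_opp (x : C) : Cexp (- x) = / Cexp x.
Proof.
assert (h := Cexp_neq_0 x).
rewrite <- (Cmult_1_r (Cexp (- x))), <- (Cinv_r (Cexp x) h), Cmult_assoc, Cexp_opp_mult.
ring.
Qed.

Lemma Cexp_minus (x y : C) : Cexp (x - y) = Cexp x / Cexp y.
Proof. unfold Cminus, Cdiv. rewrite Cexp_plus, Cexp_opp. reflexivity. Qed.

Lemma Cmod_Cexp (x : C) : Cmod (Cexp x) = exp (Re x).
Proof.
rewrite Cexp_pair. unfold Cmod. simpl fst; simpl snd.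
replace ((exp (Re x) * cos (Im x)) ^ 2 + (exp (Re x) * sin (Im x)) ^ 2)%R
  with ((exp (Re x)) ^ 2 * ((sin (Im x))² + (cos (Im x))²))%R by (unfold Rsqr; ring).
rewrite sin2_cos2, Rmult_1_r. apply sqrt_pow2. left; apply exp_pos.
Qed.

Lemma re_le_Cmod' (c : C) : (Re c <= Cmod c)%R.
Proof. eapply Rle_trans; [apply Rle_abs|apply re_le_Cmod]. Qed.

Lemma im_le_Cmod (c : C) : (Rabs (Im c) <= Cmod c)%R.
Proof. eapply Rle_trans; [|apply Rmax_Cmod]. apply Rmax_r. Qed.

Lemma Cmod_le_re_im (c : C) : (Cmod c <= Rabs (Re c) + Rabs (Im c))%R.
Proof.
assert (h1 := Rabs_pos (Re c)). assert (h2 := Rabs_pos (Im c)).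
apply Rsqr_incr_0_var; [|lra]. unfold Rsqr.
replace (Cmod c * Cmod c)%R with (Cmod c ^ 2)%R by ring.
rewrite Cmod2_alt, <- (pow2_abs (Re c)), <- (pow2_abs (Im c)). nra.
Qed.

Lemma exp_quad (x : R) : (Rabs x <= 1 -> Rabs (exp x - 1 - x) <= x ^ 2)%R.
Proof.
intros h. apply Rabs_le_between in h.
assert (h1 := exp_ineq1_le x). rewrite Rabs_pos_eq by lra.
(* e^x <= 1 + x + x^2, because (1 + x + x^2) e^(-x) is minimal at 0 on [-1, 1]. *)
set (f := fun y : R => ((1 + y + y ^ 2) * exp (- y))%R).
assert (hd : forall y, is_derive f y ((y - y ^ 2) * exp (- y))%R).
{ intros y. unfold f. auto_derive. trivial. ring. }
assert (hm : forall y, -1 <= y <= 1 -> (1 <= f y)%R).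
{ intros y hy. destruct (MVT_gen f 0 y (fun y => (y - y ^ 2) * exp (- y))%R) as [c [hc e]].
  - intros; apply hd.
  - intros t _. apply continuity_pt_filterlim.
    apply (ex_derive_continuous f). eexists; apply hd.
  - assert (f0 : f 0%R = 1%R) by (unfold f; rewrite Ropp_0, exp_0; ring).
    rewrite f0 in e. assert (hc' := exp_pos (- c)).
    unfold Rmin, Rmax in hc.
    assert (0 <= (c - c ^ 2) * (y - 0))%R.
    { destruct (Rle_dec 0 y); simpl in hc; nra. }
    nra. }
specialize (hm x h). unfold f in hm.
assert (e : (exp (- x) * exp x = 1)%R) by (rewrite <- exp_plus, Rplus_opp_l; apply exp_0).
nra.
Qed.

Lemma cos_quad (y : R) : (Rabs (cos y - 1) <= y ^ 2)%R.
Proof.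
assert (h := COS_bound y).
rewrite Rabs_left1 by lra.
assert (e : (cos y = 1 - 2 * (sin (y / 2)) ^ 2)%R).
{ replace y with (2 * (y / 2))%R at 1 by field. rewrite cos_2a_sin. ring. }
assert (hs : (Rabs (sin (y / 2)) <= Rabs (y / 2))%R).
{ destruct (MVT_gen sin 0 (y / 2) cos) as [c [_ ec]].
  - intros t _. apply is_derive_Reals, derivable_pt_lim_sin.
  - intros t _. apply continuity_sin.
  - rewrite sin_0, !Rminus_0_r in ec. rewrite ec, Rabs_mult.
    assert (h' := COS_bound c). assert (Rabs (cos c) <= 1)%R by (apply Rabs_le; lra).
    assert (h2 := Rabs_pos (y / 2)). nra. }
assert (hs2 : ((sin (y / 2)) ^ 2 <= (y / 2) ^ 2)%R).
{ rewrite <- (pow2_abs (sin _)), <- (pow2_abs (y / 2)). apply pow_incr. split; [apply Rabs_pos|exact hs]. }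
nra.
Qed.

Lemma sin_quad (y : R) : (Rabs y <= 1 -> Rabs (sin y - y) <= y ^ 2)%R.
Proof.
intros hy.
destruct (MVT_gen (fun t => sin t - t)%R 0 y (fun t => cos t - 1)%R) as [c [hc ec]].
- intros t _. auto_derive. trivial. ring.
- intros t _. reg.
- rewrite sin_0, !Rminus_0_r in ec. rewrite ec, Rabs_mult.
  assert (h := cos_quad c).
  assert (hcy : (Rabs c <= Rabs y)%R).
  { unfold Rmin, Rmax in hc. destruct (Rle_dec 0 y); unfold Rabs; repeat destruct Rcase_abs; lra. }
  rewrite <- (pow2_abs c) in h. rewrite <- (pow2_abs y).
  assert (h1 := Rabs_pos c).
  apply Rle_trans with (Rabs c ^ 2 * Rabs y)%R; [apply Rmult_le_compat_r; lra|].
  assert (Rabs c ^ 2 <= Rabs c * Rabs y)%R by nra. nra.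
Qed.

(** With v = x + i y, the real part of the remainder is (e^x - 1 - x) + e^x (cos y - 1), at most 4
    |v|^2 since e^x <= 3; the imaginary part is (sin y - y) + (e^x - 1) sin y, at most 5 |v|^2. The
    sum is rounded up to 10. *)
Lemma Cexp_quad_small (v : C) :
  (Cmod v <= 1 -> Cmod (Cexp v - RtoC 1 - v) <= 10 * Cmod v ^ 2)%R.
Proof.
intros hv. rewrite Cexp_pair. set (x := Re v). set (y := Im v).
assert (hx : (Rabs x <= Cmod v)%R) by apply re_le_Cmod.
assert (hy : (Rabs y <= Cmod v)%R) by apply im_le_Cmod.
eapply Rle_trans. apply Cmod_le_re_im.
change (Rabs (exp x * cos y + - 1 + - x) + Rabs (exp x * sin y + - 0 + - y) <= 10 * Cmod v ^ 2)%R.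
assert (h1 := exp_quad x ltac:(lra)). assert (h2 := cos_quad y).
assert (h3 := sin_quad y ltac:(lra)).
rewrite <- (pow2_abs x) in h1. rewrite <- (pow2_abs y) in h2, h3.
set (c := Cmod v) in *.
assert (px := Rabs_pos x). assert (py := Rabs_pos y).
assert (ex3 : (exp x <= 3)%R).
{ apply Rle_trans with (exp 1); [|apply exp_le_3].
  assert (x <= 1)%R by (assert (t := Rle_abs x); lra).
  destruct (Rle_lt_or_eq_dec x 1 H) as [q|q].
  left; apply exp_increasing; exact q. rewrite q; lra. }
assert (e1 : (Rabs (exp x - 1) <= 2 * Rabs x)%R).
{ replace (exp x - 1)%R with ((exp x - 1 - x) + x)%R by ring.
  eapply Rle_trans; [apply Rabs_triang|]. nra. }
assert (s1 : (Rabs (sin y) <= 2 * Rabs y)%R).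
{ replace (sin y)%R with ((sin y - y) + y)%R by ring.
  eapply Rle_trans; [apply Rabs_triang|]. nra. }
assert (a1 : (Rabs (exp x * cos y + - 1 + - x) <= 4 * c ^ 2)%R).
{ replace (exp x * cos y + - 1 + - x)%R with ((exp x - 1 - x) + exp x * (cos y - 1))%R by ring.
  eapply Rle_trans; [apply Rabs_triang|]. rewrite Rabs_mult, (Rabs_pos_eq (exp x)) by (left; apply exp_pos).
  assert (q' := Rabs_pos (cos y - 1)). nra. }
assert (a2 : (Rabs (exp x * sin y + - 0 + - y) <= 5 * c ^ 2)%R).
{ replace (exp x * sin y + - 0 + - y)%R with ((sin y - y) + (exp x - 1) * sin y)%R by ring.
  eapply Rle_trans; [apply Rabs_triang|]. rewrite Rabs_mult.
  assert (q := Rabs_pos (exp x - 1)). assert (q' := Rabs_pos (sin y)).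
  assert (Rabs (exp x - 1) * Rabs (sin y) <= 2 * Rabs x * (2 * Rabs y))%R by (apply Rmult_le_compat; lra).
  nra. }
nra.
Qed.

Lemma exp_INR (x : R) (n : nat) : exp (INR n * x) = (exp x ^ n)%R.
Proof.
induction n. simpl. rewrite Rmult_0_l. apply exp_0.
rewrite S_INR, Rmult_plus_distr_r, exp_plus, IHn, Rmult_1_l. simpl. ring.
Qed.

Lemma INR_lt_pow2 (n : nat) : (INR n + 1 <= 2 ^ n)%R.
Proof.
induction n. simpl. lra. rewrite S_INR. simpl. assert (1 <= 2 ^ n)%R by (apply pow_R1_Rle; lra). lra.
Qed.

Lemma exp_ge_1 (x : R) : (0 <= x -> 1 <= exp x)%R.
Proof. intros h. assert (q := exp_ineq1_le x). lra. Qed.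

Lemma exp_le (x y : R) : (x <= y -> exp x <= exp y)%R.
Proof.
intros h. destruct (Rle_lt_or_eq_dec x y h) as [q|q].
left; apply exp_increasing; exact q. rewrite q; lra.
Qed.

(** For |v| > 1 the triangle inequality suffices. A bound without restriction on [v] is needed when
    a Laurent series is differentiated termwise, where the exponents (k - h) v are unbounded in
    k. *)
Lemma Cexp_quad (v : C) :
  (Cmod (Cexp v - RtoC 1 - v) <= 10 * Cmod v ^ 2 * exp (Cmod v))%R.
Proof.
assert (h0 := Cmod_ge_0 v). assert (h1 := exp_ge_1 _ h0).
destruct (Rle_dec (Cmod v) 1) as [h|h].
- assert (q := Cexp_quad_small v h). nra.
- assert (h2 := Cmod_triangle_minus (Cexp v - RtoC 1) v).
  assert (h3 := Cmod_triangle_minus (Cexp v) (RtoC 1)).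
  rewrite Cmod_1, Cmod_Cexp in h3.
  assert (h4 := exp_le _ _ (re_le_Cmod' v)).
  assert (h5 := exp_ineq1_le (Cmod v)).
  assert (h6 : (1 <= Cmod v ^ 2)%R) by nra.
  assert (h7 : (1 * exp (Cmod v) <= Cmod v ^ 2 * exp (Cmod v))%R)
    by (apply Rmult_le_compat_r; lra). lra.
Qed.

Lemma Cderiv_Cexp (z : C) : Cderiv Cexp z (Cexp z).
Proof.
apply (Cderiv_quad _ _ _ (Cmod (Cexp z) * 10) 1). lra.
intros h hh. rewrite Cexp_plus.
replace (Cexp z * Cexp h - Cexp z - h * Cexp z) with (Cexp z * (Cexp h - RtoC 1 - h)) by ring.
rewrite Cmod_mult, Rmult_assoc. apply Rmult_le_compat_l. apply Cmod_ge_0.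
apply Cexp_quad_small. lra.
Qed.

(** Comparing moduli gives equal real parts; then 1 - cos t = 2 sin^2 (t/2) vanishes for a t with
    |t/2| < pi. This is what makes nearby branches of the logarithm coincide. *)
Lemma Cexp_eq (x y : C) :
  Cexp x = Cexp y -> (Rabs (Im x - Im y) < 2 * PI)%R -> x = y.
Proof.
intros h hi.
assert (e : Cexp (x - y) = RtoC 1).
{ rewrite Cexp_minus, h. field. apply Cexp_neq_0. }
assert (hr : Re (x - y) = 0%R).
{ apply (f_equal Cmod) in e. rewrite Cmod_Cexp, Cmod_1, <- exp_0 in e.
  now apply exp_inv. }
rewrite Cexp_pair, hr, exp_0, !Rmult_1_l in e.
set (t := Im (x - y)) in *.
apply (f_equal fst) in e. change (cos t = 1%R) in e.
assert (et : (t = Im x - Im y)%R) by (unfold t; destruct x, y; reflexivity).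
rewrite <- et in hi.
assert (es : (sin (t / 2) = 0)%R).
{ replace t with (2 * (t / 2))%R in e by field. rewrite cos_2a_sin in e. nra. }
assert (t0 : t = 0%R).
{ apply Rabs_def2 in hi. destruct (Rtotal_order t 0) as [q|[q|q]]; auto.
  - assert (0 < sin (- (t / 2)))%R by (apply sin_gt_0; lra). rewrite sin_neg in H. lra.
  - assert (0 < sin (t / 2))%R by (apply sin_gt_0; lra). lra. }
assert (x - y = RtoC 0).
{ rewrite (surjective_pairing (x - y)). unfold RtoC. f_equal; [exact hr|exact t0]. }
now apply Ceq_minus.
Qed.

(** * A branch of the logarithm *)

(** The principal logarithm, but only on the half-plane Re z > 0: elsewhere [atan] does not return
    the argument. *)
Definition Clog (z : C) : C := (ln (Cmod z), atan (Im z / Re z)).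

Lemma Cexp_Clog (z : C) : (0 < Re z)%R -> Cexp (Clog z) = z.
Proof.
intros h. rewrite Cexp_pair. unfold Clog. simpl Re; simpl Im.
assert (hz : (0 < Cmod z)%R) by (assert (q := re_le_Cmod' z); lra).
rewrite exp_ln by exact hz.
rewrite cos_atan, sin_atan.
assert (e : (sqrt (1 + (Im z / Re z)²) = Cmod z / Re z)%R).
{ apply sqrt_lem_1.
  - assert (q := Rle_0_sqr (Im z / Re z)). lra.
  - left. apply Rdiv_lt_0_compat; lra.
  - replace (Cmod z / Re z * (Cmod z / Re z))%R with (Cmod z ^ 2 / Re z ^ 2)%R by (field; lra).
    rewrite Cmod2_alt. unfold Rsqr. field. lra. }
rewrite e. transitivity (Re z, Im z); [|symmetry; apply surjective_pairing].
apply f_equal2; field; lra.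
Qed.

Lemma Im_Clog (z : C) : (- PI / 2 < Im (Clog z) < PI / 2)%R.
Proof. apply atan_bound. Qed.

Lemma Clog_Cexp (v : C) : (- PI / 2 < Im v < PI / 2)%R -> Clog (Cexp v) = v.
Proof.
intros h. assert (hc : (0 < Re (Cexp v))%R).
{ rewrite Cexp_pair. simpl. apply Rmult_lt_0_compat. apply exp_pos. apply cos_gt_0; lra. }
apply Cexp_eq. apply Cexp_Clog, hc.
assert (q := Im_Clog (Cexp v)). apply Rabs_def1; lra.
Qed.

Lemma Cderiv_Clog (z : C) : (0 < Re z)%R -> Cderiv Clog z (/ z).
Proof.
intros h.
assert (hz : z <> RtoC 0) by (intros e; rewrite e in h; simpl in h; lra).
assert (hp := proj1 (Cmod_gt_0 z) hz).
(* Continuity of Clog suffices: its increment v satisfies k = z (e^v - 1). *)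
assert (hc : exists d, (0 < d)%R /\ forall k, (Cmod k < d)%R ->
   (0 < Re (z + k))%R /\ (Cmod (Clog (z + k) - Clog z) <= 1 / 20)%R).
{ assert (c1 : continuity_pt ln (Cmod z)) by (apply derivable_continuous_pt; exists (/ Cmod z)%R; apply derivable_pt_lim_ln; exact hp).
  assert (c2 := derivable_continuous_pt atan (Im z / Re z) (derivable_pt_atan _)).
  destruct (c1 (1 / 40)%R ltac:(lra)) as [a1 [ha1 H1]].
  destruct (c2 (1 / 40)%R ltac:(lra)) as [a2 [ha2 H2]].
  assert (hx : (0 < 2 * (Cmod z + Re z) / (Re z ^ 2))%R) by (apply Rdiv_lt_0_compat; nra).
  exists (Rmin (Rmin a1 (Re z / 2)) (a2 / (2 * (Cmod z + Re z) / (Re z ^ 2)))).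
  split. { repeat apply Rmin_pos; try lra. apply Rdiv_lt_0_compat; lra. }
  intros k hk.
  assert (hk1 : (Cmod k < a1)%R) by (eapply Rlt_le_trans; [exact hk|]; eapply Rle_trans; [apply Rmin_l|apply Rmin_l]).
  assert (hk2 : (Cmod k < Re z / 2)%R) by (eapply Rlt_le_trans; [exact hk|]; eapply Rle_trans; [apply Rmin_l|apply Rmin_r]).
  assert (hk3 : (Cmod k * (2 * (Cmod z + Re z) / (Re z ^ 2)) < a2)%R).
  { apply Rlt_le_trans with (a2 / (2 * (Cmod z + Re z) / (Re z ^ 2)) * (2 * (Cmod z + Re z) / (Re z ^ 2)))%R.
    apply Rmult_lt_compat_r; [lra|]. eapply Rlt_le_trans; [exact hk|apply Rmin_r].
    right. field. split; nra. }
  clear hk.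
  assert (r1 := re_le_Cmod k). assert (r2 := im_le_Cmod k). assert (rz := im_le_Cmod z).
  apply Rabs_le_between in r1.
  assert (er : Re (z + k) = (Re z + Re k)%R) by (destruct z, k; reflexivity).
  assert (ei : Im (z + k) = (Im z + Im k)%R) by (destruct z, k; reflexivity).
  split. rewrite er; lra.
  eapply Rle_trans; [apply Cmod_le_re_im|].
  change (Rabs (ln (Cmod (z + k)) + - ln (Cmod z)) + Rabs (atan (Im (z + k) / Re (z + k)) + - atan (Im z / Re z)) <= 1 / 20)%R.
  assert (b1 : (Rabs (ln (Cmod (z + k)) - ln (Cmod z)) < 1 / 40)%R).
  { destruct (Req_dec (Cmod (z + k)) (Cmod z)) as [e|e]. rewrite e, Rminus_diag, Rabs_R0; lra.
    apply H1. split. split; [exact I|auto].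
    change (Rabs (Cmod (z + k) - Cmod z) < a1)%R.
    apply Rle_lt_trans with (Cmod k); [|exact hk1].
    assert (t1 := Cmod_triangle z k). assert (t2 := Cmod_triangle_inv z k).
    apply Rabs_le; lra. }
  assert (b2 : (Rabs (atan (Im (z + k) / Re (z + k)) - atan (Im z / Re z)) < 1 / 40)%R).
  { destruct (Req_dec (Im (z + k) / Re (z + k)) (Im z / Re z)) as [e|e]. rewrite e, Rminus_diag, Rabs_R0; lra.
    apply H2. split. split; [exact I|auto].
    change (Rabs (Im (z + k) / Re (z + k) - Im z / Re z) < a2)%R.
    eapply Rle_lt_trans; [|exact hk3].
    rewrite er, ei.
    replace ((Im z + Im k) / (Re z + Re k) - Im z / Re z)%R
      with ((Re z * Im k - Im z * Re k) * / (Re z * (Re z + Re k)))%R by (field; lra).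
    rewrite Rabs_mult, (Rabs_pos_eq (/ _)) by (left; apply Rinv_0_lt_compat; nra).
    replace (Cmod k * (2 * (Cmod z + Re z) / Re z ^ 2))%R
      with ((Cmod k * (Cmod z + Re z)) * / (Re z * (Re z / 2)))%R by (field; lra).
    apply Rmult_le_compat. apply Rabs_pos. left; apply Rinv_0_lt_compat; nra.
    - eapply Rle_trans; [apply Rabs_triang|]. rewrite Rabs_Ropp, !Rabs_mult.
      rewrite (Rabs_pos_eq (Re z)) by lra.
      assert (Rabs (Re k) <= Cmod k)%R by apply re_le_Cmod.
      assert (q2 := Rabs_pos (Im z)). assert (q3 := Rabs_pos (Re k)).
      assert (Rabs (Im z) * Rabs (Re k) <= Cmod z * Cmod k)%R by (apply Rmult_le_compat; lra).
      nra.
    - apply Rinv_le_contravar; nra. }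
  unfold Rminus in b1, b2. lra. }
destruct hc as [d [hd H]].
apply (Cderiv_quad _ _ _ (40 / Cmod z ^ 2) d). exact hd.
intros k hk. destruct (H k hk) as [h1 h2].
set (v := Clog (z + k) - Clog z) in *.
assert (ek : k = z * (Cexp v - RtoC 1)).
{ unfold v. rewrite Cexp_minus, !Cexp_Clog by assumption. field. exact hz. }
assert (q := Cexp_quad_small v ltac:(lra)).
assert (hv := Cmod_ge_0 v).
(* As |v| <= 1/20, the remainder 10 |v|^2 is at most |v|/2, hence |v| <= 2 |e^v - 1| = 2 |k/z|.
   Inserted into 10 |v|^2 this gives the constant 40. *)
assert (b : (Cmod v <= 2 * (Cmod k / Cmod z))%R).
{ assert (t := Cmod_triangle_minus (Cexp v - RtoC 1) (Cexp v - RtoC 1 - v)).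
  replace (Cexp v - RtoC 1 - (Cexp v - RtoC 1 - v)) with v in t by ring.
  replace (Cmod k / Cmod z)%R with (Cmod (Cexp v - RtoC 1)).
  nra. rewrite ek at 1. rewrite Cmod_mult. field. lra. }
replace (v - k * / z) with (- (Cexp v - RtoC 1 - v)).
2:{ rewrite ek at 1. field. exact hz. }
rewrite Cmod_opp. eapply Rle_trans; [exact q|].
replace (40 / Cmod z ^ 2 * Cmod k ^ 2)%R with (10 * (2 * (Cmod k / Cmod z)) ^ 2)%R by (field; lra).
apply Rmult_le_compat_l; [lra|]. apply pow_incr. lra.
Qed.

Lemma Cexp_PI : Cexp (RtoC PI * Ci) = RtoC (-1).
Proof.
rewrite Cexp_pair. simpl.
replace (PI * 0 - 0 * 1)%R with 0%R by ring. replace (PI * 1 + 0 * 0)%R with PI by ring.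
rewrite exp_0, cos_PI, sin_PI. unfold RtoC. f_equal; ring.
Qed.

Lemma Cexp_2PI : Cexp (RtoC (2 * PI) * Ci) = RtoC 1.
Proof.
replace (RtoC (2 * PI) * Ci) with (RtoC PI * Ci + RtoC PI * Ci) by (rewrite RtoC_mult; ring).
rewrite Cexp_plus, Cexp_PI, <- RtoC_mult. f_equal; ring.
Qed.

Lemma Cexp_surj (z : C) : z <> RtoC 0 -> exists w, Cexp w = z.
Proof.
(* Multiplication by a fourth root of unity moves z to the half-plane Re > 0. *)
assert (hpos : forall u c, Cexp c = u -> (0 < Re (u * z))%R -> exists w, Cexp w = z).
{ intros u c hc h. exists (Clog (u * z) - c).
  rewrite Cexp_minus, Cexp_Clog, hc by exact h. field. rewrite <- hc. apply Cexp_neq_0. }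
assert (hi : Cexp (RtoC (PI / 2) * Ci) = Ci).
{ rewrite Cexp_pair. simpl. replace (PI / 2 * 0 - 0 * 1)%R with 0%R by ring. replace (PI / 2 * 1 + 0 * 0)%R with (PI / 2)%R by ring.
  rewrite exp_0, cos_PI2, sin_PI2. unfold Ci. f_equal; ring. }
assert (hi' : Cexp (- (RtoC (PI / 2) * Ci)) = - Ci).
{ rewrite Cexp_opp, hi. apply Ci_inv. }
intros hz. destruct z as [x y].
destruct (Rtotal_order x 0) as [q|[q|q]].
- apply (hpos _ _ Cexp_PI). simpl. lra.
- destruct (Rtotal_order y 0) as [r|[r|r]].
  + apply (hpos _ _ hi). simpl. lra.
  + exfalso. apply hz. rewrite q, r. reflexivity.
  + apply (hpos _ _ hi'). simpl. lra.
- apply (hpos _ _ Cexp_0). simpl. lra.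
Qed.

(** * Limits and series of complex numbers *)

Definition Clim (u : nat -> C) (l : C) : Prop :=
  forall eps : R, (0 < eps)%R ->
  exists N, forall n, (N <= n)%nat -> (Cmod (u n - l) < eps)%R.

Lemma Clim_unique (u : nat -> C) (l m : C) : Clim u l -> Clim u m -> l = m.
Proof.
intros H1 H2. apply Ceq_minus, Cmod_eq_0.
destruct (Rle_lt_or_eq_dec 0 _ (Cmod_ge_0 (l - m))) as [h|h]; [exfalso|now symmetry].
destruct (H1 (Cmod (l - m) / 2)%R ltac:(lra)) as [N1 h1].
destruct (H2 (Cmod (l - m) / 2)%R ltac:(lra)) as [N2 h2].
specialize (h1 (N1 + N2)%nat ltac:(lia)). specialize (h2 (N1 + N2)%nat ltac:(lia)).
assert (t := Cmod_triangle_minus (u (N1 + N2)%nat - m) (u (N1 + N2)%nat - l)).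
replace (u (N1 + N2)%nat - m - (u (N1 + N2)%nat - l)) with (l - m) in t by ring. lra.
Qed.

Lemma Clim_ext (u v : nat -> C) (l : C) : (forall n, u n = v n) -> Clim u l -> Clim v l.
Proof. intros e H eps he. destruct (H eps he) as [N h]. exists N. intros n hn. rewrite <- e. auto. Qed.

Lemma Clim_plus (u v : nat -> C) (l m : C) :
  Clim u l -> Clim v m -> Clim (fun n => u n + v n) (l + m).
Proof.
intros H1 H2 e he. destruct (H1 (e / 2)%R ltac:(lra)) as [N1 h1].
destruct (H2 (e / 2)%R ltac:(lra)) as [N2 h2]. exists (N1 + N2)%nat. intros n hn.
specialize (h1 n ltac:(lia)). specialize (h2 n ltac:(lia)).
replace (u n + v n - (l + m)) with ((u n - l) + (v n - m)) by ring.
eapply Rle_lt_trans; [apply Cmod_triangle|]. lra.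
Qed.

Lemma Clim_scal (c : C) (u : nat -> C) (l : C) :
  Clim u l -> Clim (fun n => c * u n) (c * l).
Proof.
intros H e he. assert (hc := Cmod_ge_0 c).
destruct (H (e / (Cmod c + 1))%R) as [N h]. apply Rdiv_lt_0_compat; lra.
exists N. intros n hn. specialize (h n hn).
replace (c * u n - c * l) with (c * (u n - l)) by ring. rewrite Cmod_mult.
assert (h0 := Cmod_ge_0 (u n - l)).
apply Rle_lt_trans with (Cmod (u n - l) * (Cmod c + 1))%R. nra.
apply Rlt_le_trans with (e / (Cmod c + 1) * (Cmod c + 1))%R.
apply Rmult_lt_compat_r; lra. right; field; lra.
Qed.

Lemma Clim_S (u : nat -> C) (l : C) : Clim u l -> Clim (fun n => u (S n)) l.
Proof. intros H e he. destruct (H e he) as [N h]. exists N. intros n hn. apply h. lia. Qed.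

Lemma Clim_bound (u : nat -> C) (l c : C) (b : R) :
  Clim u l -> (forall n, (Cmod (u n - c) <= b)%R) -> (Cmod (l - c) <= b)%R.
Proof.
intros H h. apply Rnot_lt_le. intros q.
destruct (H (Cmod (l - c) - b)%R ltac:(lra)) as [N hN]. specialize (hN N (le_n _)).
specialize (h N). assert (t := Cmod_triangle_minus (u N - c) (u N - l)).
replace (u N - c - (u N - l)) with (l - c) in t by ring. lra.
Qed.

Lemma Re_minus (z w : C) : Re (z - w) = (Re z - Re w)%R.
Proof. destruct z, w; reflexivity. Qed.

Lemma Im_minus (z w : C) : Im (z - w) = (Im z - Im w)%R.
Proof. destruct z, w; reflexivity. Qed.

Lemma CLim_seq_unique (u : nat -> C) (l : C) : Clim u l -> CLim_seq u = l.
Proof.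
intros H. unfold CLim_seq.
assert (hr : is_lim_seq (fun n => Re (u n)) (Re l)).
{ apply is_lim_seq_spec. intros eps. destruct (H eps (cond_pos eps)) as [N h].
  exists N. intros n hn. specialize (h n hn). assert (t := re_le_Cmod (u n - l)).
  rewrite Re_minus in t. lra. }
assert (hi : is_lim_seq (fun n => Im (u n)) (Im l)).
{ apply is_lim_seq_spec. intros eps. destruct (H eps (cond_pos eps)) as [N h].
  exists N. intros n hn. specialize (h n hn). assert (t := im_le_Cmod (u n - l)).
  rewrite Im_minus in t. lra. }
apply is_lim_seq_unique in hr. apply is_lim_seq_unique in hi.
rewrite hr, hi. symmetry. apply surjective_pairing.
Qed.

Lemma Clim_cauchy (u : nat -> C) (t : nat -> R) :
  is_lim_seq t 0%R ->
  (forall n m, (n <= m)%nat -> (Cmod (u m - u n) <= t n)%R) ->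
  exists l, Clim u l /\ forall n, (Cmod (l - u n) <= t n)%R.
Proof.
intros ht H.
assert (ht' : forall eps : R, (0 < eps)%R -> exists N, (t N < eps)%R).
{ intros e he. apply is_lim_seq_spec in ht. destruct (ht (mkposreal e he)) as [N h].
  exists N. specialize (h N (le_n _)). simpl in h. rewrite Rminus_0_r in h.
  assert (q := Rle_abs (t N)). lra. }
assert (comp : forall f : C -> R, (forall z w, (Rabs (f z - f w) <= Cmod (z - w))%R) ->
  ex_finite_lim_seq (fun n => f (u n))).
{ intros f hf. apply ex_lim_seq_cauchy_corr. intros eps. destruct (ht' (eps / 2)%R) as [N hN].
  assert (q := cond_pos eps); lra. exists N. intros n m hn hm.
  assert (a := H N n hn). assert (b := H N m hm).
  assert (a' := hf (u n) (u N)). assert (b' := hf (u m) (u N)).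
  apply Rabs_le_between in a'. apply Rabs_le_between in b'. apply Rabs_def1; lra. }
destruct (comp Re) as [x hx]. { intros z w. rewrite <- Re_minus. apply re_le_Cmod. }
destruct (comp Im) as [y hy]. { intros z w. rewrite <- Im_minus. apply im_le_Cmod. }
assert (hl : Clim u (x, y)).
{ intros e he. apply is_lim_seq_spec in hx. apply is_lim_seq_spec in hy.
  destruct (hx (mkposreal (e / 2) ltac:(lra))) as [N1 h1].
  destruct (hy (mkposreal (e / 2) ltac:(lra))) as [N2 h2].
  exists (N1 + N2)%nat. intros n hn. specialize (h1 n ltac:(lia)). specialize (h2 n ltac:(lia)).
  simpl in h1, h2. eapply Rle_lt_trans; [apply Cmod_le_re_im|].
  change (Rabs (Re (u n) - x) + Rabs (Im (u n) - y) < e)%R. lra. }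
exists (x, y). split. exact hl.
intros n. apply (Clim_bound (fun k => u (k + n)%nat)).
- intros e he. destruct (hl e he) as [N h]. exists N. intros k hk. apply h. lia.
- intros k. apply H. lia.
Qed.

Fixpoint csum (f : nat -> C) (n : nat) : C :=
  match n with O => RtoC 0 | S n => csum f n + f n end.

Lemma csum_ext (f g : nat -> C) (n : nat) : (forall k, f k = g k) -> csum f n = csum g n.
Proof. intros e. induction n; simpl; [|rewrite IHn, e]; reflexivity. Qed.

Lemma csum_plus (f g : nat -> C) (n : nat) : csum (fun k => f k + g k) n = csum f n + csum g n.
Proof. induction n; simpl; [|rewrite IHn]; ring. Qed.

Lemma csum_scal (c : C) (f : nat -> C) (n : nat) : csum (fun k => c * f k) n = c * csum f n.
Proof. induction n; simpl; [|rewrite IHn]; ring. Qed.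

Definition Cser (f : nat -> C) (l : C) : Prop := Clim (csum f) l.

Lemma Cser_ext (f g : nat -> C) (l : C) : (forall k, f k = g k) -> Cser f l -> Cser g l.
Proof. intros e. apply Clim_ext. intros n. apply csum_ext, e. Qed.

Lemma Cser_plus (f g : nat -> C) (l m : C) : Cser f l -> Cser g m -> Cser (fun k => f k + g k) (l + m).
Proof.
intros H1 H2. apply (Clim_ext (fun n => csum f n + csum g n)).
intros n. symmetry. apply csum_plus. apply Clim_plus; assumption.
Qed.

Lemma Cser_scal (c : C) (f : nat -> C) (l : C) : Cser f l -> Cser (fun k => c * f k) (c * l).
Proof.
intros H1. apply (Clim_ext (fun n => c * csum f n)).
intros n. symmetry. apply csum_scal. apply Clim_scal; assumption.
Qed.

Lemma Cser_single (f : nat -> C) (m : nat) : (forall n, n <> m -> f n = RtoC 0) -> Cser f (f m).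
Proof.
intros H e he. exists (S m).
assert (h0 : forall n, (n <= m)%nat -> csum f n = RtoC 0).
{ induction n; intros hn; simpl; [reflexivity|]. rewrite IHn, H by lia. ring. }
assert (h1 : forall k, csum f (S m + k) = f m).
{ induction k. rewrite Nat.add_0_r. simpl. rewrite h0 by lia. ring.
  rewrite Nat.add_succ_r. change (csum f (S m + k) + f (S m + k)%nat = f m). rewrite IHk, (H (S m + k)%nat) by lia. ring. }
intros n hn. replace n with (S m + (n - S m))%nat by lia. rewrite h1.
replace (f m - f m) with (RtoC 0) by ring. rewrite Cmod_0. exact he.
Qed.

(** The exact geometric sum stays in the bound, including the term q^(n + k), so that the induction
    on [k] closes. *)
Lemma csum_geom_tail (f : nat -> C) (K q : R) :
  (0 <= q < 1)%R -> (forall n, (Cmod (f n) <= K * q ^ n)%R) ->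
  forall n k, (Cmod (csum f (n + k)%nat - csum f n) <= K * (q ^ n - q ^ (n + k)) / (1 - q))%R.
Proof.
intros hq H n. induction k.
- rewrite Nat.add_0_r. replace (csum f n - csum f n) with (RtoC 0) by ring.
  rewrite Cmod_0. right. field. lra.
- rewrite Nat.add_succ_r. simpl csum at 1.
  replace (csum f (n + k)%nat + f (n + k)%nat - csum f n)
    with ((csum f (n + k)%nat - csum f n) + f (n + k)%nat) by ring.
  eapply Rle_trans; [apply Cmod_triangle|].
  specialize (H (n + k)%nat).
  apply Rle_trans with (K * (q ^ n - q ^ (n + k)) / (1 - q) + K * q ^ (n + k))%R; [lra|].
  right. simpl pow. field. lra.
Qed.

Lemma Cser_geom (f : nat -> C) (K q : R) :
  (0 <= q < 1)%R -> (forall n, (Cmod (f n) <= K * q ^ n)%R) ->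
  exists l, Cser f l /\ forall n, (Cmod (l - csum f n) <= K * q ^ n / (1 - q))%R.
Proof.
intros hq H.
assert (hK : (0 <= K)%R).
{ specialize (H 0%nat). simpl in H. assert (h := Cmod_ge_0 (f 0%nat)). lra. }
apply Clim_cauchy.
- replace (Finite 0) with (Rbar_mult (Finite (K / (1 - q))%R) (Finite 0)) by (simpl; f_equal; ring).
  apply is_lim_seq_ext with (fun n => (K / (1 - q) * q ^ n)%R).
  intros n. field. lra. apply is_lim_seq_scal_l, is_lim_seq_geom. apply Rabs_def1; lra.
- intros n m hm. replace m with (n + (m - n))%nat by lia.
  eapply Rle_trans. apply csum_geom_tail with (K := K) (q := q); assumption.
  assert (h := pow_le q (n + (m - n)) (proj1 hq)).
  unfold Rdiv. apply Rmult_le_compat_r. left; apply Rinv_0_lt_compat; lra.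
  apply Rmult_le_compat_l; lra.
Qed.

(* The value is unspecified when the series diverges. *)
Definition CSeries (f : nat -> C) : C := epsilon (inhabits (RtoC 0)) (Cser f).

Lemma CSeries_correct (f : nat -> C) (K q : R) :
  (0 <= q < 1)%R -> (forall n, (Cmod (f n) <= K * q ^ n)%R) ->
  Cser f (CSeries f) /\ forall n, (Cmod (CSeries f - csum f n) <= K * q ^ n / (1 - q))%R.
Proof.
intros hq H. destruct (Cser_geom f K q hq H) as [l [h1 h2]].
assert (h3 : Cser f (CSeries f)) by (unfold CSeries; apply (epsilon_spec (inhabits (RtoC 0)) (Cser f)); exists l; exact h1).
split. exact h3. rewrite (Clim_unique _ (CSeries f) l h3 h1). exact h2.
Qed.

Lemma CSeries_unique (f : nat -> C) (l : C) : Cser f l -> CSeries f = l.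
Proof.
intros H. apply (Clim_unique (csum f)); [|exact H].
apply (epsilon_spec (inhabits (RtoC 0)) (Cser f)). exists l. exact H.
Qed.

Lemma CSeries_ext (f g : nat -> C) : (forall n, f n = g n) -> CSeries f = CSeries g.
Proof.
intros e. assert (h : f = g) by (apply FunctionalExtensionality.functional_extensionality; exact e).
now rewrite h.
Qed.

(** The remainders of the terms sum to at most K / (1 - q) |h|^2, which is a quadratic remainder for
    the sum. The first two bounds guarantee that the series of values and of derivatives
    converge. *)
Lemma Cderiv_CSeries (f f' : nat -> C -> C) (z : C) (q K d : R) :
  (0 <= q < 1)%R -> (0 < d)%R ->
  (forall n h, (Cmod h < d -> Cmod (f n (z + h)%C) <= K * q ^ n)%R) ->
  (forall n, (Cmod (f' n z) <= K * q ^ n)%R) ->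
  (forall n h, (Cmod h < d ->
     Cmod (f n (z + h)%C - f n z - h * f' n z) <= K * q ^ n * Cmod h ^ 2)%R) ->
  Cderiv (fun y => CSeries (fun n => f n y)) z (CSeries (fun n => f' n z)).
Proof.
intros hq hd H0 H1 H2.
apply (Cderiv_quad _ _ _ (K / (1 - q)) d hd). intros h hh.
assert (s1 := proj1 (CSeries_correct (fun n => f n (z + h)) K q hq (fun n => H0 n h hh))).
(* The bound at [z] itself is the bound for the increment 0, transported along z + 0 = z. *)
assert (s2 := proj1 (CSeries_correct (fun n => f n z) K q hq
   (fun n => eq_rect (z + RtoC 0) (fun y => (Cmod (f n y) <= K * q ^ n)%R) (H0 n (RtoC 0) ltac:(rewrite Cmod_0; exact hd)) z (Cplus_0_r z)))).
assert (s3 := proj1 (CSeries_correct (fun n => f' n z) K q hq H1)).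
set (S1 := CSeries (fun n => f n (z + h))) in *.
set (S2 := CSeries (fun n => f n z)) in *.
set (S3 := CSeries (fun n => f' n z)) in *.
assert (s : Cser (fun n => f n (z + h) - f n z - h * f' n z) (S1 - S2 - h * S3)).
{ apply (Cser_ext (fun n => (f n (z + h) + (RtoC (-1)) * f n z) + (- h) * f' n z)).
  intros n. ring.
  replace (S1 - S2 - h * S3) with ((S1 + RtoC (-1) * S2) + (- h) * S3).
  apply Cser_plus; [apply Cser_plus|]; try apply Cser_scal; assumption.
  ring. }
destruct (Cser_geom (fun n => f n (z + h) - f n z - h * f' n z) (K * Cmod h ^ 2) q hq) as [l [l1 l2]].
{ intros n. eapply Rle_trans. apply H2, hh. right; ring. }
rewrite (Clim_unique _ _ _ s l1). specialize (l2 0%nat). simpl csum in l2.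
replace (l - RtoC 0) with l in l2 by ring. eapply Rle_trans; [exact l2|].
right. simpl. field. lra.
Qed.

(** * Complex-valued functions of a real variable *)

(** Componentwise, as the integral [CInt] will be, so that the theorems of real integration apply to
    both parts. *)
Definition Ccont (f : R -> C) (t : R) : Prop :=
  continuous (fun s => Re (f s)) t /\ continuous (fun s => Im (f s)) t.

Definition Rderiv (f : R -> C) (t : R) (l : C) : Prop :=
  is_derive (fun s => Re (f s)) t (Re l) /\ is_derive (fun s => Im (f s)) t (Im l).

Lemma Ccont_const (c : C) (t : R) : Ccont (fun _ => c) t.
Proof. split; apply continuous_const. Qed.

Lemma Ccont_plus (f g : R -> C) (t : R) : Ccont f t -> Ccont g t -> Ccont (fun s => f s + g s) t.
Proof.
intros [h1 h2] [h3 h4]. split.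
- apply (continuous_plus (fun s => Re (f s)) (fun s => Re (g s))); assumption.
- apply (continuous_plus (fun s => Im (f s)) (fun s => Im (g s))); assumption.
Qed.

Lemma Ccont_mult (f g : R -> C) (t : R) : Ccont f t -> Ccont g t -> Ccont (fun s => f s * g s) t.
Proof.
intros [h1 h2] [h3 h4]. split.
- apply (continuous_minus (fun s => Re (f s) * Re (g s))%R (fun s => Im (f s) * Im (g s))%R);
  [apply (continuous_mult (fun s => Re (f s)) (fun s => Re (g s)))
  |apply (continuous_mult (fun s => Im (f s)) (fun s => Im (g s)))]; assumption.
- apply (continuous_plus (fun s => Re (f s) * Im (g s))%R (fun s => Im (f s) * Re (g s))%R);
  [apply (continuous_mult (fun s => Re (f s)) (fun s => Im (g s)))
  |apply (continuous_mult (fun s => Im (f s)) (fun s => Re (g s)))]; assumption.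
Qed.

Lemma Ccont_minus (f g : R -> C) (t : R) : Ccont f t -> Ccont g t -> Ccont (fun s => f s - g s) t.
Proof.
intros [h1 h2] [h3 h4]. split.
- apply (continuous_minus (fun s => Re (f s)) (fun s => Re (g s))); assumption.
- apply (continuous_minus (fun s => Im (f s)) (fun s => Im (g s))); assumption.
Qed.

Lemma Ccont_ext_loc (f g : R -> C) (t d : R) :
  (0 < d)%R -> (forall s, (Rabs (s - t) < d)%R -> f s = g s) -> Ccont f t -> Ccont g t.
Proof.
intros hd e [h1 h2]. split.
- apply (continuous_ext_loc (fun s => Re (g s)) (fun s => Re (f s)) t); [|exact h1].
  exists (mkposreal d hd). intros s hs. now rewrite (e s hs).
- apply (continuous_ext_loc (fun s => Im (g s)) (fun s => Im (f s)) t); [|exact h2].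
  exists (mkposreal d hd). intros s hs. now rewrite (e s hs).
Qed.

Lemma Ccont_eps (f : R -> C) (t : R) : Ccont f t ->
  forall eps : R, (0 < eps)%R -> exists d : R, (0 < d)%R /\
  forall s, (Rabs (s - t) < d -> Cmod (f s - f t) < eps)%R.
Proof.
intros [h1 h2] eps he.
destruct (proj1 (filterlim_locally (fun s => Re (f s)) (Re (f t))) h1 (mkposreal (eps / 2) ltac:(lra))) as [d1 H1].
destruct (proj1 (filterlim_locally (fun s => Im (f s)) (Im (f t))) h2 (mkposreal (eps / 2) ltac:(lra))) as [d2 H2].
exists (Rmin d1 d2). split. apply Rmin_pos; apply cond_pos.
intros s hs. assert (a := Rmin_l d1 d2). assert (b := Rmin_r d1 d2).
assert (q1 : (Rabs (Re (f s) - Re (f t)) < eps / 2)%R).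
{ apply H1. change (Rabs (s - t) < d1)%R. lra. }
assert (q2 : (Rabs (Im (f s) - Im (f t)) < eps / 2)%R).
{ apply H2. change (Rabs (s - t) < d2)%R. lra. }
eapply Rle_lt_trans; [apply Cmod_le_re_im|].
change (Rabs (Re (f s) - Re (f t)) + Rabs (Im (f s) - Im (f t)) < eps)%R. lra.
Qed.

Lemma Rderiv_Ccont (f : R -> C) (t : R) (l : C) : Rderiv f t l -> Ccont f t.
Proof.
intros [h1 h2]. split; apply (ex_derive_continuous (K := R_AbsRing) (V := R_NormedModule));
  eexists; eassumption.
Qed.

Lemma Rderiv_ext_loc (f g : R -> C) (t d : R) (l : C) :
  (0 < d)%R -> (forall s, (Rabs (s - t) < d)%R -> f s = g s) -> Rderiv f t l -> Rderiv g t l.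
Proof.
intros hd e [h1 h2]. split.
- apply (is_derive_ext_loc (fun s => Re (f s))); [|exact h1].
  exists (mkposreal d hd). intros s hs. now rewrite (e s hs).
- apply (is_derive_ext_loc (fun s => Im (f s))); [|exact h2].
  exists (mkposreal d hd). intros s hs. now rewrite (e s hs).
Qed.

(** The passage from complex to real derivatives. Lines are the only curves needed: in the
    logarithmic coordinate a circle is a vertical segment. *)
Lemma Rderiv_line (G : C -> C) (p r : C) (t : R) (l : C) :
  Cderiv G (p + RtoC t * r) l -> Rderiv (fun s => G (p + RtoC s * r)) t (r * l).
Proof.
intros H.
assert (K : forall eps : R, (0 < eps)%R -> exists d : posreal, forall h : R, h <> 0%R ->
   (Rabs h < d -> Cmod (G (p + RtoC (t + h) * r)%C - G (p + RtoC t * r)%C - RtoC h * (r * l)) < eps * Rabs h)%R).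
{ intros eps he. assert (hr := Cmod_ge_0 r).
  assert (he' : (0 < eps / (Cmod r + 1))%R) by (apply Rdiv_lt_0_compat; lra).
  destruct (proj1 (Cderiv_iff _ _ _) H _ he') as [d [hd Hd]].
  assert (hd' : (0 < d / (Cmod r + 1))%R) by (apply Rdiv_lt_0_compat; lra).
  exists (mkposreal _ hd'). intros h h0 hh. simpl in hh.
  specialize (Hd (p + RtoC (t + h) * r)).
  replace (p + RtoC (t + h) * r - (p + RtoC t * r)) with (RtoC h * r) in Hd
    by (rewrite RtoC_plus; ring).
  rewrite Cmod_mult, Cmod_R in Hd.
  assert (hp := Rabs_pos_lt h h0).
  assert (a : (Rabs h * (Cmod r + 1) < d)%R).
  { apply Rlt_le_trans with (d / (Cmod r + 1) * (Cmod r + 1))%R.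
    apply Rmult_lt_compat_r; lra. right; field; lra. }
  specialize (Hd ltac:(nra)). rewrite <- Cmult_assoc in Hd.
  eapply Rle_lt_trans; [exact Hd|].
  apply Rlt_le_trans with (eps / (Cmod r + 1) * (Rabs h * (Cmod r + 1)))%R.
  apply Rmult_lt_compat_l; nra. right; field; lra. }
assert (aux : forall a b c h eps : R, h <> 0%R -> (Rabs (a - b - h * c) < eps * Rabs h -> Rabs ((a - b) / h - c) < eps)%R).
{ intros a b c h eps h0 q. assert (hp := Rabs_pos_lt h h0).
  replace ((a - b) / h - c)%R with ((a - b - h * c) / h)%R by (field; exact h0).
  rewrite Rabs_div by exact h0. apply Rmult_lt_reg_r with (Rabs h). exact hp.
  replace (Rabs (a - b - h * c) / Rabs h * Rabs h)%R with (Rabs (a - b - h * c)) by (field; lra).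
  exact q. }
split; apply is_derive_Reals; intros eps he; destruct (K eps he) as [d Hd]; exists d;
  intros h h0 hh; specialize (Hd h h0 hh); apply aux; auto;
  (eapply Rle_lt_trans; [|exact Hd]).
- eapply Rle_trans; [|apply re_le_Cmod].
  right. f_equal. destruct (G (p + RtoC (t + h) * r)), (G (p + RtoC t * r)), (r * l). simpl. ring.
- eapply Rle_trans; [|apply im_le_Cmod].
  right. f_equal. destruct (G (p + RtoC (t + h) * r)), (G (p + RtoC t * r)), (r * l). simpl. ring.
Qed.

Lemma Ccont_line (G : C -> C) (p r : C) (t : R) (l : C) :
  Cderiv G (p + RtoC t * r) l -> Ccont (fun s => G (p + RtoC s * r)) t.
Proof. intros H. eapply Rderiv_Ccont, Rderiv_line, H. Qed.

Definition CInt (f : R -> C) (a b : R) : C :=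
  (RInt (fun t => Re (f t)) a b, RInt (fun t => Im (f t)) a b).

Definition Ccont_on (f : R -> C) (a b : R) : Prop := forall t, (a <= t <= b)%R -> Ccont f t.

Lemma Ccont_on_ex (f : R -> C) (a b : R) : (a <= b)%R -> Ccont_on f a b ->
  ex_RInt (fun t => Re (f t)) a b /\ ex_RInt (fun t => Im (f t)) a b.
Proof.
intros h H. split; apply (ex_RInt_continuous (V := R_CompleteNormedModule));
  intros t ht; rewrite Rmin_left, Rmax_right in ht by exact h; apply H; exact ht.
Qed.

Lemma CInt_ext (f g : R -> C) (a b : R) : (a <= b)%R ->
  (forall t, (a < t < b)%R -> f t = g t) -> CInt f a b = CInt g a b.
Proof.
intros h e. unfold CInt.
f_equal; apply RInt_ext; intros t ht; rewrite Rmin_left, Rmax_right in ht by exact h; now rewrite e.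
Qed.

Lemma CInt_plus (f g : R -> C) (a b : R) : (a <= b)%R -> Ccont_on f a b -> Ccont_on g a b ->
  CInt (fun t => f t + g t) a b = CInt f a b + CInt g a b.
Proof.
intros h hf hg. destruct (Ccont_on_ex f a b h hf). destruct (Ccont_on_ex g a b h hg).
unfold CInt, Cplus. simpl.
f_equal; apply (RInt_plus (V := R_CompleteNormedModule)); assumption.
Qed.

Lemma CInt_minus (f g : R -> C) (a b : R) : (a <= b)%R -> Ccont_on f a b -> Ccont_on g a b ->
  CInt (fun t => f t - g t) a b = CInt f a b - CInt g a b.
Proof.
intros h hf hg. destruct (Ccont_on_ex f a b h hf). destruct (Ccont_on_ex g a b h hg).
unfold CInt, Cminus, Cplus, Copp. simpl.
f_equal; apply (RInt_minus (V := R_CompleteNormedModule)); assumption.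
Qed.

Lemma CInt_scal (c : C) (f : R -> C) (a b : R) : (a <= b)%R -> Ccont_on f a b ->
  CInt (fun t => c * f t) a b = c * CInt f a b.
Proof.
intros h hf. destruct (Ccont_on_ex f a b h hf) as [h1 h2].
assert (s : forall (k : R) (g : R -> R), ex_RInt g a b -> RInt (fun t => (k * g t)%R) a b = (k * RInt g a b)%R /\ ex_RInt (fun t => (k * g t)%R) a b).
{ intros k g hg. split. apply (RInt_scal (V := R_CompleteNormedModule)), hg.
  apply (ex_RInt_scal (V := R_NormedModule)), hg. }
unfold CInt, Cmult. simpl. f_equal.
- rewrite <- (proj1 (s (fst c) _ h1)), <- (proj1 (s (snd c) _ h2)).
  apply (RInt_minus (V := R_CompleteNormedModule)); apply s; assumption.
- rewrite <- (proj1 (s (fst c) _ h2)), <- (proj1 (s (snd c) _ h1)).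
  apply (RInt_plus (V := R_CompleteNormedModule)); apply s; assumption.
Qed.

Lemma CInt_Chasles (f : R -> C) (a b c : R) : (a <= b <= c)%R -> Ccont_on f a c ->
  CInt f a c = CInt f a b + CInt f b c.
Proof.
intros h hf.
assert (h1 : Ccont_on f a b) by (intros t ht; apply hf; lra).
assert (h2 : Ccont_on f b c) by (intros t ht; apply hf; lra).
destruct (Ccont_on_ex f a b ltac:(lra) h1). destruct (Ccont_on_ex f b c ltac:(lra) h2).
unfold CInt, Cplus. simpl. f_equal; symmetry; apply (RInt_Chasles (V := R_CompleteNormedModule)); assumption.
Qed.

Lemma CInt_norm_le (f : R -> C) (g : R -> R) (a b : R) : (a <= b)%R ->
  Ccont_on f a b -> ex_RInt g a b -> (forall t, (a <= t <= b)%R -> (Cmod (f t) <= g t)%R) ->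
  (Cmod (CInt f a b) <= RInt g a b)%R.
Proof.
intros h hf hg H.
destruct (Ceq_dec (CInt f a b) (RtoC 0)) as [e|e].
- rewrite e, Cmod_0. apply RInt_ge_0; auto. intros t ht.
  eapply Rle_trans; [apply Cmod_ge_0|]. apply H. lra.
- assert (hp := proj1 (Cmod_gt_0 _) e).
  (* Rotate the integral onto the positive real axis. *)
  set (c := RtoC (Cmod (CInt f a b)) / CInt f a b).
  assert (hc : Cmod c = 1%R).
  { unfold c. rewrite Cmod_div, Cmod_R, Rabs_pos_eq by (auto; lra). field. lra. }
  assert (e1 : Cmod (CInt f a b) = RInt (fun t => Re (c * f t)) a b).
  { assert (q := CInt_scal c f a b h hf).
    replace (c * CInt f a b) with (RtoC (Cmod (CInt f a b))) in q by (unfold c; field; exact e).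
    apply (f_equal Re) in q. simpl in q. symmetry. exact q. }
  rewrite e1. apply RInt_le; auto.
  + apply (Ccont_on_ex (fun t => c * f t)). exact h. intros t ht. apply Ccont_mult. apply Ccont_const. auto.
  + intros t ht. eapply Rle_trans; [apply re_le_Cmod'|]. rewrite Cmod_mult, hc, Rmult_1_l. apply H. lra.
Qed.

Lemma CInt_norm_le_const (f : R -> C) (M a b : R) : (a <= b)%R ->
  Ccont_on f a b -> (forall t, (a <= t <= b)%R -> (Cmod (f t) <= M)%R) ->
  (Cmod (CInt f a b) <= (b - a) * M)%R.
Proof.
intros h hf H. eapply Rle_trans.
apply (CInt_norm_le f (fun _ => M)); auto. apply ex_RInt_const.
rewrite RInt_const. right. reflexivity.
Qed.

Lemma CInt_derive (f f' : R -> C) (a b : R) : (a <= b)%R ->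
  (forall t, (a <= t <= b)%R -> Rderiv f t (f' t)) -> Ccont_on f' a b ->
  CInt f' a b = f b - f a.
Proof.
intros h H hc. unfold CInt.
assert (forall (g g' : R -> R), (forall t, (a <= t <= b)%R -> is_derive g t (g' t)) ->
  (forall t, (a <= t <= b)%R -> continuous g' t) -> RInt g' a b = (g b - g a)%R).
{ intros g g' h1 h2. apply is_RInt_unique. apply (is_RInt_derive (V := R_CompleteNormedModule));
  intros t ht; rewrite Rmin_left, Rmax_right in ht by exact h; auto. }
rewrite (H0 (fun t => Re (f t)) (fun t => Re (f' t))), (H0 (fun t => Im (f t)) (fun t => Im (f' t)));
 try (intros t ht; first [apply (H t ht)|apply (hc t ht)]).
destruct (f a), (f b); reflexivity.
Qed.

Lemma Ccont_on_bounded (f : R -> C) (a b : R) : (a <= b)%R -> Ccont_on f a b ->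
  exists M, forall t, (a <= t <= b)%R -> (Cmod (f t) <= M)%R.
Proof.
intros h hf.
destruct (continuity_ab_maj (fun t => (Re (f t) * Re (f t) + Im (f t) * Im (f t))%R) a b h) as [m [hm _]].
{ intros t ht. destruct (hf t ht) as [h1 h2]. apply continuity_pt_filterlim.
  apply (continuous_plus (fun t => Re (f t) * Re (f t))%R (fun t => Im (f t) * Im (f t))%R).
  apply (continuous_mult (fun s => Re (f s)) (fun s => Re (f s))); assumption.
  apply (continuous_mult (fun s => Im (f s)) (fun s => Im (f s))); assumption. }
exists (Cmod (f m)). intros t ht. specialize (hm t ht).
unfold Cmod. apply sqrt_le_1_alt. unfold Re, Im in hm. nra.
Qed.

(** The tails are bounded by K q^n / (1 - q) uniformly in t, so integration commutes with the
    sum. *)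
Lemma CInt_Cser (f : nat -> R -> C) (g : R -> C) (K q : R) : (0 <= q < 1)%R ->
  (forall n, Ccont_on (f n) 0 1) -> Ccont_on g 0 1 ->
  (forall n t, (0 <= t <= 1)%R -> (Cmod (f n t) <= K * q ^ n)%R) ->
  (forall t, (0 <= t <= 1)%R -> Cser (fun n => f n t) (g t)) ->
  Cser (fun n => CInt (f n) 0 1) (CInt g 0 1).
Proof.
intros hq hf hg H H1.
assert (hs : forall n, Ccont_on (fun t => csum (fun k => f k t) n) 0 1).
{ induction n; intros t ht; simpl. apply Ccont_const. apply Ccont_plus; [apply IHn, ht|apply hf, ht]. }
assert (e : forall n, csum (fun n => CInt (f n) 0 1) n = CInt (fun t => csum (fun k => f k t) n) 0 1).
{ induction n; simpl.
  - unfold CInt. simpl. rewrite RInt_const. unfold scal; simpl; unfold mult; simpl.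
    unfold RtoC. f_equal; ring.
  - rewrite IHn, <- CInt_plus; auto; lra. }
intros eps he.
assert (hK : (0 <= K)%R).
{ specialize (H 0%nat 0%R ltac:(lra)). simpl in H. assert (h := Cmod_ge_0 (f 0%nat 0%R)). lra. }
assert (hl : is_lim_seq (fun n => (K / (1 - q) * q ^ n)%R) 0%R).
{ replace (Finite 0) with (Rbar_mult (Finite (K / (1 - q))%R) (Finite 0)) by (simpl; f_equal; ring).
  apply is_lim_seq_scal_l, is_lim_seq_geom. apply Rabs_def1; lra. }
apply is_lim_seq_spec in hl. destruct (hl (mkposreal eps he)) as [N hN].
exists N. intros n hn. specialize (hN n hn). simpl in hN. rewrite Rminus_0_r in hN.
rewrite e, <- CInt_minus; auto; [|lra].
eapply Rle_lt_trans; [|eapply Rle_lt_trans; [apply Rle_abs|exact hN]].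
replace (K / (1 - q) * q ^ n)%R with ((1 - 0) * (K / (1 - q) * q ^ n))%R by ring.
apply CInt_norm_le_const. lra.
- intros t ht. apply Ccont_minus; [apply hs|apply hg]; exact ht.
- intros t ht. rewrite Cmod_minus_sym.
  destruct (Cser_geom (fun k => f k t) K q hq (fun k => H k t ht)) as [l [l1 l2]].
  rewrite (Clim_unique _ _ _ (H1 t ht) l1). eapply Rle_trans; [apply l2|]. right; field; lra.
Qed.

(** * Fourier coefficients *)


Lemma tpi_neq_0 : tpi <> RtoC 0.
Proof.
apply Cmult_neq_0; [|exact Ci_nz]. intros h. apply RtoC_inj in h.
assert (q := PI_RGT_0). lra.
Qed.

Lemma Cexp_Z (k : Z) : Cexp (RtoC (IZR k) * tpi) = RtoC 1.
Proof.
assert (hn : forall n : nat, Cexp (RtoC (INR n) * tpi) = RtoC 1).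
{ induction n. simpl. rewrite Cmult_0_l. apply Cexp_0.
  rewrite S_INR, RtoC_plus, Cmult_plus_distr_r, Cexp_plus, IHn, !Cmult_1_l. apply Cexp_2PI. }
destruct (Z_le_gt_dec 0 k) as [h|h].
- rewrite <- (Z2Nat.id k h), <- INR_IZR_INZ. apply hn.
- replace k with (- Z.of_nat (Z.to_nat (- k)))%Z by lia.
  rewrite opp_IZR, <- INR_IZR_INZ, RtoC_opp.
  replace (- RtoC (INR (Z.to_nat (- k))) * tpi) with (- (RtoC (INR (Z.to_nat (- k))) * tpi)) by ring.
  rewrite Cexp_opp, hn. field.
Qed.

(** The character e^(2 pi i k t) of the circle R/Z. *)
Definition fexp (k : Z) (t : R) : C := Cexp (RtoC t * (RtoC (IZR k) * tpi)).

Lemma Ccont_exp (p r : C) (t : R) : Ccont (fun s => Cexp (p + RtoC s * r)) t.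
Proof. eapply Ccont_line, Cderiv_Cexp. Qed.

Lemma Ccont_fexp (k : Z) (t : R) : Ccont (fexp k) t.
Proof.
apply (Ccont_ext_loc (fun s => Cexp (RtoC 0 + RtoC s * (RtoC (IZR k) * tpi))) _ t 1). lra.
intros s _. rewrite Cplus_0_l. reflexivity. apply Ccont_exp.
Qed.

Lemma fexp_plus (j k : Z) (t : R) : fexp (j + k) t = fexp j t * fexp k t.
Proof. unfold fexp. rewrite <- Cexp_plus, plus_IZR, RtoC_plus. f_equal. ring. Qed.

Lemma fexp_0 (t : R) : fexp 0 t = RtoC 1.
Proof. unfold fexp. rewrite <- Cexp_0. f_equal. simpl. ring. Qed.

Lemma Cmod_fexp (k : Z) (t : R) : Cmod (fexp k t) = 1%R.
Proof.
unfold fexp. rewrite Cmod_Cexp, <- exp_0. f_equal.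
unfold Ci, RtoC, Cmult, Re. simpl. ring.
Qed.

Lemma CInt_const (c : C) : CInt (fun _ => c) 0 1 = c.
Proof.
unfold CInt. rewrite !RInt_const, (surjective_pairing c).
unfold scal; simpl; unfold mult; simpl. f_equal; ring.
Qed.

Lemma CInt_fexp (k : Z) : k <> 0%Z -> CInt (fexp k) 0 1 = RtoC 0.
Proof.
intros hk.
assert (hr : RtoC (IZR k) * tpi <> RtoC 0).
{ apply Cmult_neq_0; [|exact tpi_neq_0]. intros h. apply RtoC_inj in h. apply hk, eq_IZR, h. }
set (r := RtoC (IZR k) * tpi) in *.
rewrite (CInt_derive (fun t => / r * Cexp (RtoC 0 + RtoC t * r))).
- replace (RtoC 0 + RtoC 1 * r) with r by ring. replace (RtoC 0 + RtoC 0 * r) with (RtoC 0) by ring.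
  unfold r. rewrite Cexp_Z, Cexp_0. ring.
- lra.
- intros t _. replace (fexp k t) with (r * (/ r * Cexp (RtoC 0 + RtoC t * r))).
  2:{ unfold fexp. fold r. rewrite Cplus_0_l. field. exact hr. }
  apply (Rderiv_line (fun w => / r * Cexp w)).
  eapply Cderiv_eq. apply Cderiv_mult. apply Cderiv_const. apply Cderiv_Cexp. cbv beta. ring.
- intros t _. apply Ccont_fexp.
Qed.

(* Testing against the powers of the kernel (1 + cos 2 pi (t - t0)) / 2, which peaks at t0 only. *)
Lemma fourier_unique_interior (h : R -> C) (t0 : R) :
  Ccont_on h 0 1 -> (forall k : Z, CInt (fun t => h t * fexp k t) 0 1 = RtoC 0) ->
  (0 < t0 < 1)%R -> h t0 = RtoC 0.
Proof.
intros hc H ht0.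
set (q := fun t : R => ((1 + cos (2 * PI * (t - t0))) / 2)%R).
assert (q01 : forall t, (0 <= q t <= 1)%R).
{ intros t. unfold q. assert (b := COS_bound (2 * PI * (t - t0))). lra. }
assert (qd : forall N t, continuous (fun s => (q s ^ N)%R) t).
{ intros N t. apply (ex_derive_continuous (K := R_AbsRing) (V := R_NormedModule)).
  unfold q. auto_derive. trivial. }
assert (qc : forall N t, Ccont (fun s => RtoC (q s ^ N)%R) t).
{ intros N t. split. apply (qd N t). apply continuous_const. }
assert (qi : forall N a b, ex_RInt (fun s => (q s ^ N)%R) a b).
{ intros. apply (ex_RInt_continuous (V := R_CompleteNormedModule)). intros; apply qd. }
(* The kernel is a trigonometric polynomial with frequencies -1, 0 and 1. *)
assert (qe : forall t, RtoC (q t) = RtoC (1 / 2) + fexp 1 (- t0) * RtoC (1 / 4) * fexp 1 t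
   + fexp (-1) (- t0) * RtoC (1 / 4) * fexp (-1) t).
{ intros t.
  assert (e1 : fexp 1 (- t0) * fexp 1 t = (cos (2 * PI * (t - t0)), sin (2 * PI * (t - t0)))).
  { unfold fexp. rewrite <- Cexp_plus, Cexp_pair.
    match goal with |- context [Im ?z] => replace z with ((0, 2 * PI * (t - t0)) : C)%R end.
    simpl. rewrite exp_0. f_equal; ring.
    unfold Ci, RtoC, Cmult, Cplus. simpl. f_equal; ring. }
  assert (e2 : fexp (-1) (- t0) * fexp (-1) t = (cos (2 * PI * (t - t0)), - sin (2 * PI * (t - t0)))%R).
  { unfold fexp. rewrite <- Cexp_plus, Cexp_pair.
    match goal with |- context [Im ?z] => replace z with ((0, - (2 * PI * (t - t0))) : C)%R end.
    simpl. rewrite exp_0, cos_neg, sin_neg. f_equal; ring.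
    unfold Ci, RtoC, Cmult, Cplus. simpl. f_equal; ring. }
  replace (fexp 1 (- t0) * RtoC (1 / 4) * fexp 1 t) with (RtoC (1 / 4) * (fexp 1 (- t0) * fexp 1 t)) by ring.
  replace (fexp (-1) (- t0) * RtoC (1 / 4) * fexp (-1) t) with (RtoC (1 / 4) * (fexp (-1) (- t0) * fexp (-1) t)) by ring.
  rewrite e1, e2. unfold q, RtoC, Cmult, Cplus. simpl. f_equal; field. }
(* Multiplication by the kernel replaces a Fourier coefficient by a combination of those of index k
   - 1, k and k + 1, so their vanishing persists for every power. *)
assert (HN : forall N k, CInt (fun t => h t * RtoC (q t ^ N) * fexp k t) 0 1 = RtoC 0).
{ induction N; intros k.
  - rewrite <- (H k). apply CInt_ext. lra. intros; simpl; ring.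
  - set (I := fun k t => h t * RtoC (q t ^ N) * fexp k t) in *.
    assert (hI : forall k, Ccont_on (I k) 0 1).
    { intros j t ht. apply Ccont_mult. apply Ccont_mult. apply hc, ht. apply qc. apply Ccont_fexp. }
    assert (IH : forall k, CInt (I k) 0 1 = RtoC 0) by exact IHN.
    assert (hI' : forall c k, Ccont_on (fun t => c * I k t) 0 1).
    { intros c j t ht. apply Ccont_mult. apply Ccont_const. apply hI, ht. }
    transitivity (CInt (fun t => RtoC (1 / 2) * I k t + fexp 1 (- t0) * RtoC (1 / 4) * I (1 + k)%Z t
       + fexp (-1) (- t0) * RtoC (1 / 4) * I (-1 + k)%Z t) 0 1).
    + apply CInt_ext. lra. intros t _. unfold I. rewrite !fexp_plus. simpl pow. rewrite RtoC_mult, qe. ring.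
    + rewrite CInt_plus, CInt_plus, !CInt_scal, !IH; auto; try lra. ring.
      intros t ht. apply Ccont_plus; apply hI', ht. }
destruct (Ceq_dec (h t0) (RtoC 0)) as [e|e]; [exact e|exfalso].
assert (hp := proj1 (Cmod_gt_0 _) e). set (c := Cmod (h t0)) in *.
destruct (Ccont_on_bounded h 0 1 ltac:(lra) hc) as [M hM].
destruct (Ccont_eps h t0 (hc t0 ltac:(lra)) (c / 2)%R ltac:(lra)) as [d0 [hd0 Hd0]].
set (d := Rmin (Rmin d0 (1 / 4)) (Rmin t0 (1 - t0))).
assert (hd : (0 < d)%R) by (unfold d; repeat apply Rmin_pos; lra).
assert (d1 : (d <= d0)%R) by (unfold d; eapply Rle_trans; [apply Rmin_l|apply Rmin_l]).
assert (d2 : (d <= 1 / 4)%R) by (unfold d; eapply Rle_trans; [apply Rmin_l|apply Rmin_r]).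
assert (d3 : (d <= t0)%R) by (unfold d; eapply Rle_trans; [apply Rmin_r|apply Rmin_l]).
assert (d4 : (d <= 1 - t0)%R) by (unfold d; eapply Rle_trans; [apply Rmin_r|apply Rmin_r]).
clearbody d. assert (hpi := PI_RGT_0).
(* The kernel is at most [rho] at distance >= d from t0 and at least [rho'] within distance d/2.
   Since rho < rho', high powers concentrate near t0. *)
set (rho := ((1 + cos (2 * PI * d)) / 2)%R).
set (rho' := ((1 + cos (2 * PI * (d / 2))) / 2)%R).
assert (qabs : forall t, q t = ((1 + cos (2 * PI * Rabs (t - t0))) / 2)%R).
{ intros t. unfold q. unfold Rabs. destruct Rcase_abs; auto.
  replace (2 * PI * - (t - t0))%R with (- (2 * PI * (t - t0)))%R by ring. rewrite cos_neg. reflexivity. }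
assert (hrho : (0 < rho)%R).
{ unfold rho. assert (0 <= cos (2 * PI * d))%R by (apply cos_ge_0; nra). lra. }
assert (hrr : (rho < rho')%R).
{ unfold rho, rho'. assert (cos (2 * PI * d) < cos (2 * PI * (d / 2)))%R by (apply cos_decreasing_1; nra). lra. }
assert (qout : forall t, (0 <= t <= 1)%R -> (d <= Rabs (t - t0))%R -> (q t <= rho)%R).
{ intros t ht h1. rewrite qabs. unfold rho.
  (* By periodicity the kernel peaks again at distance 1 from t0. This is excluded because t0 stays
     at least d away from both ends of the interval. *)
  assert (h2 : (Rabs (t - t0) <= 1 - d)%R) by (apply Rabs_le; lra).
  set (s := Rabs (t - t0)) in *.
  assert (cos (2 * PI * s) <= cos (2 * PI * d))%R; [|lra].
  destruct (Rle_dec s (1 / 2)).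
  - apply cos_decr_1; nra.
  - replace (cos (2 * PI * d)) with (cos (2 * PI * (1 - d))).
    apply cos_incr_1; nra.
    replace (2 * PI * (1 - d))%R with (- (2 * PI * d) + 2 * INR 1 * PI)%R by (simpl; ring).
    rewrite cos_period. apply cos_neg. }
assert (qin : forall t, (Rabs (t - t0) <= d / 2)%R -> (rho' <= q t)%R).
{ intros t h1. rewrite qabs. unfold rho'. assert (h0 := Rabs_pos (t - t0)).
  set (s := Rabs (t - t0)) in *.
  assert (cos (2 * PI * (d / 2)) <= cos (2 * PI * s))%R; [|lra].
  apply cos_decr_1; nra. }
assert (hM0 : (0 <= M)%R).
{ eapply Rle_trans; [apply Cmod_ge_0|apply (hM 0%R); lra]. }
(* As the integral of h q^N vanishes, h(t0) J is the integral of (h(t0) - h) q^N. The integrand is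
   at most (c/2) q^N near t0, by continuity, and at most 2 M rho^N elsewhere. Absorbing (c/2) J and
   using J >= d rho'^N gives the claim. *)
assert (key : forall N, (c / 2 * (d * rho' ^ N) <= 2 * M * rho ^ N)%R).
{ intros N. set (J := RInt (fun s => (q s ^ N)%R) 0 1).
  assert (hJ : (d * rho' ^ N <= J)%R).
  { assert (pos : forall a b, (a <= b)%R -> (0 <= RInt (fun s => (q s ^ N)%R) a b)%R).
    { intros a b hab. apply RInt_ge_0; auto. intros s _. apply pow_le, q01. }
    unfold J.
    rewrite <- (RInt_Chasles (V := R_CompleteNormedModule) _ 0 (t0 - d / 2) 1) by apply qi.
    rewrite <- (RInt_Chasles (V := R_CompleteNormedModule) _ (t0 - d / 2) (t0 + d / 2) 1) by apply qi.
    assert (p1 := pos 0%R (t0 - d / 2)%R ltac:(lra)). assert (p2 := pos (t0 + d / 2)%R 1%R ltac:(lra)).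
    assert (p3 : (RInt (fun _ => (rho' ^ N)%R) (t0 - d / 2) (t0 + d / 2) <= RInt (fun s => (q s ^ N)%R) (t0 - d / 2) (t0 + d / 2))%R).
    { apply RInt_le; auto. lra. apply ex_RInt_const. intros s hs. apply pow_incr. split. lra.
      apply qin, Rabs_le. lra. }
    rewrite RInt_const in p3. unfold scal in p3; simpl in p3; unfold mult in p3; simpl in p3.
    unfold plus; simpl. lra. }
  assert (cq : Ccont_on (fun t => RtoC (q t ^ N)) 0 1) by (intros t _; apply qc).
  assert (chq : Ccont_on (fun t => h t * RtoC (q t ^ N)) 0 1) by (intros t ht; apply Ccont_mult; [apply hc, ht|apply qc]).
  assert (chq' : Ccont_on (fun t => h t0 * RtoC (q t ^ N)) 0 1) by (intros t ht; apply Ccont_mult; [apply Ccont_const|apply qc]).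
  assert (e1 : h t0 * RtoC J = CInt (fun t => h t0 * RtoC (q t ^ N) - h t * RtoC (q t ^ N)) 0 1).
  { rewrite CInt_minus, CInt_scal; auto; try lra.
    replace (CInt (fun t => h t * RtoC (q t ^ N)) 0 1) with (RtoC 0).
    - unfold CInt at 1. simpl. rewrite RInt_const. unfold scal; simpl; unfold mult; simpl.
      replace ((1 - 0) * 0)%R with 0%R by ring. unfold Cminus. rewrite Copp_0, Cplus_0_r. reflexivity.
    - rewrite <- (HN N 0%Z). apply CInt_ext. lra. intros t _. rewrite fexp_0. ring. }
  assert (b : (Cmod (h t0 * RtoC J) <= RInt (fun t => c / 2 * q t ^ N + 2 * M * rho ^ N)%R 0 1)%R).
  { rewrite e1. apply CInt_norm_le. lra.
    - intros t ht. apply Ccont_minus; auto.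
    - apply (ex_RInt_plus (V := R_NormedModule) (fun t => (c / 2 * q t ^ N)%R) (fun _ => (2 * M * rho ^ N)%R)).
      apply (ex_RInt_scal (V := R_NormedModule) (fun t => (q t ^ N)%R)), qi. apply ex_RInt_const.
    - intros t ht.
      replace (h t0 * RtoC (q t ^ N) - h t * RtoC (q t ^ N)) with ((h t0 - h t) * RtoC (q t ^ N)) by ring.
      assert (qp := pow_le _ N (proj1 (q01 t))).
      rewrite Cmod_mult, Cmod_R, Rabs_pos_eq by exact qp.
      assert (rp := pow_le _ N (Rlt_le _ _ hrho)).
      destruct (Rlt_dec (Rabs (t - t0)) d) as [r|r].
      + specialize (Hd0 t ltac:(lra)). rewrite Cmod_minus_sym in Hd0.
        assert (0 <= 2 * M * rho ^ N)%R by (apply Rmult_le_pos; lra).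
        apply Rle_trans with (c / 2 * q t ^ N)%R; [|lra]. apply Rmult_le_compat_r; lra.
      + assert (q2 : (q t ^ N <= rho ^ N)%R).
        { apply pow_incr. split. apply q01. apply qout; lra. }
        assert (m1 := Cmod_triangle_minus (h t0) (h t)). assert (m2 := hM t0 ltac:(lra)). assert (m3 := hM t ht).
        assert (0 <= c / 2 * q t ^ N)%R by (apply Rmult_le_pos; lra).
        apply Rle_trans with (2 * M * rho ^ N)%R; [|lra]. apply Rmult_le_compat; try lra. apply Cmod_ge_0. }
  assert (e2 : RInt (fun t => c / 2 * q t ^ N + 2 * M * rho ^ N)%R 0 1 = (c / 2 * J + 2 * M * rho ^ N)%R).
  { rewrite (RInt_plus (V := R_CompleteNormedModule) (fun t => (c / 2 * q t ^ N)%R) (fun _ => (2 * M * rho ^ N)%R)).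
    rewrite (RInt_scal (V := R_CompleteNormedModule) (fun t => (q t ^ N)%R)) by apply qi. rewrite RInt_const.
    unfold plus, scal; simpl; unfold mult; simpl. fold J. ring.
    apply (ex_RInt_scal (V := R_NormedModule) (fun t => (q t ^ N)%R)), qi. apply ex_RInt_const. }
  rewrite e2, Cmod_mult, Cmod_R in b. fold c in b.
  assert (j1 := Rle_abs J). assert (c * J <= c * Rabs J)%R by (apply Rmult_le_compat_l; lra).
  apply Rle_trans with (c / 2 * J)%R; [apply Rmult_le_compat_l; lra|lra]. }
(* The powers of rho'/rho > 1 are unbounded, against the inequality just proved. *)
destruct (Pow_x_infinity (rho' / rho)%R) with (b := (2 * M / (c / 2 * d) + 1)%R) as [N hN].
{ rewrite Rabs_pos_eq. apply Rmult_lt_reg_r with rho; auto. replace (rho' / rho * rho)%R with rho' by (field; lra). lra.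
  apply Rlt_le, Rdiv_lt_0_compat; lra. }
specialize (hN N (le_n _)). specialize (key N).
assert (xp : (0 < (rho' / rho) ^ N)%R) by (apply pow_lt, Rdiv_lt_0_compat; lra).
rewrite Rabs_pos_eq in hN by lra.
assert (rp : (0 < rho ^ N)%R) by (apply pow_lt; lra).
assert (e1 : (rho' ^ N = (rho' / rho) ^ N * rho ^ N)%R).
{ rewrite <- Rpow_mult_distr. f_equal. field. lra. }
rewrite e1 in key.
assert (k2 : (c / 2 * d * (rho' / rho) ^ N <= 2 * M)%R).
{ apply Rmult_le_reg_r with (rho ^ N)%R; auto. lra. }
assert (hcd : (0 < c / 2 * d)%R) by (apply Rmult_lt_0_compat; lra).
assert (k3 : (c / 2 * d * (2 * M / (c / 2 * d) + 1) <= c / 2 * d * (rho' / rho) ^ N)%R) by (apply Rmult_le_compat_l; lra).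
replace (c / 2 * d * (2 * M / (c / 2 * d) + 1))%R with (2 * M + c / 2 * d)%R in k3 by (field; lra). lra.
Qed.

(** The kernel argument needs room on both sides of the point; the endpoints follow by
    continuity. *)
Lemma fourier_unique (h : R -> C) :
  Ccont_on h 0 1 -> (forall k : Z, CInt (fun t => h t * fexp k t) 0 1 = RtoC 0) ->
  forall t, (0 <= t <= 1)%R -> h t = RtoC 0.
Proof.
intros hc H t ht.
destruct (Ceq_dec (h t) (RtoC 0)) as [e|e]; [exact e|exfalso].
assert (hp := proj1 (Cmod_gt_0 _) e).
destruct (Ccont_eps h t (hc t ht) _ hp) as [d [hd Hd]].
assert (exists s, (0 < s < 1)%R /\ (Rabs (s - t) < d)%R) as [s [hs hst]].
{ assert (m1 := Rmin_l d 1). assert (m2 := Rmin_r d 1). assert (m3 := Rmin_pos d 1 hd ltac:(lra)).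
  set (m := Rmin d 1) in *.
  destruct (Rle_dec t (1 / 2)); [exists (t + m / 4)%R|exists (t - m / 4)%R]; (split; [lra|]);
  apply Rabs_def1; lra. }
specialize (Hd s hst). rewrite (fourier_unique_interior h s hc H hs) in Hd.
unfold Cminus in Hd. rewrite Cplus_0_l, Cmod_opp in Hd. lra.
Qed.

(** * Goursat's theorem for rectangles *)

Lemma Rderiv_horizontal (G : C -> C) (x y : R) (l : C) :
  Cderiv G (x, y) l -> Rderiv (fun s => G (s, y)) x l.
Proof.
intros H.
assert (e : forall s : R, (s, y) = (RtoC 0 + (0, y)) + RtoC s * RtoC 1).
{ intros s. unfold RtoC, Cplus, Cmult. simpl. f_equal; ring. }
rewrite <- (Cmult_1_l l).
apply (Rderiv_ext_loc (fun s => G ((RtoC 0 + (0, y)) + RtoC s * RtoC 1)) _ x 1). lra.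
intros s _. now rewrite <- e. apply Rderiv_line. rewrite <- e. exact H.
Qed.

Lemma Rderiv_vertical (G : C -> C) (x y : R) (l : C) :
  Cderiv G (x, y) l -> Rderiv (fun s => G (x, s)) y (Ci * l).
Proof.
intros H.
assert (e : forall s : R, (x, s) = RtoC x + RtoC s * Ci).
{ intros s. unfold RtoC, Cplus, Cmult, Ci. simpl. f_equal; ring. }
apply (Rderiv_ext_loc (fun s => G (RtoC x + RtoC s * Ci)) _ y 1). lra.
intros s _. now rewrite <- e. apply Rderiv_line. rewrite <- e. exact H.
Qed.

(** The integral of g(w) dw along the boundary of [x1, x2] x [y1, y2], counterclockwise; dw = i dy
    on the vertical sides. *)
Definition contour (g : C -> C) (x1 x2 y1 y2 : R) : C :=
  CInt (fun x => g (x, y1)) x1 x2 + Ci * CInt (fun y => g (x2, y)) y1 y2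
  - CInt (fun x => g (x, y2)) x1 x2 - Ci * CInt (fun y => g (x1, y)) y1 y2.

(** Continuity along every horizontal and vertical segment separately is all that the sides of
    subrectangles require. *)
Definition grid_cont (g : C -> C) (x1 x2 y1 y2 : R) : Prop :=
  (forall y, (y1 <= y <= y2)%R -> Ccont_on (fun x => g (x, y)) x1 x2) /\
  (forall x, (x1 <= x <= x2)%R -> Ccont_on (fun y => g (x, y)) y1 y2).

Lemma grid_cont_diff (g : C -> C) (x1 x2 y1 y2 : R) :
  (forall x y, (x1 <= x <= x2)%R -> (y1 <= y <= y2)%R -> exists l, Cderiv g (x, y) l) ->
  grid_cont g x1 x2 y1 y2.
Proof.
intros H. split.
- intros y hy x hx. destruct (H x y hx hy) as [l hl]. eapply Rderiv_Ccont, Rderiv_horizontal, hl.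
- intros x hx y hy. destruct (H x y hx hy) as [l hl]. eapply Rderiv_Ccont, Rderiv_vertical, hl.
Qed.

Lemma contour_split (g : C -> C) (x1 x2 x3 y1 y2 y3 : R) :
  (x1 <= x2 <= x3)%R -> (y1 <= y2 <= y3)%R -> grid_cont g x1 x3 y1 y3 ->
  contour g x1 x3 y1 y3 = contour g x1 x2 y1 y2 + contour g x2 x3 y1 y2
    + contour g x1 x2 y2 y3 + contour g x2 x3 y2 y3.
Proof.
intros hx hy [h v]. unfold contour.
rewrite (CInt_Chasles (fun x => g (x, y1)) x1 x2 x3), (CInt_Chasles (fun x => g (x, y3)) x1 x2 x3),
  (CInt_Chasles (fun y => g (x1, y)) y1 y2 y3), (CInt_Chasles (fun y => g (x3, y)) y1 y2 y3); auto.
ring. all: first [apply h; lra | apply v; lra].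
Qed.

Lemma contour_minus (f g : C -> C) (x1 x2 y1 y2 : R) : (x1 <= x2)%R -> (y1 <= y2)%R ->
  grid_cont f x1 x2 y1 y2 -> grid_cont g x1 x2 y1 y2 ->
  contour (fun w => f w - g w) x1 x2 y1 y2 = contour f x1 x2 y1 y2 - contour g x1 x2 y1 y2.
Proof.
intros hx hy [h1 v1] [h2 v2]. unfold contour.
rewrite (CInt_minus (fun x => f (x, y1)) (fun x => g (x, y1))),
 (CInt_minus (fun x => f (x, y2)) (fun x => g (x, y2))),
 (CInt_minus (fun y => f (x1, y)) (fun y => g (x1, y))),
 (CInt_minus (fun y => f (x2, y)) (fun y => g (x2, y))); auto.
ring. all: first [apply h1; lra | apply v1; lra | apply h2; lra | apply v2; lra].
Qed.

(** An affine function has a quadratic primitive, whose corner values cancel around the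
    rectangle. *)
Lemma contour_affine (p r : C) (x1 x2 y1 y2 : R) : (x1 <= x2)%R -> (y1 <= y2)%R ->
  contour (fun w => p + r * w) x1 x2 y1 y2 = RtoC 0.
Proof.
intros hx hy.
set (G := fun w : C => (p + RtoC (1 / 2) * (r * w)) * w).
assert (hG : forall w, Cderiv G w (p + r * w)).
{ intros w. eapply Cderiv_eq. apply Cderiv_mult. apply Cderiv_plus. apply Cderiv_const.
  apply Cderiv_mult. apply Cderiv_const. apply Cderiv_mult. apply Cderiv_const. apply Cderiv_id. apply Cderiv_id.
  cbv beta. replace (p + r * w) with (p + (RtoC (1 / 2) + RtoC (1 / 2)) * (r * w)). ring.
  rewrite <- RtoC_plus. replace (1 / 2 + 1 / 2)%R with 1%R by field. ring. }
assert (hg : forall w, Cderiv (fun w => p + r * w) w r).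
{ intros w. eapply Cderiv_eq. apply Cderiv_plus. apply Cderiv_const. apply Cderiv_mult. apply Cderiv_const.
  apply Cderiv_id. cbv beta. ring. }
assert (A : forall y, CInt (fun x => p + r * (x, y)) x1 x2 = G (x2, y) - G (x1, y)).
{ intros y. apply (CInt_derive (fun x => G (x, y))). exact hx.
  intros t _. apply Rderiv_horizontal. apply hG.
  intros t _. eapply Rderiv_Ccont. apply (Rderiv_horizontal (fun w => p + r * w)). apply hg. }
assert (B : forall x, Ci * CInt (fun y => p + r * (x, y)) y1 y2 = G (x, y2) - G (x, y1)).
{ intros x. assert (c : Ccont_on (fun y => p + r * (x, y)) y1 y2).
  { intros t _. eapply Rderiv_Ccont. apply (Rderiv_vertical (fun w => p + r * w)). apply hg. }
  rewrite <- CInt_scal by assumption. apply (CInt_derive (fun y => G (x, y))). exact hy.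
  intros t _. apply Rderiv_vertical. apply hG.
  intros t ht. apply Ccont_mult. apply Ccont_const. apply c, ht. }
unfold contour. rewrite !A, !B. ring.
Qed.

Lemma contour_bound (g : C -> C) (eps x1 x2 y1 y2 : R) : (x1 <= x2)%R -> (y1 <= y2)%R ->
  grid_cont g x1 x2 y1 y2 ->
  (forall x y, (x1 <= x <= x2)%R -> (y1 <= y <= y2)%R -> (Cmod (g (x, y)) <= eps)%R) ->
  (Cmod (contour g x1 x2 y1 y2) <= 2 * eps * ((x2 - x1) + (y2 - y1)))%R.
Proof.
intros hx hy [h v] H. unfold contour.
assert (a1 := CInt_norm_le_const (fun x => g (x, y1)) eps x1 x2 hx (h y1 ltac:(lra)) (fun t ht => H t y1 ht ltac:(lra))).
assert (a2 := CInt_norm_le_const (fun x => g (x, y2)) eps x1 x2 hx (h y2 ltac:(lra)) (fun t ht => H t y2 ht ltac:(lra))).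
assert (a3 := CInt_norm_le_const (fun y => g (x1, y)) eps y1 y2 hy (v x1 ltac:(lra)) (fun t ht => H x1 t ltac:(lra) ht)).
assert (a4 := CInt_norm_le_const (fun y => g (x2, y)) eps y1 y2 hy (v x2 ltac:(lra)) (fun t ht => H x2 t ltac:(lra) ht)).
eapply Rle_trans; [apply Cmod_triangle_minus|]. rewrite Cmod_mult, Cmod_Ci.
assert (t := Cmod_triangle_minus (CInt (fun x => g (x, y1)) x1 x2 + Ci * CInt (fun y => g (x2, y)) y1 y2) (CInt (fun x => g (x, y2)) x1 x2)).
assert (t' := Cmod_triangle (CInt (fun x => g (x, y1)) x1 x2) (Ci * CInt (fun y => g (x2, y)) y1 y2)).
rewrite Cmod_mult, Cmod_Ci in t'. lra.
Qed.

Lemma grid_cont_sub (g : C -> C) (x1 x2 y1 y2 x3 x4 y3 y4 : R) :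
  (x1 <= x3)%R -> (x4 <= x2)%R -> (y1 <= y3)%R -> (y4 <= y2)%R ->
  grid_cont g x1 x2 y1 y2 -> grid_cont g x3 x4 y3 y4.
Proof.
intros a b c d [h v]. split.
- intros y hy x hx. apply h; lra.
- intros x hx y hy. apply v; lra.
Qed.

(** Bisection: if the integral has modulus c > 0, nested rectangles of sides a/2^n and b/2^n carry
    integrals of modulus at least c/4^n. At their common point g is affine up to eps times the
    distance, which allows only 2 eps (a + b)^2 / 4^n. *)
Theorem goursat (g : C -> C) (x1 x2 y1 y2 : R) : (x1 <= x2)%R -> (y1 <= y2)%R ->
  (forall x y, (x1 <= x <= x2)%R -> (y1 <= y <= y2)%R -> exists l, Cderiv g (x, y) l) ->
  contour g x1 x2 y1 y2 = RtoC 0.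
Proof.
intros hx hy H.
assert (hc := grid_cont_diff g x1 x2 y1 y2 H).
destruct (Ceq_dec (contour g x1 x2 y1 y2) (RtoC 0)) as [e|e]; [exact e|exfalso].
assert (hp := proj1 (Cmod_gt_0 _) e). set (c := Cmod (contour g x1 x2 y1 y2)) in *.
set (a := (x2 - x1)%R). set (b := (y2 - y1)%R).
assert (ha : (0 <= a)%R) by (unfold a; lra). assert (hb : (0 <= b)%R) by (unfold b; lra).
assert (pw : forall n, (0 < / 2 ^ n)%R) by (intros; apply Rinv_0_lt_compat, pow_lt; lra).
assert (pS : forall n, (/ 2 ^ n = / 2 ^ S n + / 2 ^ S n)%R) by (intros; simpl; field; apply pow_nonzero; lra).
set (P := fun (n : nat) (p : R * R) =>
  (x1 <= fst p /\ fst p + a * / 2 ^ n <= x2 /\ y1 <= snd p /\ snd p + b * / 2 ^ n <= y2 /\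
   c <= 4 ^ n * Cmod (contour g (fst p) (fst p + a * / 2 ^ n) (snd p) (snd p + b * / 2 ^ n)))%R).
set (Q := fun (n : nat) (p p' : R * R) =>
  (fst p <= fst p' /\ fst p' + a * / 2 ^ S n <= fst p + a * / 2 ^ n /\
   snd p <= snd p' /\ snd p' + b * / 2 ^ S n <= snd p + b * / 2 ^ n)%R).
assert (step : forall n p, P n p -> exists p', P (S n) p' /\ Q n p p').
{ intros n [x y] [h1 [h2 [h3 [h4 h5]]]]. simpl fst in *; simpl snd in *.
  specialize (pS n). assert (q0 := pw (S n)).
  set (u := (a * / 2 ^ S n)%R). set (v := (b * / 2 ^ S n)%R).
  assert (eu : (a * / 2 ^ n = u + u)%R) by (unfold u; rewrite pS; ring).
  assert (ev : (b * / 2 ^ n = v + v)%R) by (unfold v; rewrite pS; ring).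
  assert (hu : (0 <= u)%R) by (unfold u; nra). assert (hv : (0 <= v)%R) by (unfold v; nra).
  rewrite eu in h2, h5. rewrite ev in h4, h5.
  assert (s := contour_split g x (x + u) (x + (u + u)) y (y + v) (y + (v + v)) ltac:(lra) ltac:(lra)
     ltac:(apply (grid_cont_sub g x1 x2 y1 y2); auto)).
  set (B := (c / 4 ^ S n)%R).
  assert (p4 : (0 < 4 ^ S n)%R) by (apply pow_lt; lra).
  assert (hB : forall z, (B <= Cmod z)%R -> (c <= 4 ^ S n * Cmod z)%R).
  { intros z hz. unfold B in hz. apply Rmult_le_reg_l with (/ 4 ^ S n)%R. apply Rinv_0_lt_compat; auto.
    replace (/ 4 ^ S n * (4 ^ S n * Cmod z))%R with (Cmod z) by (field; lra). unfold Rdiv in hz. lra. }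
  assert (h6 : (4 * B <= Cmod (contour g x (x + (u + u)) y (y + (v + v))))%R).
  { unfold B. apply Rmult_le_reg_l with (4 ^ n)%R. apply pow_lt; lra.
    replace (4 ^ n * (4 * (c / 4 ^ S n)))%R with c. exact h5.
    simpl. field. apply pow_nonzero; lra. }
  rewrite s in h6.
  assert (t1 := Cmod_triangle (contour g x (x + u) y (y + v) + contour g (x + u) (x + (u + u)) y (y + v) + contour g x (x + u) (y + v) (y + (v + v))) (contour g (x + u) (x + (u + u)) (y + v) (y + (v + v)))).
  assert (t2 := Cmod_triangle (contour g x (x + u) y (y + v) + contour g (x + u) (x + (u + u)) y (y + v)) (contour g x (x + u) (y + v) (y + (v + v)))).
  assert (t3 := Cmod_triangle (contour g x (x + u) y (y + v)) (contour g (x + u) (x + (u + u)) y (y + v))).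
  assert (fin : forall x' y', (x' = x \/ x' = x + u)%R -> (y' = y \/ y' = y + v)%R ->
     (B <= Cmod (contour g x' (x' + u) y' (y' + v)))%R -> exists p', P (S n) p' /\ Q n (x, y) p').
  { intros x' y' hx' hy' hz. exists (x', y'). unfold P, Q. simpl fst; simpl snd. fold u v. rewrite eu, ev.
    assert (k := hB _ hz). destruct hx' as [-> | ->]; destruct hy' as [-> | ->]; repeat split; lra. }
  destruct (Rle_dec B (Cmod (contour g x (x + u) y (y + v)))) as [r|r1].
  { apply (fin x y); auto. }
  destruct (Rle_dec B (Cmod (contour g (x + u) (x + (u + u)) y (y + v)))) as [r|r2].
  { apply (fin (x + u)%R y); auto. rewrite Rplus_assoc. exact r. }
  destruct (Rle_dec B (Cmod (contour g x (x + u) (y + v) (y + (v + v))))) as [r|r3].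
  { apply (fin x (y + v)%R); auto. rewrite Rplus_assoc. exact r. }
  apply (fin (x + u)%R (y + v)%R); auto. rewrite !Rplus_assoc. lra. }
assert (P0 : P 0%nat (x1, y1)).
{ unfold P. simpl fst; simpl snd. simpl pow. rewrite Rinv_1, !Rmult_1_r, Rmult_1_l.
  replace (x1 + a)%R with x2 by (unfold a; ring). replace (y1 + b)%R with y2 by (unfold b; ring).
  repeat split; try lra. right; reflexivity. }
(* Dependent choice: each rectangle is carried together with its proof of [P], from which [step]
   selects the next quarter. *)
set (next := fun n (p : {p | P n p}) =>
  let s := constructive_indefinite_description _ (step n (proj1_sig p) (proj2_sig p)) in
  exist (P (S n)) (proj1_sig s) (proj1 (proj2_sig s))).
set (sq := nat_rect (fun n => {p | P n p}) (exist _ (x1, y1) P0) next).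
set (X := fun n => fst (proj1_sig (sq n))). set (Y := fun n => snd (proj1_sig (sq n))).
assert (PX : forall n, P n (X n, Y n)).
{ intros n. unfold X, Y. rewrite <- surjective_pairing. apply (proj2_sig (sq n)). }
assert (QX : forall n, Q n (X n, Y n) (X (S n), Y (S n))).
{ intros n. unfold X, Y. simpl sq. unfold next. simpl proj1_sig.
  destruct (constructive_indefinite_description _ _) as [p' [hp1 hp2]]. simpl. exact hp2. }
assert (lim : forall (U : nat -> R) (w : R), (0 <= w)%R -> (forall n, (U n <= U (S n))%R) ->
   (forall n, (U (S n) + w * / 2 ^ S n <= U n + w * / 2 ^ n)%R) ->
   exists L : R, forall n, (U n <= L <= U n + w * / 2 ^ n)%R).
{ intros U w hw i1 i2.
  assert (mono : forall n k, (U n <= U (n + k)%nat)%R).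
  { intros n k. induction k. rewrite Nat.add_0_r; lra. rewrite Nat.add_succ_r. specialize (i1 (n + k)%nat). lra. }
  assert (anti : forall n k, (U (n + k)%nat + w * / 2 ^ (n + k) <= U n + w * / 2 ^ n)%R).
  { intros n k. induction k. rewrite Nat.add_0_r; lra. rewrite Nat.add_succ_r. specialize (i2 (n + k)%nat). lra. }
  assert (bd : forall n k, (U k <= U n + w * / 2 ^ n)%R).
  { intros n k. assert (q1 := mono k n). assert (q2 := anti n k). rewrite (Nat.add_comm k n) in q1.
    assert (q3 := pw (n + k)%nat). nra. }
  destruct (ex_finite_lim_seq_incr U (U 0%nat + w * / 2 ^ 0)%R i1 (bd 0%nat)) as [L hL].
  exists L. intros n. split.
  - apply (is_lim_seq_incr_compare U L hL i1).
  - apply (is_lim_seq_le U (fun _ => (U n + w * / 2 ^ n)%R) L (U n + w * / 2 ^ n)%R (bd n) hL).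
    apply is_lim_seq_const. }
destruct (lim X a ha) as [x0 hx0]; [intros n; apply (QX n)|intros n; apply (QX n)|].
destruct (lim Y b hb) as [y0 hy0]; [intros n; apply (QX n)|intros n; apply (QX n)|].
destruct (H x0 y0) as [l hl].
{ destruct (PX 0%nat) as [r1 [r2 _]]. simpl fst in *. specialize (hx0 0%nat). lra. }
{ destruct (PX 0%nat) as [_ [_ [r1 [r2 _]]]]. simpl snd in *. specialize (hy0 0%nat). lra. }
(* Chosen so that 2 (a + b)^2 eps < c; the summand 1 keeps the denominator positive when the
   rectangle degenerates to a point. *)
set (eps := (c / (2 * (a + b) ^ 2 + 1))%R).
assert (hden : (0 < 2 * (a + b) ^ 2 + 1)%R) by (assert (q := pow2_ge_0 (a + b)); lra).
assert (heps : (0 < eps)%R) by (apply Rdiv_lt_0_compat; lra).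
destruct (proj1 (Cderiv_iff _ _ _) hl eps heps) as [d [hd Hd]].
assert (exists n, ((a + b) * / 2 ^ n < d)%R) as [n hn].
{ assert (L : is_lim_seq (fun n => ((a + b) * (/ 2) ^ n)%R) 0%R).
  { replace (Finite 0) with (Rbar_mult (Finite (a + b)%R) (Finite 0)) by (simpl; f_equal; ring).
    apply is_lim_seq_scal_l, is_lim_seq_geom. apply Rabs_def1; lra. }
  apply is_lim_seq_spec in L. destruct (L (mkposreal d hd)) as [n hn]. exists n.
  specialize (hn n (le_n _)). simpl in hn. rewrite Rminus_0_r, pow_inv in hn.
  eapply Rle_lt_trans; [apply Rle_abs|exact hn]. }
destruct (PX n) as [r1 [r2 [r3 [r4 r5]]]]. simpl fst in *; simpl snd in *.
specialize (hx0 n). specialize (hy0 n). assert (q0 := pw n).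
set (u := (a * / 2 ^ n)%R) in *. set (v := (b * / 2 ^ n)%R) in *.
assert (euv : ((a + b) * / 2 ^ n = u + v)%R) by (unfold u, v; ring). rewrite euv in hn.
assert (hu : (0 <= u)%R) by (unfold u; nra). assert (hv : (0 <= v)%R) by (unfold v; nra).
(* The tangent function at the limit point has integral 0, so it may be subtracted from g. *)
set (aff := fun w : C => (g (x0, y0) - (x0, y0) * l) + l * w).
assert (caff : grid_cont aff (X n) (X n + u) (Y n) (Y n + v)).
{ apply grid_cont_diff. intros x y _ _. eexists. unfold aff. apply Cderiv_plus. apply Cderiv_const.
  apply Cderiv_mult. apply Cderiv_const. apply Cderiv_id. }
assert (cg : grid_cont g (X n) (X n + u) (Y n) (Y n + v)).
{ apply (grid_cont_sub g x1 x2 y1 y2); auto. }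
assert (e1 := contour_minus g aff (X n) (X n + u) (Y n) (Y n + v) ltac:(lra) ltac:(lra) cg caff).
unfold aff at 2 in e1. rewrite contour_affine in e1 by lra.
assert (bd : (Cmod (contour (fun w => (g w - aff w)%C) (X n) (X n + u) (Y n) (Y n + v)) <= 2 * (eps * (u + v)) * (u + v))%R).
{ replace (u + v)%R with ((X n + u - X n) + (Y n + v - Y n))%R at 2 by ring. apply contour_bound. lra. lra.
  - destruct caff as [k1 k2]. destruct cg as [k3 k4]. split; intros s hs t ht; apply Ccont_minus; auto.
    apply k3; auto. apply k1; auto. apply k4; auto. apply k2; auto.
  - intros x y hxx hyy. unfold aff.
    assert (D : (Cmod ((x, y) - (x0, y0)) <= u + v)%R).
    { eapply Rle_trans; [apply Cmod_le_re_im|]. change (Rabs (x - x0) + Rabs (y - y0) <= u + v)%R.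
      apply Rplus_le_compat; apply Rabs_le; lra. }
    replace (g (x, y) - (g (x0, y0) - (x0, y0) * l + l * (x, y))) with (g (x, y) - g (x0, y0) - ((x, y) - (x0, y0)) * l) by ring.
    eapply Rle_trans; [apply Hd; lra|]. apply Rmult_le_compat_l; lra. }
rewrite e1 in bd. replace (contour g (X n) (X n + u) (Y n) (Y n + v) - RtoC 0) with (contour g (X n) (X n + u) (Y n) (Y n + v)) in bd by ring.
assert (p4 : (0 < 4 ^ n)%R) by (apply pow_lt; lra).
assert (f1 : (c <= 4 ^ n * (2 * (eps * (u + v)) * (u + v)))%R).
{ eapply Rle_trans; [exact r5|]. apply Rmult_le_compat_l; lra. }
rewrite <- euv in f1.
replace (4 ^ n * (2 * (eps * ((a + b) * / 2 ^ n)) * ((a + b) * / 2 ^ n)))%R with (2 * (a + b) ^ 2 * eps)%R in f1.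
- unfold eps in f1. apply (Rmult_le_compat_r (2 * (a + b) ^ 2 + 1)) in f1; [|lra].
  replace (2 * (a + b) ^ 2 * (c / (2 * (a + b) ^ 2 + 1)) * (2 * (a + b) ^ 2 + 1))%R with (2 * (a + b) ^ 2 * c)%R in f1 by (field; lra).
  nra.
- replace 4%R with (2 * 2)%R by ring. rewrite Rpow_mult_distr. field. apply pow_nonzero; lra.
Qed.

(** * Power series *)

(** Bernoulli's inequality for (1 + a)^n with 1 + a = 1/v. *)
Lemma linear_geom_bound (v : R) : (0 <= v < 1)%R ->
  exists K, (0 < K)%R /\ forall n : nat, (INR n * v ^ n <= K)%R.
Proof.
intros hv. destruct (Req_dec v 0) as [e|e].
- exists 1%R. split. lra. intros n. destruct n. simpl. lra. rewrite e. simpl. lra.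
- assert (hp : (0 < v)%R) by lra.
  set (a := (/ v - 1)%R). assert (ha : (0 < a)%R).
  { unfold a. apply Rmult_lt_reg_r with v; auto. replace ((/ v - 1) * v)%R with (1 - v)%R by (field; lra). lra. }
  exists (/ a)%R. split. apply Rinv_0_lt_compat; auto. intros n.
  assert (q := poly n a ha). replace (1 + a)%R with (/ v)%R in q by (unfold a; ring).
  rewrite pow_inv in q. assert (vp := pow_lt v n hp).
  apply Rmult_le_reg_l with (a * / v ^ n)%R. apply Rmult_lt_0_compat; auto. apply Rinv_0_lt_compat; auto.
  replace (a * / v ^ n * (INR n * v ^ n))%R with (INR n * a)%R by (field; lra).
  replace (a * / v ^ n * / a)%R with (/ v ^ n)%R by (field; lra). lra.
Qed.

(** With p = q^2 and q = v^2, one of the two factors q^n, written (v^n)^2, absorbs the square of 1 +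
    n, and the other remains. *)
Lemma square_geom_bound (p : R) : (0 <= p < 1)%R ->
  exists K q, (0 < K)%R /\ (0 <= q < 1)%R /\ (p <= q)%R /\
  forall n : nat, ((1 + INR n) ^ 2 * p ^ n <= K * q ^ n)%R.
Proof.
intros hp.
assert (hs : forall t, (0 <= t < 1)%R -> (0 <= sqrt t < 1)%R).
{ intros t ht. split. apply sqrt_pos. rewrite <- sqrt_1. apply sqrt_lt_1; lra. }
set (q := sqrt p). assert (hq := hs p hp). fold q in hq.
set (v := sqrt q). assert (hv := hs q hq). fold v in hv.
assert (eq1 : p = (q * q)%R) by (symmetry; apply sqrt_sqrt; lra).
assert (eq2 : q = (v * v)%R) by (symmetry; apply sqrt_sqrt; lra).
destruct (linear_geom_bound v hv) as [K [hK H]].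
exists ((1 + K) ^ 2)%R, q. split. apply pow_lt; lra. split. exact hq. split. rewrite eq1. nra.
intros n. rewrite eq1, Rpow_mult_distr, <- Rmult_assoc. apply Rmult_le_compat_r. apply pow_le; lra.
rewrite eq2, Rpow_mult_distr.
assert (v1 : (0 <= v ^ n <= 1)%R).
{ split. apply pow_le; lra. rewrite <- (pow1 n). apply pow_incr; lra. }
assert (hn := pos_INR n). specialize (H n).
replace ((1 + INR n) ^ 2 * (v ^ n * v ^ n))%R with ((v ^ n + INR n * v ^ n) ^ 2)%R by ring.
apply pow_incr. split; nra.
Qed.

Lemma Cpow_quad (z h : C) (s : R) (n : nat) : (0 < s)%R -> (Cmod z <= s)%R -> (Cmod (z + h) <= s)%R ->
  (Cmod ((z + h) ^ n - z ^ n - h * (RtoC (INR n) * z ^ (n - 1))) <= INR n ^ 2 * s ^ n / s ^ 2 * Cmod h ^ 2)%R.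
Proof.
intros hs h1 h2.
assert (hp : forall m, (Cmod (z ^ m) <= s ^ m)%R).
{ intros m. rewrite Cmod_pow. apply pow_incr. split; [apply Cmod_ge_0|exact h1]. }
destruct n as [|n].
{ simpl. replace (RtoC 1 - RtoC 1 - h * (RtoC 0 * RtoC 1)) with (RtoC 0) by ring. rewrite Cmod_0. right; field. lra. }
replace (S n - 1)%nat with n by lia.
induction n.
- simpl. replace ((z + h) * RtoC 1 - z * RtoC 1 - h * (RtoC 1 * RtoC 1)) with (RtoC 0) by ring.
  rewrite Cmod_0. apply Rmult_le_pos. apply Rlt_le, Rdiv_lt_0_compat. nra. nra. apply (pow2_ge_0 (Cmod h)).
(* For m = n + 1, the remainder of degree m + 1 is z + h times that of degree m, plus m h^2 z^n. The
   constants close because m^2 + m <= (m + 1)^2. *)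
- replace ((z + h) ^ S (S n) - z ^ S (S n) - h * (RtoC (INR (S (S n))) * z ^ S n))
    with ((z + h) * ((z + h) ^ S n - z ^ S n - h * (RtoC (INR (S n)) * z ^ n)) + RtoC (INR (S n)) * h * h * z ^ n).
  2:{ rewrite (S_INR (S n)), RtoC_plus, !Cpow_S. ring. }
  eapply Rle_trans; [apply Cmod_triangle|]. rewrite !Cmod_mult, Cmod_R, (Rabs_pos_eq (INR (S n))) by apply pos_INR.
  set (D := Cmod ((z + h) ^ S n - z ^ S n - h * (RtoC (INR (S n)) * z ^ n))) in *.
  assert (d0 : (0 <= D)%R) by apply Cmod_ge_0.
  assert (m1 : (Cmod (z + h) * D <= s * (INR (S n) ^ 2 * s ^ S n / s ^ 2 * Cmod h ^ 2))%R).
  { apply Rmult_le_compat; auto. apply Cmod_ge_0. }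
  assert (m2 : (INR (S n) * Cmod h * Cmod h * Cmod (z ^ n) <= INR (S n) * Cmod h * Cmod h * s ^ n)%R).
  { apply Rmult_le_compat_l; auto. repeat apply Rmult_le_pos; try apply Cmod_ge_0. apply pos_INR. }
  eapply Rle_trans; [apply Rplus_le_compat; [exact m1|exact m2]|].
  rewrite (S_INR (S n)). set (N := INR (S n)).
  replace (s * (N ^ 2 * s ^ S n / s ^ 2 * Cmod h ^ 2) + N * Cmod h * Cmod h * s ^ n)%R
    with ((N ^ 2 + N) * (s ^ n * Cmod h ^ 2))%R by (simpl; field; lra).
  replace ((N + 1) ^ 2 * s ^ S (S n) / s ^ 2 * Cmod h ^ 2)%R with ((N + 1) ^ 2 * (s ^ n * Cmod h ^ 2))%R by (simpl; field; lra).
  apply Rmult_le_compat_r. apply Rmult_le_pos. apply pow_le; lra. apply pow2_ge_0.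
  assert (0 <= N)%R by apply pos_INR. nra.
Qed.

Lemma Cser_shift (f : nat -> C) (l : C) : f 0%nat = RtoC 0 -> Cser f l -> Cser (fun n => f (S n)) l.
Proof.
intros h0 H. apply (Clim_ext (fun n => csum f (S n))); [|apply Clim_S, H].
induction n. simpl. rewrite h0. ring. simpl csum at 2. rewrite <- IHn. reflexivity.
Qed.

Definition coef_bounded (A : nat -> C) (r : R) : Prop :=
  exists M, forall n, (Cmod (A n) * r ^ n <= M)%R.

Lemma pseries_term_bound (A : nat -> C) (r M : R) (v : C) : (0 < r)%R ->
  (forall n, (Cmod (A n) * r ^ n <= M)%R) ->
  forall n, (Cmod (A n * v ^ n) <= M * (Cmod v / r) ^ n)%R.
Proof.
intros hr H n. rewrite Cmod_mult, Cmod_pow.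
unfold Rdiv. rewrite Rpow_mult_distr, pow_inv.
assert (rp := pow_lt r n hr). assert (vp := pow_le _ n (Cmod_ge_0 v)).
replace (Cmod (A n) * Cmod v ^ n)%R with (Cmod (A n) * r ^ n * (Cmod v ^ n * / r ^ n))%R by (field; lra).
apply Rmult_le_compat_r; auto. apply Rmult_le_pos; auto. left; apply Rinv_0_lt_compat; auto.
Qed.

Lemma div_lt_1 (x r : R) : (0 <= x < r)%R -> (0 <= x / r < 1)%R.
Proof.
intros h. split. apply Rmult_le_pos. lra. left; apply Rinv_0_lt_compat; lra.
apply Rmult_lt_reg_r with r. lra. replace (x / r * r)%R with x by (field; lra). lra.
Qed.

Lemma pseries_correct (A : nat -> C) (r : R) (v : C) : (Cmod v < r)%R -> coef_bounded A r ->
  Cser (fun n => A n * v ^ n) (CSeries (fun n => A n * v ^ n)).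
Proof.
intros hv [M H]. assert (h0 := Cmod_ge_0 v).
apply (CSeries_correct _ M (Cmod v / r)). apply div_lt_1; lra.
apply pseries_term_bound; auto. lra.
Qed.

Definition dcoef (A : nat -> C) (n : nat) : C := RtoC (INR (S n)) * A (S n).

Lemma Cderiv_pseries (A : nat -> C) (c z : C) (r : R) : (Cmod (z - c) < r)%R -> coef_bounded A r ->
  Cderiv (fun y => CSeries (fun n => A n * (y - c) ^ n)) z (CSeries (fun n => dcoef A n * (z - c) ^ n)).
Proof.
intros hv [M H]. assert (h0 := Cmod_ge_0 (z - c)).
assert (hM : (0 <= M)%R).
{ specialize (H 0%nat). simpl in H. assert (q := Cmod_ge_0 (A 0%nat)). lra. }
(* An intermediate radius: the increments stay in the disc of radius s, while s < r leaves a factor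
   (s/r)^n that absorbs n^2. *)
set (s := ((Cmod (z - c) + r) / 2)%R). set (d := (s - Cmod (z - c))%R).
assert (hd : (0 < d)%R) by (unfold d, s; lra). assert (hs : (0 < s < r)%R) by (unfold s; lra).
assert (hsz : (Cmod (z - c) <= s)%R) by (unfold s; lra).
destruct (square_geom_bound (s / r)%R) as [K [q [hK [hq [hpq HK]]]]]. { apply div_lt_1; lra. }
assert (si : (0 < / s ^ 2)%R) by (apply Rinv_0_lt_compat, pow_lt; lra).
(* One constant for all three bounds: 1 serves the terms, 1/s their derivatives, 1/s^2 the
   remainders. *)
set (L := (M * K * (1 + s + / s ^ 2 + / s))%R).
assert (si' : (0 < / s)%R) by (apply Rinv_0_lt_compat; lra).
assert (b : forall n w, (Cmod w <= s)%R -> (Cmod (A n * w ^ n) <= M * (s / r) ^ n)%R).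
{ intros n w hw. eapply Rle_trans. apply pseries_term_bound with (r := r) (M := M); auto. lra.
  apply Rmult_le_compat_l; auto. apply pow_incr. split. apply Rmult_le_pos. apply Cmod_ge_0. left; apply Rinv_0_lt_compat; lra.
  apply Rmult_le_compat_r; auto. left; apply Rinv_0_lt_compat; lra. }
assert (g : forall n, (0 <= q ^ n)%R) by (intros; apply pow_le; lra).
assert (sr : forall n, (0 <= (s / r) ^ n)%R) by (intros; apply pow_le; apply div_lt_1; lra).
assert (MK : (0 <= M * K)%R) by (apply Rmult_le_pos; lra).
assert (sq : forall x : R, (0 <= x -> 0 <= x <= (1 + x) ^ 2 /\ 0 <= 1 <= (1 + x) ^ 2 /\ 0 <= x ^ 2 <= (1 + x) ^ 2)%R).
{ intros x hx. repeat split; nra. }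
(* The termwise derivative before reindexing; for n = 0 the truncated exponent n - 1 is harmless
   because of the factor n. *)
set (F' := fun n (y : C) => A n * (RtoC (INR n) * (y - c) ^ (n - 1))).
assert (An : forall n, (Cmod (A n) * s ^ n <= M * (s / r) ^ n)%R).
{ intros n. assert (k := b n (RtoC s)). rewrite Cmod_mult, Cmod_pow, Cmod_R, Rabs_pos_eq in k by lra. apply k. lra. }
assert (in1 : forall n x, (0 <= x <= (1 + INR n) ^ 2)%R -> (x * (M * (s / r) ^ n) <= M * K * q ^ n)%R).
{ intros n x hx. replace (M * K * q ^ n)%R with (M * (K * q ^ n))%R by ring.
  replace (x * (M * (s / r) ^ n))%R with (M * (x * (s / r) ^ n))%R by ring.
  apply Rmult_le_compat_l; auto. eapply Rle_trans; [|apply HK]. apply Rmult_le_compat_r; auto. lra. }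
assert (F'b : forall n, (Cmod (F' n z) <= L * q ^ n)%R).
{ intros n. unfold F'. destruct n.
  - rewrite !Cmod_mult. simpl. rewrite Cmod_0. rewrite Rmult_0_l, Rmult_0_r. rewrite Rmult_1_r.
    unfold L. apply Rmult_le_pos; [exact MK|lra].
  - replace (S n - 1)%nat with n by lia. rewrite !Cmod_mult, Cmod_pow, Cmod_R, Rabs_pos_eq by apply pos_INR.
    assert (hn := pos_INR (S n)).
    assert (k1 := in1 (S n) (INR (S n)) ltac:(split; nra)).
    assert (k2 : (Cmod (z - c) ^ n <= s ^ n)%R) by (apply pow_incr; lra).
    apply Rle_trans with (/ s * (INR (S n) * (Cmod (A (S n)) * s ^ S n)))%R.
    { replace (/ s * (INR (S n) * (Cmod (A (S n)) * s ^ S n)))%R with (Cmod (A (S n)) * (INR (S n) * s ^ n))%R by (simpl; field; lra).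
      apply Rmult_le_compat_l. apply Cmod_ge_0. apply Rmult_le_compat_l; auto. }
    apply Rle_trans with (/ s * (M * K * q ^ S n))%R.
    { apply Rmult_le_compat_l. lra. eapply Rle_trans; [|exact k1]. apply Rmult_le_compat_l; auto. }
    assert (k3 : (0 <= M * K * q ^ S n)%R) by (apply Rmult_le_pos; auto).
    replace (L * q ^ S n)%R with ((1 + s + / s ^ 2 + / s) * (M * K * q ^ S n))%R by (unfold L; ring).
    apply Rmult_le_compat_r; lra. }
assert (e : CSeries (fun n => dcoef A n * (z - c) ^ n) = CSeries (fun n => F' n z)).
{ assert (k := proj1 (CSeries_correct (fun n => F' n z) L q hq F'b)).
  apply CSeries_unique. apply Cser_shift in k.
  - eapply Cser_ext; [|exact k]. intros n. unfold F', dcoef. replace (S n - 1)%nat with n by lia. ring.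
  - unfold F'. simpl. ring. }
rewrite e.
apply (Cderiv_CSeries (fun n y => A n * (y - c) ^ n) F' z q L d hq hd); auto.
- intros n h hh. eapply Rle_trans. apply b.
  { replace (z + h - c) with ((z - c) + h) by ring. eapply Rle_trans; [apply Cmod_triangle|]. unfold d in hh. lra. }
  assert (k := in1 n 1%R). assert (hn := pos_INR n). specialize (k (proj1 (proj2 (sq _ hn)))).
  assert (k3 : (0 <= M * K * q ^ n)%R) by (apply Rmult_le_pos; auto).
  replace (L * q ^ n)%R with ((1 + s + / s ^ 2 + / s) * (M * K * q ^ n))%R by (unfold L; ring). nra.
- intros n h hh.
  replace (A n * (z + h - c) ^ n - A n * (z - c) ^ n - h * F' n z)
    with (A n * (((z - c) + h) ^ n - (z - c) ^ n - h * (RtoC (INR n) * (z - c) ^ (n - 1)))).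
  2:{ unfold F'. replace (z + h - c) with ((z - c) + h) by ring. ring. }
  rewrite Cmod_mult.
  assert (k := Cpow_quad (z - c) h s n (proj1 hs) ltac:(unfold s; lra)
    ltac:(eapply Rle_trans; [apply Cmod_triangle|unfold d in hh; lra])).
  apply Rle_trans with (Cmod (A n) * (INR n ^ 2 * s ^ n / s ^ 2 * Cmod h ^ 2))%R.
  { apply Rmult_le_compat_l; auto. apply Cmod_ge_0. }
  replace (Cmod (A n) * (INR n ^ 2 * s ^ n / s ^ 2 * Cmod h ^ 2))%R
    with ((/ s ^ 2 * (INR n ^ 2 * (Cmod (A n) * s ^ n))) * Cmod h ^ 2)%R by (field; lra).
  apply Rmult_le_compat_r. apply pow2_ge_0.
  assert (hn := pos_INR n).
  assert (k1 := in1 n (INR n ^ 2)%R ltac:(split; nra)).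
  apply Rle_trans with (/ s ^ 2 * (M * K * q ^ n))%R.
  { apply Rmult_le_compat_l. lra. eapply Rle_trans; [|exact k1]. apply Rmult_le_compat_l; auto. apply pow2_ge_0. }
  assert (k3 : (0 <= M * K * q ^ n)%R) by (apply Rmult_le_pos; auto).
  replace (L * q ^ n)%R with ((1 + s + / s ^ 2 + / s) * (M * K * q ^ n))%R by (unfold L; ring).
  apply Rmult_le_compat_r; lra.
Qed.

Lemma coef_bounded_dcoef (A : nat -> C) (r s : R) : (0 < r < s)%R ->
  coef_bounded A s -> coef_bounded (dcoef A) r.
Proof.
intros hr [M H]. destruct (linear_geom_bound (r / s)) as [K [hK HK]]. apply div_lt_1; lra.
assert (hM : (0 <= M)%R).
{ specialize (H 0%nat). simpl in H. assert (q := Cmod_ge_0 (A 0%nat)). lra. }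
exists (M * K / r)%R. intros n. unfold dcoef.
rewrite Cmod_mult, Cmod_R, Rabs_pos_eq by apply pos_INR.
specialize (H (S n)). specialize (HK (S n)).
assert (sp := pow_lt s (S n) ltac:(lra)).
replace (INR (S n) * Cmod (A (S n)) * r ^ n)%R
  with ((Cmod (A (S n)) * s ^ S n) * (INR (S n) * (r / s) ^ S n) / r)%R.
- apply Rmult_le_compat_r. left; apply Rinv_0_lt_compat; lra.
  apply Rmult_le_compat; auto. apply Rmult_le_pos. apply Cmod_ge_0. lra.
  apply Rmult_le_pos. apply pos_INR. apply pow_le, div_lt_1; lra.
- unfold Rdiv. rewrite Rpow_mult_distr, pow_inv. simpl pow. field.
  split; [lra|split; [apply pow_nonzero; lra|lra]].
Qed.

(** * Taylor expansion of holomorphic functions *)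

Lemma Cexp_pow (w : C) (n : nat) : Cexp w ^ n = Cexp (RtoC (INR n) * w).
Proof.
induction n. simpl. rewrite Cmult_0_l, Cexp_0. reflexivity.
rewrite Cpow_S, IHn, <- Cexp_plus, S_INR, RtoC_plus. f_equal. ring.
Qed.

Definition holomorphic_on_ball (f : C -> C) (c : C) (R0 : R) : Prop :=
  forall z, (Cmod (z - c) < R0)%R -> exists l, Cderiv f z l.

(** The point e^(2 pi (x + i y)): for fixed x, the unit interval in y runs once around the circle of
    radius e^(2 pi x). *)
Definition polar (x y : R) : C := Cexp (RtoC (2 * PI) * (x, y)).

Lemma polar_mult (x y : R) : polar x y = RtoC (exp (2 * PI * x)) * fexp 1 y.
Proof.
unfold polar, fexp. rewrite <- Cexp_R, <- Cexp_plus. f_equal.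
unfold RtoC, Ci, Cmult, Cplus. simpl. f_equal; ring.
Qed.

Lemma Cmod_polar (x y : R) : Cmod (polar x y) = exp (2 * PI * x).
Proof. rewrite polar_mult, Cmod_mult, Cmod_fexp, Cmod_R, Rmult_1_r. apply Rabs_pos_eq. left; apply exp_pos. Qed.

Lemma fexp_pow (y : R) (n : nat) : fexp 1 y ^ n = fexp (Z.of_nat n) y.
Proof. unfold fexp. rewrite Cexp_pow. f_equal. rewrite <- INR_IZR_INZ. simpl. ring. Qed.

Section CircleCoefficients.
Context (f : C -> C) (c : C) (R0 : R) (hf : holomorphic_on_ball f c R0).

(** The function f(z) (z - c)^(-k) in the coordinate w with z - c = e^(2 pi w). It is holomorphic in
    w wherever f is at z, and has period i. *)
Let g (k : Z) (w : C) : C :=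
  f (c + Cexp (RtoC (2 * PI) * w)) * Cexp (- (RtoC (IZR k) * (RtoC (2 * PI) * w))).

Definition circle_coef (k : Z) (x : R) : C :=
  CInt (fun y => f (c + polar x y) * fexp (- k) y) 0 1.

Lemma circle_cont (x : R) : (exp (2 * PI * x) < R0)%R -> forall y, Ccont (fun y => f (c + polar x y)) y.
Proof.
intros hx y. destruct (hf (c + polar x y)) as [l hl].
{ replace (c + polar x y - c) with (polar x y) by ring. rewrite Cmod_polar. exact hx. }
eapply Rderiv_Ccont. apply (Rderiv_vertical (fun w => f (c + Cexp (RtoC (2 * PI) * w)))).
apply (Cderiv_comp f (fun w => c + Cexp (RtoC (2 * PI) * w))). exact hl.
apply Cderiv_plus. apply Cderiv_const.
apply (Cderiv_comp Cexp (fun w => RtoC (2 * PI) * w)). apply Cderiv_Cexp.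
apply Cderiv_mult. apply Cderiv_const. apply Cderiv_id.
Qed.

Lemma circle_coef_scaled (k : Z) (x : R) : (exp (2 * PI * x) < R0)%R ->
  CInt (fun y => g k (x, y)) 0 1 = RtoC (exp (- (2 * PI * IZR k * x))) * circle_coef k x.
Proof.
intros hx. unfold circle_coef. rewrite <- CInt_scal.
- apply CInt_ext. lra. intros y _. unfold g. fold (polar x y).
  replace (Cexp (- (RtoC (IZR k) * (RtoC (2 * PI) * (x, y))))) with (RtoC (exp (- (2 * PI * IZR k * x))) * fexp (- k) y).
  ring. unfold fexp. rewrite <- Cexp_R, <- Cexp_plus, opp_IZR. f_equal.
  unfold RtoC, Ci, Cmult, Cplus, Copp. simpl. f_equal; ring.
- lra.
- intros y _. apply Ccont_mult. apply circle_cont, hx. apply Ccont_fexp.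
Qed.

(** Goursat on [x1, x2] x [0, 1]: the horizontal sides cancel by periodicity, so the two vertical
    ones agree. *)
Lemma circle_coef_const_aux (k : Z) (x1 x2 : R) : (x1 <= x2)%R -> (exp (2 * PI * x2) < R0)%R ->
  CInt (fun y => g k (x1, y)) 0 1 = CInt (fun y => g k (x2, y)) 0 1.
Proof.
intros hx hR.
assert (e := goursat (g k) x1 x2 0 1 hx ltac:(lra)).
unfold contour in e.
replace (CInt (fun x => g k (x, 1%R)) x1 x2) with (CInt (fun x => g k (x, 0%R)) x1 x2) in e.
2:{ apply CInt_ext. exact hx. intros x _. unfold g.
  replace (RtoC (2 * PI) * (x, 1%R)) with (RtoC (2 * PI) * (x, 0%R) + tpi).
  2:{ unfold RtoC, Ci, Cmult, Cplus. simpl. f_equal; ring. }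
  rewrite Cexp_plus, Cexp_2PI, Cmult_1_r. f_equal.
  replace (- (RtoC (IZR k) * (RtoC (2 * PI) * (x, 0%R) + tpi)))
    with (- (RtoC (IZR k) * (RtoC (2 * PI) * (x, 0%R))) - RtoC (IZR k) * tpi) by ring.
  rewrite Cexp_minus, Cexp_Z. field. }
assert (e' : Ci * (CInt (fun y => g k (x2, y)) 0 1 - CInt (fun y => g k (x1, y)) 0 1) = RtoC 0).
{ rewrite <- e. ring.
  intros x y hxx hy.
  destruct (hf (c + polar x y)) as [l hl].
  { replace (c + polar x y - c) with (polar x y) by ring. rewrite Cmod_polar.
    eapply Rle_lt_trans; [|exact hR]. apply exp_le. apply Rmult_le_compat_l; [|lra].
    assert (p := PI_RGT_0). lra. }
  eexists. unfold g. apply Cderiv_mult.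
  - apply (Cderiv_comp f (fun w => c + Cexp (RtoC (2 * PI) * w))).
    + exact hl.
    + apply Cderiv_plus. apply Cderiv_const.
      apply (Cderiv_comp Cexp (fun w => RtoC (2 * PI) * w)). apply Cderiv_Cexp.
      apply Cderiv_mult. apply Cderiv_const. apply Cderiv_id.
  - apply (Cderiv_comp Cexp (fun w => - (RtoC (IZR k) * (RtoC (2 * PI) * w)))). apply Cderiv_Cexp.
    apply Cderiv_opp. apply Cderiv_mult. apply Cderiv_const.
    apply Cderiv_mult. apply Cderiv_const. apply Cderiv_id. }
symmetry. apply Ceq_minus.
rewrite <- (Cmult_1_l (CInt _ _ _ - CInt _ _ _)).
replace (RtoC 1) with (- Ci * Ci). rewrite <- Cmult_assoc, e'. ring.
unfold Ci, RtoC, Cmult, Copp. simpl. f_equal; ring.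
Qed.

Lemma circle_coef_const (k : Z) (x1 x2 : R) : (exp (2 * PI * x1) < R0)%R -> (exp (2 * PI * x2) < R0)%R ->
  RtoC (exp (- (2 * PI * IZR k * x1))) * circle_coef k x1
  = RtoC (exp (- (2 * PI * IZR k * x2))) * circle_coef k x2.
Proof.
intros h1 h2. rewrite <- !circle_coef_scaled by assumption.
destruct (Rle_dec x1 x2) as [h|h]; [|symmetry]; apply circle_coef_const_aux; auto; lra.
Qed.

Lemma circle_coef_neg (k : Z) (x : R) : (k < 0)%Z -> (exp (2 * PI * x) < R0)%R -> circle_coef k x = RtoC 0.
Proof.
intros hk hx. assert (hpi := PI_RGT_0).
assert (hR : (0 < R0)%R) by (eapply Rlt_trans; [apply exp_pos|exact hx]).
destruct (hf c) as [l hl]. { replace (c - c) with (RtoC 0) by ring. rewrite Cmod_0. exact hR. }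
destruct (Cderiv_Cmod_cont f c l hl 1%R Rlt_0_1) as [d [hd Hd]].
set (E := RtoC (exp (- (2 * PI * IZR k * x))) * circle_coef k x).
destruct (Ceq_dec (circle_coef k x) (RtoC 0)) as [e|e]; [exact e|exfalso].
assert (hE : (0 < Cmod E)%R).
{ apply Cmod_gt_0. apply Cmult_neq_0; auto. intros h. apply RtoC_inj in h.
  assert (q := exp_pos (- (2 * PI * IZR k * x))). lra. }
set (M := (Cmod (f c) + 1)%R). assert (hM : (0 < M)%R) by (unfold M; assert (q := Cmod_ge_0 (f c)); lra).
(* On the circle of radius r <= 1 the scaled coefficient of index k < 0 is at most M r^|k| <= M r. *)
set (r := Rmin (Rmin 1 (R0 / 2)) (Rmin (d / 2) (Cmod E / (2 * M)))).
assert (hr : (0 < r)%R).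
{ unfold r. repeat apply Rmin_pos; try lra. apply Rdiv_lt_0_compat; lra. }
assert (r1 : (r <= 1)%R) by (unfold r; eapply Rle_trans; [apply Rmin_l|apply Rmin_l]).
assert (r2 : (r <= R0 / 2)%R) by (unfold r; eapply Rle_trans; [apply Rmin_l|apply Rmin_r]).
assert (r3 : (r <= d / 2)%R) by (unfold r; eapply Rle_trans; [apply Rmin_r|apply Rmin_l]).
assert (r4 : (r <= Cmod E / (2 * M))%R) by (unfold r; eapply Rle_trans; [apply Rmin_r|apply Rmin_r]).
clearbody r.
set (x' := (ln r / (2 * PI))%R).
assert (ex' : exp (2 * PI * x') = r).
{ unfold x'. replace (2 * PI * (ln r / (2 * PI)))%R with (ln r) by (field; lra). apply exp_ln, hr. }
assert (eE : E = RtoC (exp (- (2 * PI * IZR k * x'))) * circle_coef k x').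
{ apply circle_coef_const; lra. }
assert (b : (Cmod (circle_coef k x') <= M)%R).
{ replace M with ((1 - 0) * M)%R by ring. apply CInt_norm_le_const. lra.
  - intros y _. apply Ccont_mult. apply circle_cont. lra. apply Ccont_fexp.
  - intros y _. rewrite Cmod_mult, Cmod_fexp, Rmult_1_r.
    specialize (Hd (c + polar x' y)). replace (c + polar x' y - c) with (polar x' y) in Hd by ring.
    rewrite Cmod_polar in Hd. specialize (Hd ltac:(lra)).
    assert (t := Cmod_triangle (f (c + polar x' y) - f c) (f c)).
    replace (f (c + polar x' y) - f c + f c) with (f (c + polar x' y)) in t by ring. unfold M; lra. }
assert (b2 : (exp (- (2 * PI * IZR k * x')) <= r)%R).
{ rewrite <- ex'. apply exp_le.
  assert (k1 : (IZR k <= -1)%R) by (apply IZR_le; lia).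
  assert (x0 : (2 * PI * x' <= 0)%R).
  { rewrite <- (ln_exp (2 * PI * x')), ex', <- ln_1. destruct (Rle_lt_or_eq_dec r 1 r1) as [q|q].
    left; apply ln_increasing; lra. rewrite q; lra. }
  nra. }
rewrite eE, Cmod_mult, Cmod_R, Rabs_pos_eq in r4, hE by (left; apply exp_pos).
assert (p := exp_pos (- (2 * PI * IZR k * x'))).
assert (b3 : (exp (- (2 * PI * IZR k * x')) * Cmod (circle_coef k x') <= r * M)%R) by (apply Rmult_le_compat; try lra; apply Cmod_ge_0).
apply (Rmult_le_compat_r (2 * M)) in r4; [|lra].
unfold Rdiv in r4. rewrite Rmult_assoc, Rinv_l in r4 by lra.
assert (0 < r * M)%R by (apply Rmult_lt_0_compat; lra). lra.
Qed.

End CircleCoefficients.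

Theorem taylor (f : C -> C) (c : C) (R0 : R) : (0 < R0)%R -> holomorphic_on_ball f c R0 ->
  exists A : nat -> C, (forall r, (0 < r < R0)%R -> coef_bounded A r) /\
  forall z, (Cmod (z - c) < R0)%R -> f z = CSeries (fun n => A n * (z - c) ^ n).
Proof.
intros hR hf. assert (hpi := PI_RGT_0).
set (xr := fun r => (ln r / (2 * PI))%R).
assert (exr : forall r, (0 < r)%R -> exp (2 * PI * xr r) = r).
{ intros r hr. unfold xr. replace (2 * PI * (ln r / (2 * PI)))%R with (ln r) by (field; lra). apply exp_ln, hr. }
(* The common value of r^(-k) times the k-th Fourier coefficient over all radii r < R0, sampled at
   R0/2. *)
set (B := fun k => RtoC (exp (- (2 * PI * IZR k * xr (R0 / 2)%R))) * circle_coef f c k (xr (R0 / 2)%R)).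
assert (hB : forall k x, (exp (2 * PI * x) < R0)%R -> circle_coef f c k x = RtoC (exp (2 * PI * IZR k * x)) * B k).
{ intros k x hx. unfold B. rewrite <- (circle_coef_const f c R0 hf k x) by (rewrite ?exr; lra).
  rewrite Cmult_assoc, <- RtoC_mult, <- exp_plus, Rplus_opp_r, exp_0. ring. }
set (A := fun n => B (Z.of_nat n)).
assert (epow : forall x n, exp (2 * PI * IZR (Z.of_nat n) * x) = (exp (2 * PI * x) ^ n)%R).
{ intros x n. rewrite <- INR_IZR_INZ, <- exp_INR. f_equal. ring. }
assert (bA : forall r, (0 < r < R0)%R -> coef_bounded A r).
{ intros r hr.
  assert (hx : (exp (2 * PI * xr r) < R0)%R) by (rewrite exr; lra).
  destruct (Ccont_on_bounded (fun y => f (c + polar (xr r) y)) 0 1 ltac:(lra)) as [M hM].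
  { intros y _. apply (circle_cont f c R0 hf); auto. }
  exists M. intros n.
  replace (Cmod (A n) * r ^ n)%R with (Cmod (circle_coef f c (Z.of_nat n) (xr r))).
  - replace M with ((1 - 0) * M)%R by ring. apply CInt_norm_le_const. lra.
    intros y _. apply Ccont_mult. apply (circle_cont f c R0 hf); auto. apply Ccont_fexp.
    intros y hy. rewrite Cmod_mult, Cmod_fexp, Rmult_1_r. auto.
  - rewrite hB by exact hx. rewrite Cmod_mult, Cmod_R, Rabs_pos_eq by (left; apply exp_pos).
    rewrite epow, exr by lra. apply Rmult_comm. }
exists A. split. exact bA.
(* On the circle through z, the function and the series have the same Fourier coefficients, hence
   the same values. The centre lies on no such circle. *)
assert (F0 : forall z, z <> c -> (Cmod (z - c) < R0)%R -> f z = CSeries (fun n => A n * (z - c) ^ n)).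
{ intros z hz hzR.
  destruct (Cexp_surj (z - c)) as [w hw]. { now apply Cminus_eq_contra. }
  set (x := (Re w / (2 * PI))%R). set (y0 := (Im w / (2 * PI))%R).
  set (y := (y0 - IZR (Int_part y0))%R).
  assert (hy : (0 <= y <= 1)%R).
  { unfold y. destruct (base_Int_part y0). lra. }
  assert (ez : z - c = polar x y).
  { rewrite <- hw. unfold polar.
    replace (RtoC (2 * PI) * (x, y)) with (w - RtoC (IZR (Int_part y0)) * tpi).
    rewrite Cexp_minus, Cexp_Z. field.
    unfold y, x, y0, RtoC, Ci, Cmult, Cminus, Cplus, Copp. rewrite (surjective_pairing w) at 1. unfold Re, Im. simpl. f_equal; field; lra. }
  assert (hx : (exp (2 * PI * x) < R0)%R) by (rewrite <- (Cmod_polar x y), <- ez; exact hzR).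
  set (r := exp (2 * PI * x)) in *. assert (hr : (0 < r)%R) by apply exp_pos.
  set (s := ((r + R0) / 2)%R).
  destruct (bA s ltac:(unfold s; lra)) as [M HM].
  set (S := fun v => CSeries (fun n => A n * v ^ n)).
  set (T := fun k n t => A n * polar x t ^ n * fexp k t).
  assert (Sc : forall t, Ccont (fun t => S (polar x t)) t).
  { intros t.
    apply (Ccont_ext_loc (fun t => CSeries (fun n => A n * (polar x t - RtoC 0) ^ n)) _ t 1). lra.
    intros u _. unfold S. apply CSeries_ext. intros n. f_equal. f_equal. ring.
    eapply Rderiv_Ccont.
    apply (Rderiv_vertical (fun w => (fun v => CSeries (fun n => A n * (v - RtoC 0) ^ n)) (Cexp (RtoC (2 * PI) * w)))).
    apply (Cderiv_comp (fun v => CSeries (fun n => A n * (v - RtoC 0) ^ n)) (fun w => Cexp (RtoC (2 * PI) * w))).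
    apply Cderiv_pseries with (r := s).
    replace (Cexp (RtoC (2 * PI) * (x, t)) - RtoC 0) with (polar x t) by (unfold polar; ring).
    rewrite Cmod_polar. fold r. unfold s; lra. exists M; exact HM.
    apply (Cderiv_comp Cexp (fun w => RtoC (2 * PI) * w)). apply Cderiv_Cexp.
    apply Cderiv_mult. apply Cderiv_const. apply Cderiv_id. }
  assert (fc : forall t, Ccont (fun t => f (c + polar x t)) t).
  { intros t. apply (circle_cont f c R0 hf); auto. }
  assert (eT : forall k n t, T k n t = RtoC (exp (2 * PI * IZR (Z.of_nat n) * x)) * A n * fexp (Z.of_nat n + k) t).
  { intros k n t. unfold T. rewrite polar_mult, Cpow_mult_l, fexp_pow, fexp_plus, epow, RtoC_pow. ring. }
  assert (iT : forall k n, CInt (T k n) 0 1 = RtoC (exp (2 * PI * IZR (Z.of_nat n) * x)) * A n * CInt (fexp (Z.of_nat n + k)) 0 1).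
  { intros k n. rewrite <- CInt_scal. apply CInt_ext. lra. intros t _. apply eT. lra. intros t _. apply Ccont_fexp. }
  assert (sT : forall k, Cser (fun n => CInt (T k n) 0 1) (CInt (fun t => S (polar x t) * fexp k t) 0 1)).
  { intros k. apply (CInt_Cser (T k) _ M (r / s)). apply div_lt_1; unfold s; lra.
    - intros n t _. apply (Ccont_ext_loc (fun t => RtoC (exp (2 * PI * IZR (Z.of_nat n) * x)) * A n * fexp (Z.of_nat n + k) t) _ t 1).
      lra. intros u _. symmetry. apply eT. apply Ccont_mult. apply Ccont_const. apply Ccont_fexp.
    - intros t _. apply Ccont_mult. apply Sc. apply Ccont_fexp.
    - intros n t _. unfold T. rewrite Cmod_mult, Cmod_fexp, Rmult_1_r.
      replace r with (Cmod (polar x t)) by apply Cmod_polar.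
      apply pseries_term_bound; auto. unfold s; lra.
    - intros t _. apply (Cser_ext (fun n => fexp k t * (A n * polar x t ^ n))). intros n; unfold T; ring.
      rewrite Cmult_comm. apply Cser_scal. apply pseries_correct with s.
      rewrite Cmod_polar. fold r. unfold s; lra. exists M; exact HM. }
  assert (Z0 : forall k, CInt (fun t => (f (c + polar x t) - S (polar x t)) * fexp k t) 0 1 = RtoC 0).
  { intros k. transitivity (CInt (fun t => f (c + polar x t) * fexp k t - S (polar x t) * fexp k t) 0 1).
    apply CInt_ext. lra. intros; ring.
    rewrite CInt_minus.
    - replace (CInt (fun t => f (c + polar x t) * fexp k t) 0 1) with (circle_coef f c (- k) x).
      2:{ unfold circle_coef. rewrite Z.opp_involutive. reflexivity. }
      (* Testing against the character of index k leaves only the term of degree -k of the series.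
         For k > 0 there is none, and the coefficient of f of negative index -k vanishes as well. *)
      destruct (Z_le_gt_dec k 0) as [h|h].
      + set (m := Z.to_nat (- k)). assert (em : Z.of_nat m = (- k)%Z) by (unfold m; lia).
        rewrite (Clim_unique _ _ _ (sT k) (Cser_single (fun n => CInt (T k n) 0 1) m ltac:(intros n hn; cbv beta; rewrite iT, CInt_fexp by lia; ring))).
        rewrite hB by exact hx. rewrite iT. unfold A. rewrite em.
        replace (- k + k)%Z with 0%Z by lia.
        replace (CInt (fexp 0) 0 1) with (RtoC 1). ring.
        rewrite <- (CInt_const (RtoC 1)). apply CInt_ext. lra. intros; symmetry; apply fexp_0.
      + assert (z0 : forall n, CInt (T k n) 0 1 = RtoC 0) by (intros n; rewrite iT, CInt_fexp by lia; ring).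
        assert (eS : CInt (fun t => S (polar x t) * fexp k t) 0 1 = RtoC 0).
        { apply (Clim_unique _ _ _ (sT k)). rewrite <- (z0 0%nat).
          apply (Cser_single (fun n => CInt (T k n) 0 1) 0%nat). intros n _. exact (z0 n). }
        rewrite eS, (circle_coef_neg f c R0 hf (- k) x). ring. lia. exact hx.
    - lra.
    - intros t _. apply Ccont_mult; auto. apply Ccont_fexp.
    - intros t _. apply Ccont_mult; auto. apply Ccont_fexp. }
  assert (k := fourier_unique (fun t => f (c + polar x t) - S (polar x t)) ltac:(intros t _; apply Ccont_minus; auto) Z0 y hy).
  simpl in k. rewrite <- ez in k. apply Ceq_minus in k. fold (S (z - c)). rewrite <- k. f_equal. ring. }
intros z hz. destruct (Ceq_dec z c) as [e|e]; [|apply F0; auto].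
(* Both sides are continuous at c and agree elsewhere. *)
subst z. set (S := fun z => CSeries (fun n => A n * (z - c) ^ n)). change (f c = S c).
destruct (hf c hz) as [l hl].
assert (hS := Cderiv_pseries A c c (R0 / 2) ltac:(replace (c - c) with (RtoC 0) by ring; rewrite Cmod_0; lra) (bA (R0 / 2)%R ltac:(lra))).
change (Cderiv S c (CSeries (fun n => dcoef A n * (c - c) ^ n))) in hS.
apply Ceq_minus. destruct (Ceq_dec (f c - S c) (RtoC 0)) as [e|e]; [exact e|exfalso].
assert (hp := proj1 (Cmod_gt_0 _) e). set (m := Cmod (f c - S c)) in *.
destruct (Cderiv_Cmod_cont _ _ _ hl (m / 2)%R ltac:(lra)) as [d1 [hd1 H1]].
destruct (Cderiv_Cmod_cont _ _ _ hS (m / 2)%R ltac:(lra)) as [d2 [hd2 H2]].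
set (h := (Rmin (Rmin d1 d2) R0 / 2)%R).
assert (hm := Rmin_pos _ _ (Rmin_pos _ _ hd1 hd2) hR).
assert (m1 := Rmin_l (Rmin d1 d2) R0). assert (m2 := Rmin_r (Rmin d1 d2) R0). assert (m3 := Rmin_l d1 d2). assert (m4 := Rmin_r d1 d2).
assert (hh : (0 < h)%R) by (unfold h; lra).
assert (eh : Cmod (c + RtoC h - c) = h).
{ replace (c + RtoC h - c) with (RtoC h) by ring. rewrite Cmod_R. apply Rabs_pos_eq. lra. }
specialize (H1 (c + RtoC h)). specialize (H2 (c + RtoC h)). rewrite eh in H1, H2.
specialize (H1 ltac:(unfold h; lra)). specialize (H2 ltac:(unfold h; lra)).
rewrite (F0 (c + RtoC h)) in H1.
- fold (S (c + RtoC h)) in H1.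
  assert (t := Cmod_triangle_minus (S (c + RtoC h) - S c) (S (c + RtoC h) - f c)).
  replace (S (c + RtoC h) - S c - (S (c + RtoC h) - f c)) with (f c - S c) in t by ring. fold m in t. lra.
- intros q. rewrite q in eh. replace (c - c) with (RtoC 0) in eh by ring. rewrite Cmod_0 in eh. lra.
- rewrite eh. unfold h. lra.
Qed.

Lemma holomorphic_derive (f : C -> C) (c : C) (R0 : R) : (0 < R0)%R -> holomorphic_on_ball f c R0 ->
  holomorphic_on_ball (C_derive f) c R0.
Proof.
intros hR hf. destruct (taylor f c R0 hR hf) as [A [bA eA]].
intros z hz. assert (h0 := Cmod_ge_0 (z - c)).
set (r := ((Cmod (z - c) + R0) / 2)%R). set (s := ((r + R0) / 2)%R).
assert (hrR : (r < R0)%R) by (unfold r; lra).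
eexists.
apply (Cderiv_ext_loc (fun y => CSeries (fun n => dcoef A n * (y - c) ^ n)) _ z _ (r - Cmod (z - c))%R).
- unfold r; lra.
- intros y hy. symmetry. apply Cderiv_unique.
  assert (hyc : (Cmod (y - c) < r)%R).
  { replace (y - c) with ((y - z) + (z - c)) by ring. eapply Rle_lt_trans; [apply Cmod_triangle|]. lra. }
  apply (Cderiv_ext_loc (fun y => CSeries (fun n => A n * (y - c) ^ n)) _ y _ (r - Cmod (y - c))%R).
  + lra.
  + intros u hu. symmetry. apply eA.
    replace (u - c) with ((u - y) + (y - c)) by ring. eapply Rle_lt_trans; [apply Cmod_triangle|]. lra.
  + apply Cderiv_pseries with r; auto. apply bA. unfold r; lra.
- apply Cderiv_pseries with r. unfold r; lra.
  apply (coef_bounded_dcoef A r s). unfold s, r; lra. apply bA. unfold s, r; lra.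
Qed.

(** The first nonzero Taylor coefficient would dominate all later terms near the centre and exclude
    zeros other than the centre there. *)
Theorem isolated_zeros (f : C -> C) (c : C) (R0 : R) : (0 < R0)%R -> holomorphic_on_ball f c R0 ->
  (forall d, (0 < d)%R -> exists z, (0 < Cmod (z - c) < d)%R /\ f z = RtoC 0) ->
  forall z, (Cmod (z - c) < R0)%R -> f z = RtoC 0.
Proof.
intros hR hf hz. destruct (taylor f c R0 hR hf) as [A [bA eA]].
assert (A0 : forall m, A m = RtoC 0).
{ intros m. induction m as [m IH] using (well_founded_induction Wf_nat.lt_wf).
  destruct (Ceq_dec (A m) (RtoC 0)) as [e|e]; [exact e|exfalso].
  assert (hp := proj1 (Cmod_gt_0 _) e).
  set (r := (R0 / 2)%R). assert (hr : (0 < r)%R) by (unfold r; lra).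
  destruct (bA r ltac:(unfold r; lra)) as [M HM].
  assert (hM : (0 < M)%R).
  { eapply Rlt_le_trans; [|apply (HM m)]. apply Rmult_lt_0_compat; auto. apply pow_lt; auto. }
  assert (rm : (0 < r ^ S m)%R) by (apply pow_lt; auto).
  (* With |v| <= r/2 the tail after the m-th term is at most 2 M (|v|/r)^(m + 1); the second bound
     on |v| makes this smaller than |A_m| |v|^m. *)
  destruct (hz (Rmin (r / 2) (Cmod (A m) * r ^ S m / (2 * M)))) as [z [[z1 z2] fz]].
  { apply Rmin_pos. lra. apply Rdiv_lt_0_compat. apply Rmult_lt_0_compat; auto. lra. }
  assert (m1 := Rmin_l (r / 2) (Cmod (A m) * r ^ S m / (2 * M))).
  assert (m2 := Rmin_r (r / 2) (Cmod (A m) * r ^ S m / (2 * M))).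
  set (v := z - c) in *. set (q := (Cmod v / r)%R).
  assert (hq : (0 <= q <= 1 / 2)%R).
  { unfold q. split. apply div_lt_1; lra. apply Rmult_le_reg_r with r; auto.
    replace (Cmod v / r * r)%R with (Cmod v) by (field; lra). lra. }
  destruct (CSeries_correct (fun n => A n * v ^ n) M q ltac:(lra) (pseries_term_bound A r M v hr HM)) as [_ k].
  specialize (k (S m)). unfold v in k at 1. rewrite <- eA in k by (fold v; unfold r in *; lra). rewrite fz in k.
  assert (cs : forall j, (j <= m)%nat -> csum (fun n => A n * v ^ n) j = RtoC 0).
  { induction j; intros hj; simpl. reflexivity. rewrite IHj, IH by lia. ring. }
  simpl csum in k. rewrite cs in k by lia.
  replace (RtoC 0 - (RtoC 0 + A m * v ^ m)) with (- (A m * v ^ m)) in k by ring.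
  rewrite Cmod_opp, Cmod_mult, Cmod_pow in k.
  assert (vm : (0 < Cmod v ^ m)%R) by (apply pow_lt; auto).
  assert (k2 : (M * q ^ S m / (1 - q) <= 2 * M * q ^ S m)%R).
  { assert (0 <= q ^ S m)%R by (apply pow_le; lra).
    apply Rmult_le_reg_r with (1 - q)%R. lra. replace (M * q ^ S m / (1 - q) * (1 - q))%R with (M * q ^ S m)%R by (field; lra).
    assert (0 <= M * q ^ S m)%R by (apply Rmult_le_pos; lra). nra. }
  assert (k3 : (2 * M * q ^ S m = 2 * M / r ^ S m * Cmod v * Cmod v ^ m)%R).
  { unfold q, Rdiv. rewrite Rpow_mult_distr, pow_inv. simpl. field. split; [apply pow_nonzero|]; lra. }
  assert (k4 : (Cmod (A m) <= 2 * M / r ^ S m * Cmod v)%R).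
  { apply Rmult_le_reg_r with (Cmod v ^ m)%R; auto. lra. }
  assert (k5 : (2 * M / r ^ S m * Cmod v < 2 * M / r ^ S m * (Cmod (A m) * r ^ S m / (2 * M)))%R).
  { apply Rmult_lt_compat_l. apply Rdiv_lt_0_compat; lra. lra. }
  replace (2 * M / r ^ S m * (Cmod (A m) * r ^ S m / (2 * M)))%R with (Cmod (A m)) in k5 by (field; lra). lra. }
intros z hzz. rewrite eA by exact hzz. apply CSeries_unique.
apply (Cser_ext (fun _ => RtoC 0)). intros n. rewrite A0. ring.
apply (Cser_single (fun _ => RtoC 0) 0). reflexivity.
Qed.

Lemma identity_near (f : C -> C) (c : C) (R0 d : R) : (0 < R0)%R -> (0 < d)%R -> holomorphic_on_ball f c R0 ->
  (forall z, (Cmod (z - c) < d)%R -> f z = RtoC 0) ->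
  forall z, (Cmod (z - c) < R0)%R -> f z = RtoC 0.
Proof.
intros hR hd hf H. apply (isolated_zeros f c R0 hR hf).
intros e he. assert (m := Rmin_pos _ _ hd he). assert (m1 := Rmin_l d e). assert (m2 := Rmin_r d e).
exists (c + RtoC (Rmin d e / 2)).
assert (eh : Cmod (c + RtoC (Rmin d e / 2) - c) = (Rmin d e / 2)%R).
{ replace (c + RtoC (Rmin d e / 2) - c) with (RtoC (Rmin d e / 2)) by ring. rewrite Cmod_R. apply Rabs_pos_eq. lra. }
split. rewrite eh. lra. apply H. rewrite eh. lra.
Qed.

(** * Convergence of the matrix products *)

Definition den (l : C) (k : nat) : C := RtoC (INR k) ^ 2 - l ^ 2 / RtoC 4.

Definition entry (lambda mu l : C) (k N i j : nat) : C :=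
  coeff_mat (zero : C_Ring) (Mprod lambda mu l k N) i j.

Lemma coeff_Mmult2 (A B : matrix (T := C_Ring) 2 2) (i j : nat) : (i < 2)%nat -> (j < 2)%nat ->
  coeff_mat (zero : C_Ring) (Mmult A B) i j =
  coeff_mat (zero : C_Ring) A i 0 * coeff_mat (zero : C_Ring) B 0 j
  + coeff_mat (zero : C_Ring) A i 1 * coeff_mat (zero : C_Ring) B 1 j.
Proof.
intros hi hj. unfold Mmult. rewrite coeff_mat_bij by assumption.
simpl pred. rewrite sum_Sn, sum_O. reflexivity.
Qed.

(** The products grow on the right, which suits convergence; splitting off the left factor relates
    R_k to R_(k+1). *)
Lemma Mprod_S_l (lambda mu l : C) (k N : nat) :
  Mprod lambda mu l k (S N) = Mmult (M lambda mu l k) (Mprod lambda mu l (S k) N).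
Proof.
induction N.
- simpl. rewrite Nat.add_0_r, Mmult_one_l, Mmult_one_r. reflexivity.
- change (Mprod lambda mu l k (S (S N))) with (Mmult (Mprod lambda mu l k (S N)) (M lambda mu l (k + S N))).
  rewrite IHN. change (Mprod lambda mu l (S k) (S N)) with (Mmult (Mprod lambda mu l (S k) N) (M lambda mu l (S k + N))).
  rewrite Mmult_assoc. do 2 f_equal. lia.
Qed.

Lemma entry_0 (lambda mu l : C) (k : nat) :
  entry lambda mu l k 0 0 0 = RtoC 1 /\ entry lambda mu l k 0 0 1 = RtoC 0.
Proof. split; reflexivity. Qed.

Lemma entry_S_r (lambda mu l : C) (k N : nat) :
  entry lambda mu l k (S N) 0 0 =
    entry lambda mu l k N 0 0 * (RtoC 1 + lambda / den l (k + N)) + entry lambda mu l k N 0 1 /\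
  entry lambda mu l k (S N) 0 1 = entry lambda mu l k N 0 0 * (mu ^ 2 / den l (k + N)).
Proof.
unfold entry. simpl Mprod. rewrite !coeff_Mmult2 by lia.
unfold M. rewrite !coeff_mat_bij by lia. fold (den l (k + N)). split; ring.
Qed.

Lemma entry_S_l (lambda mu l : C) (k N : nat) :
  entry lambda mu l k (S N) 0 0 =
    (RtoC 1 + lambda / den l k) * entry lambda mu l (S k) N 0 0
    + mu ^ 2 / den l k * entry lambda mu l (S k) N 1 0 /\
  entry lambda mu l k (S N) 1 0 = entry lambda mu l (S k) N 0 0.
Proof.
unfold entry. rewrite Mprod_S_l, !coeff_Mmult2 by lia.
unfold M. rewrite !coeff_mat_bij by lia. fold (den l k). split; ring.
Qed.

Definition noneven (l : C) : Prop := forall k : Z, l <> RtoC 2 * RtoC (IZR k).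

Lemma half_neq (l : C) (k : Z) : noneven l ->
  RtoC (IZR k) - l / RtoC 2 <> RtoC 0 /\ RtoC (IZR k) + l / RtoC 2 <> RtoC 0.
Proof.
assert (h2 : RtoC 2 <> RtoC 0) by (intros h; apply RtoC_inj in h; lra).
intros hl. split; intros h.
- apply (hl k). replace (RtoC (IZR k)) with (RtoC (IZR k) - l / RtoC 2 + l / RtoC 2) by ring.
  rewrite h. field.
- apply (hl (- k)%Z). rewrite opp_IZR, RtoC_opp.
  replace (RtoC (IZR k)) with (RtoC (IZR k) + l / RtoC 2 - l / RtoC 2) by ring.
  rewrite h. field.
Qed.

Lemma den_factor (l : C) (k : nat) :
  den l k = (RtoC (INR k) - l / RtoC 2) * (RtoC (INR k) + l / RtoC 2).
Proof. unfold den. field. Qed.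

Lemma den_neq_0 (l : C) (k : nat) : noneven l -> den l k <> RtoC 0.
Proof.
intros hl. rewrite den_factor, INR_IZR_INZ.
destruct (half_neq l (Z.of_nat k) hl). apply Cmult_neq_0; assumption.
Qed.

Lemma finite_bound (f : nat -> R) (n : nat) : exists K, forall k, (k < n)%nat -> (f k <= K)%R.
Proof.
induction n as [|n [K HK]]. exists 0%R. intros; lia.
exists (Rmax K (f n)). intros k hk. destruct (Nat.eq_dec k n) as [->|h]. apply Rmax_r.
eapply Rle_trans; [apply HK; lia|apply Rmax_l].
Qed.

(** The majorant 1 / ((j + 1)(j + 2)) telescopes, so later sums over j have closed form. For j >=
    |l| + 1 the denominator is at least (3/4) j^2 and (j + 1)(j + 2) <= 6 j^2, so 12 suffices; the
    remaining finitely many j enter through [K]. *)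
Lemma den_growth (l : C) : noneven l -> exists K, (0 < K)%R /\
  forall j : nat, (/ Cmod (den l j) <= K * / ((INR j + 1) * (INR j + 2)))%R.
Proof.
intros hl.
set (f := fun j : nat => ((INR j + 1) * (INR j + 2) / Cmod (den l j))%R).
assert (hc := Cmod_ge_0 l).
destruct (INR_unbounded (Cmod l + 1)) as [J hJ].
destruct (finite_bound f J) as [K HK].
exists (Rmax K 12). split. { eapply Rlt_le_trans; [|apply Rmax_r]. lra. }
intros j. assert (hd := proj1 (Cmod_gt_0 _) (den_neq_0 l j hl)).
assert (hj := pos_INR j).
assert (hp : (0 < (INR j + 1) * (INR j + 2))%R) by nra.
assert (b : (f j <= Rmax K 12)%R).
{ destruct (Nat.lt_ge_cases j J) as [h|h].
  - eapply Rle_trans; [apply HK; exact h|apply Rmax_l].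
  - eapply Rle_trans; [|apply Rmax_r]. apply le_INR in h. unfold f.
    apply Rmult_le_reg_r with (Cmod (den l j)); auto.
    replace ((INR j + 1) * (INR j + 2) / Cmod (den l j) * Cmod (den l j))%R with ((INR j + 1) * (INR j + 2))%R by (field; lra).
    assert (t : (INR j ^ 2 - Cmod l ^ 2 / 4 <= Cmod (den l j))%R).
    { unfold den. assert (q := Cmod_triangle_inv (RtoC (INR j) ^ 2) (- (l ^ 2 / RtoC 4))).
      rewrite Cmod_opp, Cmod_div, !Cmod_pow, !Cmod_R, !Rabs_pos_eq in q by (try lra; intros e; apply RtoC_inj in e; lra).
      exact q. }
    nra. }
unfold f in b. apply Rmult_le_reg_r with ((INR j + 1) * (INR j + 2))%R; auto.
replace (Rmax K 12 * / ((INR j + 1) * (INR j + 2)) * ((INR j + 1) * (INR j + 2)))%R with (Rmax K 12) by (field; split; lra).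
unfold Rdiv in b. lra.
Qed.

Lemma Clim_S_inv (u : nat -> C) (l : C) : Clim (fun n => u (S n)) l -> Clim u l.
Proof.
intros H e he. destruct (H e he) as [N h]. exists (S N). intros n hn.
destruct n; [lia|]. apply h. lia.
Qed.

(** M_k tends not to the identity but to the projection with rows (1, 0) and (1, 0), which fixes the
    column (1, 1). Hence the sum p + q of the first row is the quantity with summable increments p
    (lambda + mu^2) / d, whereas q = p mu^2 / d tends to 0. The rate in k shows that the limits are
    bounded and eventually nonzero. *)
Lemma entry_limit (lambda mu l : C) : noneven l -> exists K, forall k, exists x,
  Clim (fun N => entry lambda mu l k N 0 0) x /\ (Cmod (x - RtoC 1) <= K / (INR k + 1))%R.
Proof.
intros hl. destruct (den_growth l hl) as [K0 [hK0 HK0]].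
set (K := ((Cmod lambda + Cmod (mu ^ 2)) * K0)%R).
assert (hla := Cmod_ge_0 lambda). assert (hmu := Cmod_ge_0 (mu ^ 2)).
assert (hK : (0 <= K)%R) by (apply Rmult_le_pos; lra).
exists (exp K * K)%R. intros k.
set (p := fun N => entry lambda mu l k N 0 0). set (q := fun N => entry lambda mu l k N 0 1).
(* A telescoping majorant: its decrements bound the relative growth of |p| + |q| at each step. *)
set (a := fun N : nat => (K / (INR k + INR N + 1))%R).
assert (hk := pos_INR k).
assert (ha : forall N, (0 <= a N)%R).
{ intros N. unfold a. assert (h := pos_INR N). apply Rmult_le_pos; auto. left; apply Rinv_0_lt_compat; lra. }
assert (Ha : forall N, ((Cmod lambda + Cmod (mu ^ 2)) * / Cmod (den l (k + N)) <= a N - a (S N))%R).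
{ intros N. unfold a. assert (h := pos_INR N). specialize (HK0 (k + N)%nat). rewrite plus_INR in HK0. rewrite S_INR.
  replace (K / (INR k + INR N + 1) - K / (INR k + (INR N + 1) + 1))%R
    with ((Cmod lambda + Cmod (mu ^ 2)) * (K0 * / ((INR k + INR N + 1) * (INR k + INR N + 2))))%R by (unfold K; field; lra).
  apply Rmult_le_compat_l; lra. }
assert (a0 : a 0%nat = (K / (INR k + 1))%R) by (unfold a; simpl; f_equal; ring).
assert (a0K : (a 0%nat <= K)%R).
{ rewrite a0. apply Rmult_le_reg_r with (INR k + 1)%R. lra. replace (K / (INR k + 1) * (INR k + 1))%R with K by (field; lra). nra. }
assert (adiv : forall N w, (Cmod (w / den l (k + N)) = Cmod w * / Cmod (den l (k + N)))%R).
{ intros N w. rewrite Cmod_div by (apply den_neq_0, hl). reflexivity. }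
assert (bnd : forall N, (Cmod (p N) + Cmod (q N) <= exp (a 0%nat - a N))%R).
{ induction N.
  - unfold p, q. destruct (entry_0 lambda mu l k) as [-> ->]. rewrite Cmod_1, Cmod_0, Rminus_diag, exp_0. lra.
  - unfold p, q. destruct (entry_S_r lambda mu l k N) as [-> ->]. fold (p N) (q N).
    assert (t := Cmod_triangle (p N * (RtoC 1 + lambda / den l (k + N))) (q N)).
    rewrite Cmod_mult in t. assert (t2 := Cmod_triangle (RtoC 1) (lambda / den l (k + N))). rewrite Cmod_1 in t2.
    rewrite (Cmod_mult (p N) (mu ^ 2 / _)). rewrite adiv in *. specialize (Ha N).
    assert (pp := Cmod_ge_0 (p N)). assert (qp := Cmod_ge_0 (q N)).
    assert (e1 := exp_ineq1_le (a N - a (S N))).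
    replace (a 0%nat - a (S N))%R with ((a 0%nat - a N) + (a N - a (S N)))%R by ring. rewrite exp_plus.
    set (i := (/ Cmod (den l (k + N)))%R) in *.
    assert (i0 : (0 <= i)%R) by (left; apply Rinv_0_lt_compat, Cmod_gt_0, den_neq_0, hl).
    assert (s1 : (Cmod (p N) * Cmod (RtoC 1 + lambda / den l (k + N)) <= Cmod (p N) * (1 + Cmod lambda * i))%R) by (apply Rmult_le_compat_l; lra).
    assert (s2 : ((Cmod (p N) + Cmod (q N)) * (1 + (Cmod lambda + Cmod (mu ^ 2)) * i) <= exp (a 0%nat - a N) * exp (a N - a (S N)))%R).
    { apply Rmult_le_compat; try lra. assert (0 <= (Cmod lambda + Cmod (mu ^ 2)) * i)%R by (apply Rmult_le_pos; lra). lra. }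
    assert (0 <= Cmod (q N) * ((Cmod lambda + Cmod (mu ^ 2)) * i))%R by (repeat apply Rmult_le_pos; lra).
    lra. }
assert (pB : forall N, (Cmod (p N) <= exp K)%R).
{ intros N. assert (b := bnd N). assert (h := Cmod_ge_0 (q N)).
  assert (exp (a 0%nat - a N) <= exp K)%R by (apply exp_le; specialize (ha N); lra). lra. }
assert (eK := exp_pos K).
set (s := fun N => p N + q N).
assert (sd : forall N, (Cmod (s (S N) - s N) <= exp K * (a N - a (S N)))%R).
{ intros N. unfold s, p, q. destruct (entry_S_r lambda mu l k N) as [-> ->]. fold (p N) (q N).
  replace (p N * (RtoC 1 + lambda / den l (k + N)) + q N + p N * (mu ^ 2 / den l (k + N)) - (p N + q N))
    with (p N * (lambda / den l (k + N) + mu ^ 2 / den l (k + N))) by ring.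
  rewrite Cmod_mult. assert (t := Cmod_triangle (lambda / den l (k + N)) (mu ^ 2 / den l (k + N))).
  rewrite !adiv in t. specialize (Ha N).
  apply Rmult_le_compat; try apply Cmod_ge_0; auto. lra. }
assert (st : forall n m, (n <= m)%nat -> (Cmod (s m - s n) <= exp K * (a n - a m))%R).
{ intros n m h. induction h as [|m h IH].
  - replace (s n - s n) with (RtoC 0) by ring. rewrite Cmod_0. lra.
  - replace (s (S m) - s n) with ((s (S m) - s m) + (s m - s n)) by ring.
    eapply Rle_trans; [apply Cmod_triangle|]. specialize (sd m). lra. }
assert (al : is_lim_seq a 0%R).
{ unfold a. apply is_lim_seq_ext with (fun n => (K * / (INR (n + S k)))%R).
  - intros n. unfold Rdiv. rewrite plus_INR, S_INR. do 2 f_equal. ring.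
  - replace (Finite 0) with (Rbar_mult (Finite K) (Finite 0)) by (simpl; f_equal; ring).
    apply is_lim_seq_scal_l. apply (is_lim_seq_incr_n (fun n => (/ INR n)%R)).
    replace (Finite 0) with (Rbar_inv p_infty) by reflexivity. apply is_lim_seq_inv. apply is_lim_seq_INR. discriminate. }
destruct (Clim_cauchy s (fun n => (exp K * a n)%R)) as [x [hx1 hx2]].
{ replace (Finite 0) with (Rbar_mult (Finite (exp K)) (Finite 0)) by (simpl; f_equal; ring). apply is_lim_seq_scal_l, al. }
{ intros n m h. eapply Rle_trans; [apply st, h|]. apply Rmult_le_compat_l. lra. specialize (ha m). lra. }
assert (qlim : Clim (fun N => (q (S N))) (RtoC 0)).
{ intros e he.
  assert (L : is_lim_seq (fun n => (exp K * a n)%R) 0%R).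
  { replace (Finite 0) with (Rbar_mult (Finite (exp K)) (Finite 0)) by (simpl; f_equal; ring). apply is_lim_seq_scal_l, al. }
  apply is_lim_seq_spec in L. destruct (L (mkposreal e he)) as [N hN]. exists N. intros n hn. specialize (hN n hn).
  simpl in hN. rewrite Rminus_0_r in hN. replace (q (S n) - RtoC 0) with (q (S n)) by ring.
  eapply Rle_lt_trans; [|eapply Rle_lt_trans; [apply Rle_abs|exact hN]].
  unfold q. destruct (entry_S_r lambda mu l k n) as [_ ->]. fold (p n). rewrite Cmod_mult, adiv.
  apply Rmult_le_compat; auto. apply Cmod_ge_0.
  apply Rmult_le_pos; auto. left; apply Rinv_0_lt_compat, Cmod_gt_0, den_neq_0, hl.
  specialize (Ha n). specialize (ha (S n)).
  assert (0 <= Cmod lambda * / Cmod (den l (k + n)))%R.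
  { apply Rmult_le_pos; auto. left; apply Rinv_0_lt_compat, Cmod_gt_0, den_neq_0, hl. }
  lra. }
exists x. split.
- replace x with (x + RtoC (-1) * RtoC 0) by ring.
  apply (Clim_ext (fun n => s n + RtoC (-1) * q n)).
  { intros n. unfold s. fold (p n). ring. }
  apply Clim_plus. exact hx1. apply Clim_scal. apply Clim_S_inv, qlim.
- specialize (hx2 0%nat). change (s 0%nat) with (entry lambda mu l k 0 0 0 + entry lambda mu l k 0 0 1) in hx2. destruct (entry_0 lambda mu l k) as [e1 e2]. rewrite e1, e2 in hx2.
  replace (RtoC 1 + RtoC 0) with (RtoC 1) in hx2 by ring. rewrite a0 in hx2. unfold Rdiv in *. lra.
Qed.

(** The lower row (1, 0) of M_k makes the lower left entry of R_k equal to the upper left entry of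
    R_(k+1), so R_k = M_k R_(k+1) becomes a scalar recurrence. *)
Lemma Rinf_spec (lambda mu l : C) : noneven l -> exists x : nat -> C,
  Rinf lambda mu l 0 1 1 = x 0%nat /\ Rinf lambda mu l 0 2 1 = x 1%nat /\
  (forall k, x k = (RtoC 1 + lambda / den l k) * x (S k) + mu ^ 2 / den l k * x (S (S k))) /\
  (exists K, forall k, (Cmod (x k) <= K)%R) /\ exists k, x k <> RtoC 0.
Proof.
intros hl. destruct (entry_limit lambda mu l hl) as [K HK].
set (x := fun k => Rinf lambda mu l k 1 1).
assert (hx : forall k, Clim (fun N => entry lambda mu l k N 0 0) (x k) /\ (Cmod (x k - RtoC 1) <= K / (INR k + 1))%R).
{ intros k. destruct (HK k) as [y [h1 h2]].
  replace (x k) with y. split; assumption. symmetry. apply (CLim_seq_unique _ _ h1). }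
assert (h10 : forall k, Clim (fun N => entry lambda mu l k N 1 0) (x (S k))).
{ intros k. apply Clim_S_inv. apply (Clim_ext (fun N => entry lambda mu l (S k) N 0 0)).
  intros n. symmetry. exact (proj2 (entry_S_l lambda mu l k n)). apply hx. }
assert (hK : (0 <= K)%R).
{ destruct (hx 0%nat) as [_ h]. assert (q := Cmod_ge_0 (x 0%nat - RtoC 1)). simpl in h. lra. }
exists x. split; [reflexivity|]. split.
{ apply (CLim_seq_unique _ _ (h10 0%nat)). }
split.
{ intros k. apply (Clim_unique (fun N => entry lambda mu l k (S N) 0 0)).
  apply (Clim_S (fun N => entry lambda mu l k N 0 0)), hx.
  apply (Clim_ext (fun N => (RtoC 1 + lambda / den l k) * entry lambda mu l (S k) N 0 0 + mu ^ 2 / den l k * entry lambda mu l (S k) N 1 0)).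
  intros n. symmetry. exact (proj1 (entry_S_l lambda mu l k n)).
  apply Clim_plus; apply Clim_scal. apply hx. apply h10. }
split.
- exists (K + 1)%R. intros k. destruct (hx k) as [_ h].
  assert (t := Cmod_triangle (x k - RtoC 1) (RtoC 1)). replace (x k - RtoC 1 + RtoC 1) with (x k) in t by ring. rewrite Cmod_1 in t.
  assert (hk := pos_INR k).
  assert (K / (INR k + 1) <= K)%R.
  { apply Rmult_le_reg_r with (INR k + 1)%R. lra. replace (K / (INR k + 1) * (INR k + 1))%R with K by (field; lra). nra. }
  lra.
- destruct (INR_unbounded K) as [k hk]. exists k. intros e. destruct (hx k) as [_ h]. rewrite e in h.
  replace (RtoC 0 - RtoC 1) with (- RtoC 1) in h by ring. rewrite Cmod_opp, Cmod_1 in h.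
  assert (K / (INR k + 1) < 1)%R; [|lra].
  apply Rmult_lt_reg_r with (INR k + 1)%R. lra. replace (K / (INR k + 1) * (INR k + 1))%R with K by (field; lra). lra.
Qed.

(** * The three-term recurrence *)


(* With h = l / 2 this is the coefficient of z^(k - h) of the equation for E = z^(-h) sum_k a_k z^k. *)
Definition recurrence_at (lambda mu h : C) (a : Z -> C) (k : Z) : Prop :=
  ([k] ^ 2 - h ^ 2 + lambda) * a k + mu * ([k] + RtoC 1 - h) * a (k + 1)%Z
  - mu * ([k] + h) * a (k - 1)%Z = RtoC 0.

(* Coefficients of the involution E(z) -> 2 omega z^(- l - 1) (E'(1/z) - mu E(1/z)) of the solution space. *)
Definition sharp (omega mu h : C) (a : Z -> C) (m : Z) : C :=
  RtoC 2 * omega * ((- [m] - h) * a (- m)%Z - mu * a (- m - 1)%Z).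

(** The recurrence of the image at k is 2 omega times (- k - h) times that of [a] at -k, minus mu
    times that at -k - 1. Only these two indices enter, so a solution known on one side can be
    reflected. *)
Lemma sharp_recurrence (lambda mu omega h : C) (a : Z -> C) (k : Z) :
  recurrence_at lambda mu h a (- k) -> recurrence_at lambda mu h a (- k - 1) ->
  recurrence_at lambda mu h (sharp omega mu h a) k.
Proof.
unfold recurrence_at, sharp. intros H1 H2.
replace (- k - 1 + 1)%Z with (- k)%Z in H2 by ring.
replace (- (k + 1))%Z with (- k - 1)%Z by ring. replace (- (k - 1))%Z with (- k + 1)%Z by ring.
replace (- k + 1 - 1)%Z with (- k)%Z by ring.
rewrite !plus_IZR, !minus_IZR, !opp_IZR in *. rewrite !RtoC_plus, !RtoC_minus, !RtoC_opp in *.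
set (K := [k]) in *. set (x := a (- k)%Z) in *. set (y := a (- k - 1)%Z) in *.
set (z := a (- k - 1 - 1)%Z) in *. set (w := a (- k + 1)%Z) in *.
transitivity (RtoC 2 * omega * ((- K - h) * (((- K) ^ 2 - h ^ 2 + lambda) * x + mu * (- K + RtoC 1 - h) * w - mu * (- K + h) * y)
  - mu * (((- K - RtoC 1) ^ 2 - h ^ 2 + lambda) * y + mu * (- K - RtoC 1 + RtoC 1 - h) * x - mu * (- K - RtoC 1 + h) * z))).
ring. rewrite H1, H2. ring.
Qed.

(** Expanded, the twofold image is 4 omega^2 ((lambda + mu^2) a_m - X), where X is the left side of
    the recurrence at m. *)
Lemma sharp_involutive (lambda mu omega h : C) (a : Z -> C) (m : Z) :
  lambda + mu ^ 2 = RtoC 1 / (RtoC 4 * omega ^ 2) -> omega <> RtoC 0 ->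
  recurrence_at lambda mu h a m ->
  sharp omega mu h (sharp omega mu h a) m = a m.
Proof.
intros e ho H. unfold recurrence_at, sharp in *.
replace (- - m)%Z with m by ring. replace (- - m - 1)%Z with (m - 1)%Z by ring.
replace (- (- m - 1))%Z with (m + 1)%Z by ring. replace (m + 1 - 1)%Z with m by ring.
rewrite !minus_IZR, !opp_IZR. rewrite !RtoC_minus, !RtoC_opp.
set (K := [m]) in *. set (x := a m) in *. set (y := a (m + 1)%Z) in *. set (z := a (m - 1)%Z) in *.
transitivity (RtoC 4 * omega ^ 2 * ((lambda + mu ^ 2) * x - ((K ^ 2 - h ^ 2 + lambda) * x + mu * (K + RtoC 1 - h) * y - mu * (K + h) * z))).
{ replace (RtoC 4) with (RtoC 2 * RtoC 2) by (rewrite <- RtoC_mult; f_equal; ring). ring. }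
rewrite H, e. field. exact ho.
Qed.

Definition nonresonant (h : C) : Prop := forall k : Z, [k] - h <> RtoC 0 /\ [k] + h <> RtoC 0.

(** The coefficients mu (k + 1 - h) and mu (k + h) of the outer terms are nonzero, so the recurrence
    can be solved for either neighbour. *)
Lemma recurrence_zero (lambda mu h : C) (a : Z -> C) : mu <> RtoC 0 -> nonresonant h ->
  (forall k, recurrence_at lambda mu h a k) -> a (-1)%Z = RtoC 0 -> a 0%Z = RtoC 0 ->
  forall m, a m = RtoC 0.
Proof.
intros hmu hh H e1 e0.
assert (F : forall n : nat, a (Z.of_nat n - 1)%Z = RtoC 0 /\ a (Z.of_nat n) = RtoC 0).
{ induction n as [|n [IH1 IH2]]. split; assumption.
  rewrite Nat2Z.inj_succ. replace (Z.succ (Z.of_nat n) - 1)%Z with (Z.of_nat n) by lia. split. exact IH2.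
  specialize (H (Z.of_nat n)). unfold recurrence_at in H. rewrite IH1, IH2 in H.
  replace (Z.succ (Z.of_nat n)) with (Z.of_nat n + 1)%Z by lia.
  destruct (hh (Z.of_nat n + 1)%Z) as [n1 _]. rewrite plus_IZR, RtoC_plus in n1.
  destruct (Ceq_dec (a (Z.of_nat n + 1)%Z) (RtoC 0)) as [e|e]; [exact e|exfalso].
  apply (Cmult_neq_0 _ _ (Cmult_neq_0 _ _ hmu n1) e). rewrite <- H. ring. }
assert (G : forall n : nat, a (- Z.of_nat n - 1)%Z = RtoC 0 /\ a (- Z.of_nat n)%Z = RtoC 0).
{ induction n as [|n [IH1 IH2]]. split; assumption.
  rewrite Nat2Z.inj_succ. replace (- Z.succ (Z.of_nat n))%Z with (- Z.of_nat n - 1)%Z by lia. split; [|exact IH1].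
  specialize (H (- Z.of_nat n - 1)%Z). unfold recurrence_at in H.
  replace (- Z.of_nat n - 1 + 1)%Z with (- Z.of_nat n)%Z in H by lia. rewrite IH1, IH2 in H.
  destruct (hh (- Z.of_nat n - 1)%Z) as [_ n1].
  destruct (Ceq_dec (a (- Z.of_nat n - 1 - 1)%Z) (RtoC 0)) as [e|e]; [exact e|exfalso].
  apply (Cmult_neq_0 _ _ (Cmult_neq_0 _ _ hmu n1) e).
  match type of H with ?X = _ => replace (mu * ([(- Z.of_nat n - 1)] + h) * a (- Z.of_nat n - 1 - 1)%Z) with (- X) by ring end.
  rewrite H. ring. }
intros m. destruct (Z_le_gt_dec 0 m).
- rewrite <- (Z2Nat.id m) by lia. apply F.
- replace m with (- Z.of_nat (Z.to_nat (- m)))%Z by lia. apply G.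
Qed.

(** * The solution decaying to the right *)

Section DecayingSolution.
Context (lambda mu h : C) (hmu : mu <> RtoC 0) (hh : nonresonant h).

(** The normalisation mu^n / ((0 - h)(1 - h) ... (n - 1 - h)) that turns the recurrence into the one
    defined by the first row of M_k. *)
Fixpoint gain (n : nat) : C :=
  match n with O => RtoC 1 | S n => gain n * (mu / (RtoC (INR n) - h)) end.

Lemma gain_neq_0 (n : nat) : gain n <> RtoC 0.
Proof.
induction n; simpl. exact C1_nz. apply Cmult_neq_0; auto.
destruct (hh (Z.of_nat n)) as [h1 _]. rewrite <- INR_IZR_INZ in h1.
apply Cmult_neq_0; auto. intros e. apply C1_nz. rewrite <- (Cinv_r _ h1), e. ring.
Qed.

Lemma eventually_decreasing_bounded (u : nat -> R) (N : nat) :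
  (forall n, (N <= n)%nat -> (u (S n) <= u n)%R) -> exists K, forall n, (u n <= K)%R.
Proof.
intros H. destruct (finite_bound u (S N)) as [K HK]. exists K. intros n.
destruct (Nat.le_gt_cases n N). apply HK; lia.
replace n with (N + (n - N))%nat by lia. induction (n - N)%nat. rewrite Nat.add_0_r. apply HK; lia.
rewrite Nat.add_succ_r. eapply Rle_trans; [apply H; lia|exact IHn0].
Qed.

(** The ratio of consecutive terms, |mu| r / |n - h|, is at most 1 once n exceeds |h| + |mu| r. *)
Lemma gain_decay (r : R) : (0 < r)%R -> exists K, forall n, (Cmod (gain n) * r ^ n <= K)%R.
Proof.
intros hr. destruct (INR_unbounded (Cmod h + Cmod mu * r)) as [N hN].
apply (eventually_decreasing_bounded _ N). intros n hn. simpl gain. simpl pow.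
apply le_INR in hn.
assert (t := Cmod_triangle_inv (RtoC (INR n)) (- h)). rewrite Cmod_opp, Cmod_R, Rabs_pos_eq in t by apply pos_INR.
fold (RtoC (INR n) - h) in t.
destruct (hh (Z.of_nat n)) as [h1 _]. rewrite <- INR_IZR_INZ in h1.
rewrite Cmod_mult, Cmod_div by exact h1.
assert (d := proj1 (Cmod_gt_0 _) h1).
replace (Cmod (gain n) * (Cmod mu / Cmod (RtoC (INR n) - h)) * (r * r ^ n))%R
  with ((Cmod (gain n) * r ^ n) * (Cmod mu * r / Cmod (RtoC (INR n) - h)))%R by (field; lra).
rewrite <- (Rmult_1_r (Cmod (gain n) * r ^ n)) at 2.
apply Rmult_le_compat_l. apply Rmult_le_pos. apply Cmod_ge_0. apply pow_le; lra.
apply Rmult_le_reg_r with (Cmod (RtoC (INR n) - h)); auto.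
replace (Cmod mu * r / Cmod (RtoC (INR n) - h) * Cmod (RtoC (INR n) - h))%R with (Cmod mu * r)%R by (field; lra). lra.
Qed.

Context (x : nat -> C) (Kx : R).
Context (hx : forall k : nat, x k =
  (RtoC 1 + lambda / (RtoC (INR k) ^ 2 - h ^ 2)) * x (S k) + mu ^ 2 / (RtoC (INR k) ^ 2 - h ^ 2) * x (S (S k))).
Context (bx : forall k, (Cmod (x k) <= Kx)%R).

(* Meaningful for m >= -1 only. *)
Definition decaying (m : Z) : C := gain (Z.to_nat (m + 1)) * x (Z.to_nat (m + 1)).

Lemma decaying_recurrence (k : Z) : (0 <= k)%Z -> recurrence_at lambda mu h decaying k.
Proof.
intros hk. unfold recurrence_at, decaying.
set (n := Z.to_nat k).
replace (Z.to_nat (k + 1)) with (S n) by lia. replace (Z.to_nat (k + 1 + 1)) with (S (S n)) by lia.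
replace (Z.to_nat (k - 1 + 1)) with n by lia.
assert (ek : [k] = RtoC (INR n)) by (rewrite INR_IZR_INZ; do 2 f_equal; lia).
destruct (hh k) as [h1 h2]. destruct (hh (k + 1)%Z) as [h3 _].
rewrite plus_IZR, RtoC_plus in h3. rewrite ek in *.
change (gain (S (S n))) with (gain n * (mu / (RtoC (INR n) - h)) * (mu / (RtoC (INR (S n)) - h))).
change (gain (S n)) with (gain n * (mu / (RtoC (INR n) - h))).
rewrite S_INR, RtoC_plus, (hx n).
field. repeat split; auto.
replace (RtoC (INR n) ^ 2 - h ^ 2) with ((RtoC (INR n) - h) * (RtoC (INR n) + h)) by ring.
apply Cmult_neq_0; auto.
Qed.

Lemma decaying_decay (r : R) : (0 < r)%R -> exists K, forall n : nat, (Cmod (decaying (Z.of_nat n - 1)) * r ^ n <= K)%R.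
Proof.
intros hr. destruct (gain_decay r hr) as [K HK].
assert (hK : (0 <= Kx)%R) by (eapply Rle_trans; [apply Cmod_ge_0|apply (bx 0%nat)]).
exists (K * Kx)%R. intros n. unfold decaying. replace (Z.to_nat (Z.of_nat n - 1 + 1)) with n by lia.
rewrite Cmod_mult. replace (Cmod (gain n) * Cmod (x n) * r ^ n)%R with ((Cmod (gain n) * r ^ n) * Cmod (x n))%R by ring.
apply Rmult_le_compat; auto. apply Rmult_le_pos. apply Cmod_ge_0. apply pow_le; lra. apply Cmod_ge_0.
Qed.

(* The Casoratian of b with the decaying solution changes by factors of modulus tending to 1,
   yet decays faster than 4^-n. *)
Lemma casoratian_zero (b : Z -> C) (K r : R) : (1 <= r)%R ->
  (forall k, (0 <= k)%Z -> recurrence_at lambda mu h b k) ->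
  (forall n : nat, (Cmod (b (Z.of_nat n - 1)%Z) <= K * r ^ n)%R) ->
  b (-1)%Z * decaying 0 = b 0%Z * decaying (-1).
Proof.
intros hr H hb.
assert (hK : (0 <= K)%R).
{ specialize (hb 0%nat). simpl in hb. assert (q := Cmod_ge_0 (b (-1)%Z)). lra. }
set (W := fun n : nat => b (Z.of_nat n - 1)%Z * decaying (Z.of_nat n) - b (Z.of_nat n) * decaying (Z.of_nat n - 1)).
(* Eliminating the middle terms from the two recurrences relates consecutive Casoratians. *)
assert (rec : forall n : nat, (RtoC (INR n) + RtoC 1 - h) * W (S n) = - ((RtoC (INR n) + h) * W n)).
{ intros n. unfold W. rewrite Nat2Z.inj_succ. replace (Z.succ (Z.of_nat n)) with (Z.of_nat n + 1)%Z by lia.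
  replace (Z.of_nat n + 1 - 1)%Z with (Z.of_nat n) by lia.
  assert (r1 := H (Z.of_nat n) ltac:(lia)). assert (r2 := decaying_recurrence (Z.of_nat n) ltac:(lia)).
  unfold recurrence_at in r1, r2. rewrite <- INR_IZR_INZ in r1, r2.
  set (N := RtoC (INR n)) in *.
  set (b0 := b (Z.of_nat n)) in *. set (b1 := b (Z.of_nat n + 1)%Z) in *. set (b2 := b (Z.of_nat n - 1)%Z) in *.
  set (d0 := decaying (Z.of_nat n)) in *. set (d1 := decaying (Z.of_nat n + 1)) in *. set (d2 := decaying (Z.of_nat n - 1)) in *.
  assert (e : mu * ((N + RtoC 1 - h) * (b0 * d1 - b1 * d0) + (N + h) * (b2 * d0 - b0 * d2)) = RtoC 0).
  { transitivity (b0 * ((N ^ 2 - h ^ 2 + lambda) * d0 + mu * (N + RtoC 1 - h) * d1 - mu * (N + h) * d2)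
      - d0 * ((N ^ 2 - h ^ 2 + lambda) * b0 + mu * (N + RtoC 1 - h) * b1 - mu * (N + h) * b2)). ring.
    rewrite r1, r2. ring. }
  assert (e' : (N + RtoC 1 - h) * (b0 * d1 - b1 * d0) + (N + h) * (b2 * d0 - b0 * d2) = RtoC 0).
  { destruct (Ceq_dec ((N + RtoC 1 - h) * (b0 * d1 - b1 * d0) + (N + h) * (b2 * d0 - b0 * d2)) (RtoC 0)) as [q|q]; auto.
    exfalso. exact (Cmult_neq_0 _ _ hmu q e). }
  apply Ceq_minus. rewrite <- e'. ring. }
(* The factor r compensates the growth of [b], and 4^(-n) is left over. *)
destruct (decaying_decay (4 * r) ltac:(lra)) as [D HD].
assert (hD : (0 <= D)%R).
{ specialize (HD 0%nat). simpl in HD. assert (q := Cmod_ge_0 (decaying (-1))). lra. }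
set (L := (K * D + K * r * D)%R).
assert (Wb : forall n, (Cmod (W n) * 4 ^ n <= L)%R).
{ intros n. unfold W.
  assert (q4 : (0 < 4 ^ n)%R) by (apply pow_lt; lra). assert (qr : (0 < r ^ n)%R) by (apply pow_lt; lra).
  assert (h1 := hb n). assert (h2 := hb (S n)). assert (h3 := HD n). assert (h4 := HD (S n)).
  rewrite Nat2Z.inj_succ in h2, h4. replace (Z.succ (Z.of_nat n) - 1)%Z with (Z.of_nat n) in h2, h4 by lia.
  rewrite Rpow_mult_distr in h3, h4. simpl pow in h2, h4.
  set (b0 := b (Z.of_nat n)) in *. set (b2 := b (Z.of_nat n - 1)%Z) in *.
  set (d0 := decaying (Z.of_nat n)) in *. set (d2 := decaying (Z.of_nat n - 1)) in *.
  assert (p3 := Cmod_ge_0 d0). assert (p4 := Cmod_ge_0 d2).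
  assert (t := Cmod_triangle_minus (b2 * d0) (b0 * d2)). rewrite !Cmod_mult in t.
  assert (m1 : (Cmod b2 * Cmod d0 <= K * r ^ n * Cmod d0)%R) by (apply Rmult_le_compat_r; auto).
  assert (m2 : (Cmod b0 * Cmod d2 <= K * (r * r ^ n) * Cmod d2)%R) by (apply Rmult_le_compat_r; auto).
  assert (m3 : (K * (Cmod d2 * (4 ^ n * r ^ n)) <= K * D)%R) by (apply Rmult_le_compat_l; auto).
  assert (m4 : (K * (Cmod d0 * (4 * 4 ^ n * (r * r ^ n))) <= K * D)%R) by (apply Rmult_le_compat_l; auto).
  assert (m5 : (Cmod (b2 * d0 - b0 * d2) * 4 ^ n <= (K * r ^ n * Cmod d0 + K * (r * r ^ n) * Cmod d2) * 4 ^ n)%R).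
  { apply Rmult_le_compat_r; lra. }
  unfold L.
  assert (m6 : (K * r * (Cmod d2 * (4 ^ n * r ^ n)) <= K * r * D)%R).
  { apply Rmult_le_compat_l; auto. apply Rmult_le_pos; lra. }
  assert (m7 : (K * r ^ n * Cmod d0 * 4 ^ n <= K * D)%R).
  { eapply Rle_trans; [|exact m4].
    replace (K * (Cmod d0 * (4 * 4 ^ n * (r * r ^ n))))%R with ((K * r ^ n * Cmod d0 * 4 ^ n) * (4 * r))%R by ring.
    assert (0 <= K * r ^ n * Cmod d0 * 4 ^ n)%R by (repeat apply Rmult_le_pos; lra). nra. }
  lra. }
(* For n >= 1 + 3 |h| one has n + 1 + |h| <= 2 (n - |h|), so the Casoratian loses at most a factor 2
   per step, which cannot be reconciled with a decay like 4^(-n) unless it vanishes. *)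
destruct (INR_unbounded (1 + 3 * Cmod h)) as [N hN].
assert (hch := Cmod_ge_0 h).
assert (half : forall n, (N <= n)%nat -> (Cmod (W n) <= 2 * Cmod (W (S n)))%R).
{ intros n hn. apply le_INR in hn.
  assert (e := f_equal Cmod (rec n)). rewrite Cmod_opp, !Cmod_mult in e.
  assert (t1 := Cmod_triangle_inv (RtoC (INR n)) h). rewrite Cmod_R, Rabs_pos_eq in t1 by apply pos_INR.
  assert (t2 := Cmod_triangle_minus (RtoC (INR n) + RtoC 1) h). rewrite <- RtoC_plus, Cmod_R, Rabs_pos_eq in t2 by (assert (q := pos_INR n); lra).
  rewrite RtoC_plus in t2.
  assert (p2 := Cmod_ge_0 (W (S n))).
  set (P := Cmod (RtoC (INR n) + h)) in *. set (Q := Cmod (RtoC (INR n) + RtoC 1 - h)) in *.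
  assert (hP : (0 < P)%R) by lra. assert (hQ : (Q <= 2 * P)%R) by lra.
  apply Rmult_le_reg_l with P; auto. rewrite <- e.
  replace (P * (2 * Cmod (W (S n))))%R with (2 * P * Cmod (W (S n)))%R by ring.
  apply Rmult_le_compat_r; auto. }
assert (WN : W N = RtoC 0).
{ assert (g : forall j, (Cmod (W N) <= 2 ^ j * Cmod (W (N + j)%nat))%R).
  { induction j. rewrite Nat.add_0_r. simpl; lra.
    rewrite Nat.add_succ_r. eapply Rle_trans; [exact IHj|]. simpl pow.
    assert (q := half (N + j)%nat ltac:(lia)). assert (0 < 2 ^ j)%R by (apply pow_lt; lra). nra. }
  destruct (Ceq_dec (W N) (RtoC 0)) as [q|q]; [exact q|exfalso].
  assert (hp := proj1 (Cmod_gt_0 _) q).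
  destruct (Pow_x_infinity 2 ltac:(rewrite Rabs_pos_eq; lra) (L / Cmod (W N) + 1)%R) as [j hj].
  specialize (hj j (le_n _)). assert (p2 : (0 < 2 ^ j)%R) by (apply pow_lt; lra). rewrite Rabs_pos_eq in hj by lra.
  specialize (g j). specialize (Wb (N + j)%nat).
  assert (p4 : (2 ^ j * 2 ^ j <= 4 ^ (N + j))%R).
  { rewrite <- Rpow_mult_distr, pow_add. replace (2 * 2)%R with 4%R by ring.
    assert (1 <= 4 ^ N)%R by (apply pow_R1_Rle; lra). assert (0 < 4 ^ j)%R by (apply pow_lt; lra). nra. }
  assert (g2 : (Cmod (W N) * 2 ^ j <= L)%R).
  { eapply Rle_trans; [|exact Wb]. apply Rle_trans with (Cmod (W (N + j)%nat) * (2 ^ j * 2 ^ j))%R; nra. }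
  assert (g3 : (Cmod (W N) * (L / Cmod (W N) + 1) <= Cmod (W N) * 2 ^ j)%R) by (apply Rmult_le_compat_l; lra).
  replace (Cmod (W N) * (L / Cmod (W N) + 1))%R with (L + Cmod (W N))%R in g3 by (field; lra). lra. }
(* Since n + h is nonzero, the vanishing at N propagates down to 0. *)
assert (back : forall n, W (S n) = RtoC 0 -> W n = RtoC 0).
{ intros n e. specialize (rec n). rewrite e in rec.
  destruct (hh (Z.of_nat n)) as [_ h2]. rewrite <- INR_IZR_INZ in h2.
  destruct (Ceq_dec (W n) (RtoC 0)) as [q|q]; [exact q|exfalso].
  apply (Cmult_neq_0 _ _ h2 q). replace ((RtoC (INR n) + h) * W n) with (- - ((RtoC (INR n) + h) * W n)) by ring. rewrite <- rec. ring. }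
assert (W0 : W 0%nat = RtoC 0).
{ clear -WN back. induction N; auto. }
apply Ceq_minus. exact W0.
Qed.

Lemma decaying_values : decaying (-1) = x 0%nat /\ decaying 0 = mu / (- h) * x 1%nat.
Proof.
split; unfold decaying.
- change (RtoC 1 * x 0%nat = x 0%nat). ring.
- change (RtoC 1 * (mu / (RtoC 0 - h)) * x 1%nat = mu / (- h) * x 1%nat).
  replace (RtoC 0 - h) with (- h) by ring. ring.
Qed.

End DecayingSolution.

(** * Symmetric solutions and the condition of the theorem *)

(** At index 0 the involution involves only b_0 and b_(-1), so symmetry there is one linear relation
    between these two values. *)
Lemma sharp_eigen_condition (omega mu h s : C) (b : Z -> C) :
  b 0%Z = s * sharp omega mu h b 0 <->
  b 0%Z * (RtoC 1 + s * omega * (RtoC 2 * h)) + RtoC 2 * s * omega * mu * b (-1)%Z = RtoC 0.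
Proof.
unfold sharp. simpl Z.sub. simpl Z.opp.
split; intros H.
- transitivity (b 0%Z - s * (RtoC 2 * omega * ((- RtoC 0 - h) * b 0%Z - mu * b (-1)%Z))). ring.
  rewrite <- H. ring.
- apply Ceq_minus. etransitivity; [|exact H]. ring.
Qed.

(** The factor growing like |m| in [sharp] is absorbed by 2^n, which is why the rate r becomes 2
    r. *)
Lemma sharp_growth (omega mu h : C) (a : Z -> C) (K r : R) : (1 <= r)%R ->
  (forall m, (Cmod (a m) <= K * r ^ Z.abs_nat m)%R) ->
  exists K', forall n : nat, (Cmod (a (Z.of_nat n - 1)%Z) <= K' * (2 * r) ^ n /\
    Cmod (sharp omega mu h a (Z.of_nat n - 1)) <= K' * (2 * r) ^ n)%R.
Proof.
intros hr H.
assert (hK : (0 <= K)%R).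
{ specialize (H 0%Z). simpl in H. assert (q := Cmod_ge_0 (a 0%Z)). lra. }
assert (h1 := Cmod_ge_0 omega). assert (h2 := Cmod_ge_0 mu). assert (h3 := Cmod_ge_0 h).
set (c := (1 + Cmod h + Cmod mu)%R).
exists (K * r + 2 * Cmod omega * (c * (K * r)))%R. intros n.
assert (b : forall m, (Z.abs_nat m <= S n)%nat -> (Cmod (a m) <= K * r * r ^ n)%R).
{ intros m hm. eapply Rle_trans; [apply H|]. rewrite Rmult_assoc. apply Rmult_le_compat_l; auto.
  apply (Rle_pow r _ (S n)); auto. }
assert (p2 := INR_lt_pow2 n).
assert (hn := pos_INR n). assert (rp : (0 < r ^ n)%R) by (apply pow_lt; lra).
assert (Kr : (0 <= K * r)%R) by (apply Rmult_le_pos; lra).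
assert (w : (0 <= K * r * r ^ n)%R) by (apply Rmult_le_pos; lra).
rewrite Rpow_mult_distr.
assert (e1 : (K * r * r ^ n <= K * r * (2 ^ n * r ^ n))%R).
{ apply Rmult_le_compat_l; auto. nra. }
assert (c0 : (1 <= c)%R) by (unfold c; lra).
assert (e2 : ((INR n + c) * (K * r * r ^ n) <= c * (K * r) * (2 ^ n * r ^ n))%R).
{ replace (c * (K * r) * (2 ^ n * r ^ n))%R with (c * 2 ^ n * (K * r * r ^ n))%R by ring.
  apply Rmult_le_compat_r; auto. assert (1 <= 2 ^ n)%R by (apply pow_R1_Rle; lra). nra. }
assert (e3 : (0 <= (INR n + c) * (K * r * r ^ n))%R) by (apply Rmult_le_pos; lra).
assert (e4 : (2 * Cmod omega * ((INR n + c) * (K * r * r ^ n)) <= 2 * Cmod omega * (c * (K * r) * (2 ^ n * r ^ n)))%R).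
{ apply Rmult_le_compat_l; lra. }
assert (e5 : (0 <= 2 * Cmod omega * ((INR n + c) * (K * r * r ^ n)))%R) by (apply Rmult_le_pos; lra).
split.
- eapply Rle_trans; [apply b; lia|]. lra.
- unfold sharp. rewrite !Cmod_mult, Cmod_R, Rabs_pos_eq by lra.
  assert (t := Cmod_triangle_minus ((- [Z.of_nat n - 1] - h) * a (- (Z.of_nat n - 1))%Z) (mu * a (- (Z.of_nat n - 1) - 1)%Z)).
  rewrite !Cmod_mult in t.
  assert (b1 := b (- (Z.of_nat n - 1))%Z ltac:(lia)). assert (b2 := b (- (Z.of_nat n - 1) - 1)%Z ltac:(lia)).
  assert (t2 : (Cmod (- [Z.of_nat n - 1] - h) <= INR n + 1 + Cmod h)%R).
  { eapply Rle_trans; [apply Cmod_triangle_minus|]. rewrite Cmod_opp, Cmod_R, minus_IZR, <- INR_IZR_INZ.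
    apply Rplus_le_compat_r. apply Rabs_le. lra. }
  assert (m1 : (Cmod (- [Z.of_nat n - 1] - h) * Cmod (a (- (Z.of_nat n - 1))%Z) <= (INR n + 1 + Cmod h) * (K * r * r ^ n))%R).
  { apply Rmult_le_compat; auto; apply Cmod_ge_0. }
  assert (m2 : (Cmod mu * Cmod (a (- (Z.of_nat n - 1) - 1)%Z) <= Cmod mu * (K * r * r ^ n))%R).
  { apply Rmult_le_compat_l; auto. }
  apply Rle_trans with (2 * Cmod omega * ((INR n + c) * (K * r * r ^ n)))%R; [|lra].
  apply Rmult_le_compat_l; [lra|]. unfold c. lra.
Qed.

Lemma recurrence_plus (lambda mu h : C) (a b : Z -> C) (k : Z) :
  recurrence_at lambda mu h a k -> recurrence_at lambda mu h b k ->
  recurrence_at lambda mu h (fun m => a m + b m) k.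
Proof.
unfold recurrence_at. intros H1 H2.
transitivity (RtoC 0 + RtoC 0); [|ring].
etransitivity; [|exact (f_equal2 Cplus H1 H2)]. ring.
Qed.

(** The condition of the theorem with l = 2 h; s = 1 or -1 carries the choice of sign. *)
Definition determinant_condition (omega h s x0 x1 : C) : Prop :=
  x1 + s * omega * (RtoC 2 * h) * (x1 - x0) = RtoC 0.

(** The left side is the relation at index 0 for the decaying solution, with a_(-1) = x0 and a_0 = -
    (mu/h) x1; the factor - (mu/h) splits off. *)
Lemma condition_decaying (omega mu h s x0 x1 : C) : mu <> RtoC 0 -> h <> RtoC 0 ->
  mu / (- h) * x1 * (RtoC 1 + s * omega * (RtoC 2 * h)) + RtoC 2 * s * omega * mu * x0 = RtoC 0 <->
  determinant_condition omega h s x0 x1.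
Proof.
unfold determinant_condition. intros hmu hh.
assert (e : mu / (- h) * x1 * (RtoC 1 + s * omega * (RtoC 2 * h)) + RtoC 2 * s * omega * mu * x0
  = - (mu / h) * (x1 + s * omega * (RtoC 2 * h) * (x1 - x0))) by (field; exact hh).
rewrite e. split; intros H.
- destruct (Ceq_dec (x1 + s * omega * (RtoC 2 * h) * (x1 - x0)) (RtoC 0)) as [q|q]; [exact q|exfalso].
  assert (hm : - (mu / h) <> RtoC 0).
  { intros z. apply hmu. replace mu with (- (- (mu / h)) * h) by (field; exact hh). rewrite z. ring. }
  exact (Cmult_neq_0 _ _ hm q H).
- rewrite H. ring.
Qed.

Lemma nonresonant_neq_0 (h : C) : nonresonant h -> h <> RtoC 0.
Proof.
intros hh e. destruct (hh 0%Z) as [h1 _]. apply h1. rewrite e. simpl. ring.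
Qed.

Section Condition.
Context (lambda mu omega h : C) (x : nat -> C) (Kx : R).
Context (hlm : lambda + mu ^ 2 = RtoC 1 / (RtoC 4 * omega ^ 2)) (ho : omega <> RtoC 0).
Context (hmu : mu <> RtoC 0) (hh : nonresonant h).
Context (hx : forall k : nat, x k =
  (RtoC 1 + lambda / (RtoC (INR k) ^ 2 - h ^ 2)) * x (S k) + mu ^ 2 / (RtoC (INR k) ^ 2 - h ^ 2) * x (S (S k))).
Context (bx : forall k, (Cmod (x k) <= Kx)%R).

Let A := decaying mu h x.

(** The vanishing Casoratian makes the pair (b_(-1), b_0) proportional to that of the decaying
    solution, so the linear relation between b_0 and b_(-1) carries over. *)
Lemma eigensequence_condition (s : C) (b : Z -> C) (Kb rb : R) : (1 <= rb)%R ->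
  (forall k, recurrence_at lambda mu h b k) ->
  (forall n : nat, (Cmod (b (Z.of_nat n - 1)%Z) <= Kb * rb ^ n)%R) ->
  b 0%Z = s * sharp omega mu h b 0 -> (exists m, b m <> RtoC 0) ->
  determinant_condition omega h s (x 0%nat) (x 1%nat).
Proof.
intros hr H hb e [m hm].
assert (cas := casoratian_zero lambda mu h hmu hh x Kx hx bx b Kb rb hr (fun k _ => H k) hb).
destruct (decaying_values mu h x) as [e1 e2]. rewrite e1, e2 in cas.
apply sharp_eigen_condition in e.
apply (condition_decaying omega mu h s _ _ hmu (nonresonant_neq_0 h hh)).
set (y := mu / - h * x 1%nat) in *. set (x0 := x 0%nat) in *.
(* If b_0 = 0 then b_(-1) is nonzero; the Casoratian gives y = 0 and the relation gives 2 s omega mu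
   = 0, so both terms of the goal vanish. Otherwise x0 is expressed through y and the values of
   [b]. *)
destruct (Ceq_dec (b 0%Z) (RtoC 0)) as [z|z].
- destruct (Ceq_dec (b (-1)%Z) (RtoC 0)) as [w|w].
  { exfalso. apply hm. apply (recurrence_zero lambda mu h b hmu hh H w z). }
  rewrite z in cas, e.
  assert (y0 : y = RtoC 0).
  { replace y with (/ b (-1)%Z * (b (-1)%Z * y)) by (field; exact w). rewrite cas. ring. }
  assert (q : RtoC 2 * s * omega * mu = RtoC 0).
  { replace (RtoC 2 * s * omega * mu) with (/ b (-1)%Z * (RtoC 0 * (RtoC 1 + s * omega * (RtoC 2 * h)) + RtoC 2 * s * omega * mu * b (-1)%Z)) by (field; exact w).
    rewrite e. ring. }
  rewrite y0, q. ring.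
- replace x0 with (/ b 0%Z * (b (-1)%Z * y)) by (rewrite cas; field; exact z).
  transitivity (/ b 0%Z * y * (b 0%Z * (RtoC 1 + s * omega * (RtoC 2 * h)) + RtoC 2 * s * omega * mu * b (-1)%Z)).
  field; exact z. rewrite e. ring.
Qed.

(** The sum of [a] and its image is invariant and gives the sign +. If this sum vanishes
    identically, [a] itself is anti-invariant and gives the sign -. *)
Lemma bounded_solution_condition (a : Z -> C) (K r : R) : (1 <= r)%R ->
  (forall k, recurrence_at lambda mu h a k) ->
  (forall m, (Cmod (a m) <= K * r ^ Z.abs_nat m)%R) -> (exists m, a m <> RtoC 0) ->
  determinant_condition omega h (RtoC 1) (x 0%nat) (x 1%nat) \/
  determinant_condition omega h (RtoC (-1)) (x 0%nat) (x 1%nat).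
Proof.
intros hr H ha hm.
destruct (sharp_growth omega mu h a K r hr ha) as [K' HK'].
set (b := fun m => a m + sharp omega mu h a m).
assert (Hs : forall k, recurrence_at lambda mu h (sharp omega mu h a) k).
{ intros k. apply sharp_recurrence; apply H. }
destruct (Classical_Prop.classic (exists m, b m <> RtoC 0)) as [hb|hb].
- left. apply (eigensequence_condition (RtoC 1) b (K' + K') (2 * r)); auto.
  + lra.
  + intros k. apply recurrence_plus; auto.
  + intros n. unfold b. eapply Rle_trans; [apply Cmod_triangle|]. destruct (HK' n). lra.
  + assert (e : sharp omega mu h b 0 = sharp omega mu h a 0 + sharp omega mu h (sharp omega mu h a) 0).
    { unfold sharp at 1 2 3. unfold b. ring. }
    rewrite e, (sharp_involutive lambda mu omega h a 0) by auto. unfold b. ring.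
- right. apply (eigensequence_condition (RtoC (-1)) a K' (2 * r)); auto.
  + lra.
  + intros n. apply HK'.
  + assert (z : b 0%Z = RtoC 0).
    { destruct (Ceq_dec (b 0%Z) (RtoC 0)) as [q|q]; [exact q|exfalso; apply hb; exists 0%Z; exact q]. }
    unfold b in z.
    replace (a 0%Z) with (a 0%Z + sharp omega mu h a 0 - sharp omega mu h a 0) by ring. rewrite z. ring.
Qed.

(** Decay faster than every geometric sequence in both directions, so that the Laurent series
    converges on the whole punctured plane. *)
Definition superdecay (a : Z -> C) : Prop :=
  forall r : R, (0 < r)%R -> exists K, forall m, (Cmod (a m) * r ^ Z.abs_nat m <= K)%R.

Lemma condition_eigensequence (s : C) : s * s = RtoC 1 -> (exists k, x k <> RtoC 0) ->
  determinant_condition omega h s (x 0%nat) (x 1%nat) ->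
  exists a : Z -> C, (forall k, recurrence_at lambda mu h a k) /\ superdecay a /\ exists m, a m <> RtoC 0.
Proof.
intros hs hxn hc.
apply (condition_decaying omega mu h s _ _ hmu (nonresonant_neq_0 h hh)) in hc.
assert (ds : forall k, (0 <= k)%Z -> recurrence_at lambda mu h A k) by (intros; apply decaying_recurrence; auto).
destruct (decaying_values mu h x) as [e1 e2]. fold A in e1, e2. rewrite <- e1, <- e2 in hc.
assert (s0 := proj2 (sharp_eigen_condition omega mu h s A) hc).
set (B := fun m => s * sharp omega mu h A m).
assert (sB : forall m, A m = B m -> sharp omega mu h A m = s * A m).
{ intros m q. rewrite q. unfold B. rewrite Cmult_assoc, hs. ring. }
(* A and s #A agree at 0 by the condition, hence at -1 because # is an involution. *)
assert (s1 : A (-1)%Z = B (-1)%Z).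
{ assert (inv := sharp_involutive lambda mu omega h A 0 hlm ho (ds 0%Z ltac:(lia))).
  unfold sharp in inv at 1. change (- 0)%Z with 0%Z in inv. change (0 - 1)%Z with (-1)%Z in inv.
  rewrite (sB 0%Z s0) in inv.
  assert (hA0 : A 0%Z = RtoC 2 * omega * ((- RtoC 0 - h) * (s * A 0%Z) - mu * (s * A (-1)%Z))).
  { transitivity (s * sharp omega mu h A 0). exact s0. unfold sharp. simpl Z.opp. simpl Z.sub. ring. }
  assert (q : RtoC 2 * omega * mu * (sharp omega mu h A (-1) - s * A (-1)%Z) = RtoC 0).
  { transitivity (RtoC 2 * omega * ((- RtoC 0 - h) * (s * A 0%Z) - mu * (s * A (-1)%Z))
      - RtoC 2 * omega * ((- RtoC 0 - h) * (s * A 0%Z) - mu * sharp omega mu h A (-1))). ring.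
    rewrite <- hA0. rewrite inv. ring. }
  assert (q2 : sharp omega mu h A (-1) - s * A (-1)%Z = RtoC 0).
  { destruct (Ceq_dec (sharp omega mu h A (-1) - s * A (-1)%Z) (RtoC 0)) as [z|z]; [exact z|exfalso].
    refine (Cmult_neq_0 _ _ _ z q). apply Cmult_neq_0; auto. apply Cmult_neq_0; auto.
    intros w. apply RtoC_inj in w. lra. }
  apply Ceq_minus in q2. unfold B. rewrite q2, Cmult_assoc, hs. ring. }
(* The two halves agree at -1 and 0. This suffices: the recurrence at k >= 0 uses indices >= -1
   only, and at k <= -1 indices <= 0 only. *)
set (a := fun m => if Z_le_dec 0 m then A m else B m).
assert (aA : forall m, (-1 <= m)%Z -> a m = A m).
{ intros m hm. unfold a. destruct (Z_le_dec 0 m); [reflexivity|]. replace m with (-1)%Z by lia. symmetry; exact s1. }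
assert (aB : forall m, (m <= 0)%Z -> a m = B m).
{ intros m hm. unfold a. destruct (Z_le_dec 0 m); [|reflexivity]. replace m with 0%Z by lia. exact s0. }
exists a. split; [|split].
- intros k. destruct (Z_le_dec 0 k) as [hk|hk].
  + unfold recurrence_at. rewrite !aA by lia. apply ds; exact hk.
  + unfold recurrence_at. rewrite !aB by lia.
    assert (q := sharp_recurrence lambda mu omega h A k (ds (- k)%Z ltac:(lia)) (ds (- k - 1)%Z ltac:(lia))).
    unfold recurrence_at in q. unfold B.
    transitivity (s * (([k] ^ 2 - h ^ 2 + lambda) * sharp omega mu h A k + mu * ([k] + RtoC 1 - h) * sharp omega mu h A (k + 1)
       - mu * ([k] + h) * sharp omega mu h A (k - 1))). ring. rewrite q. ring.
- intros r hr.
  (* The doubled rate pays for the linear factor in [sharp], since n + 1 <= 2^n. *)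
  destruct (decaying_decay mu h hh x Kx bx (2 * r) ltac:(lra)) as [D HD]. fold A in HD.
  destruct (decaying_decay mu h hh x Kx bx r ltac:(lra)) as [D1 HD1]. fold A in HD1.
  assert (hD : (0 <= D)%R).
  { specialize (HD 0%nat). simpl in HD. assert (q := Cmod_ge_0 (A (-1)%Z)). lra. }
  assert (hD1 : (0 <= D1)%R).
  { specialize (HD1 0%nat). simpl in HD1. assert (q := Cmod_ge_0 (A (-1)%Z)). lra. }
  assert (h1 := Cmod_ge_0 omega). assert (h2 := Cmod_ge_0 mu). assert (h3 := Cmod_ge_0 h). assert (h4 := Cmod_ge_0 s).
  assert (ri : (0 < / r)%R) by (apply Rinv_0_lt_compat; lra).
  assert (P : forall n : nat, (Cmod (A (Z.of_nat n)) * r ^ n <= / r * D1)%R).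
  { intros n. specialize (HD1 (S n)). replace (Z.of_nat (S n) - 1)%Z with (Z.of_nat n) in HD1 by lia. simpl pow in HD1.
    apply Rmult_le_reg_l with r; auto. replace (r * (/ r * D1))%R with D1 by (field; lra). lra. }
  assert (P2 : forall n : nat, (Cmod (A (Z.of_nat n)) * (INR n + 1) * r ^ n <= / (2 * r) * D)%R).
  { intros n. specialize (HD (S n)). replace (Z.of_nat (S n) - 1)%Z with (Z.of_nat n) in HD by lia. rewrite Rpow_mult_distr in HD. simpl pow in HD.
    assert (p2 := INR_lt_pow2 n).
    assert (c0 := Cmod_ge_0 (A (Z.of_nat n))). assert (rp : (0 < r ^ n)%R) by (apply pow_lt; lra).
    apply Rmult_le_reg_l with (2 * r)%R; [lra|]. replace (2 * r * (/ (2 * r) * D))%R with D by (field; lra).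
    eapply Rle_trans; [|exact HD].
    replace (2 * r * (Cmod (A (Z.of_nat n)) * (INR n + 1) * r ^ n))%R with (2 * r * Cmod (A (Z.of_nat n)) * r ^ n * (INR n + 1))%R by ring.
    replace (Cmod (A (Z.of_nat n)) * (2 * 2 ^ n * (r * r ^ n)))%R with (2 * r * Cmod (A (Z.of_nat n)) * r ^ n * 2 ^ n)%R by ring.
    apply Rmult_le_compat_l; auto. repeat apply Rmult_le_pos; lra. }
  exists (/ r * D1 + Cmod s * (2 * Cmod omega * ((1 + Cmod h) * (/ (2 * r) * D) + Cmod mu * D1)))%R.
  assert (D2 : (0 <= / (2 * r) * D)%R) by (apply Rmult_le_pos; auto; left; apply Rinv_0_lt_compat; lra).
  assert (D3 : (0 <= / r * D1)%R) by (apply Rmult_le_pos; lra).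
  assert (D4 : (0 <= (1 + Cmod h) * (/ (2 * r) * D))%R) by (apply Rmult_le_pos; lra).
  assert (D5 : (0 <= Cmod mu * D1)%R) by (apply Rmult_le_pos; lra).
  assert (D6 : (0 <= Cmod s * (2 * Cmod omega * ((1 + Cmod h) * (/ (2 * r) * D) + Cmod mu * D1)))%R).
  { apply Rmult_le_pos; auto. apply Rmult_le_pos; lra. }
  intros m. unfold a. destruct (Z_le_dec 0 m) as [hm|hm].
  + replace m with (Z.of_nat (Z.abs_nat m)) at 1 by lia. eapply Rle_trans; [apply P|]. lra.
  + set (n := Z.abs_nat m). assert (em : (- m)%Z = Z.of_nat n) by lia.
    unfold B, sharp. rewrite em. rewrite !Cmod_mult, Cmod_R, Rabs_pos_eq by lra.
    specialize (P2 n). specialize (HD1 n).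
    set (u := A (Z.of_nat n)) in *. set (v := A (Z.of_nat n - 1)%Z) in *.
    assert (rp : (0 < r ^ n)%R) by (apply pow_lt; lra).
    assert (t := Cmod_triangle_minus ((- [m] - h) * u) (mu * v)). rewrite !Cmod_mult in t.
    assert (t2 : (Cmod (- [m] - h) <= (1 + Cmod h) * (INR n + 1))%R).
    { assert (hn := pos_INR n). rewrite <- RtoC_opp, <- opp_IZR, em, <- INR_IZR_INZ.
      eapply Rle_trans; [apply Cmod_triangle_minus|]. rewrite Cmod_R, Rabs_pos_eq by auto. nra. }
    assert (cu := Cmod_ge_0 u).
    assert (m1 : (Cmod (- [m] - h) * Cmod u * r ^ n <= (1 + Cmod h) * (/ (2 * r) * D))%R).
    { apply Rle_trans with ((1 + Cmod h) * (INR n + 1) * Cmod u * r ^ n)%R.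
      apply Rmult_le_compat_r; [lra|]. apply Rmult_le_compat_r; auto.
      replace ((1 + Cmod h) * (INR n + 1) * Cmod u * r ^ n)%R with ((1 + Cmod h) * (Cmod u * (INR n + 1) * r ^ n))%R by ring.
      apply Rmult_le_compat_l; lra. }
    assert (m2 : (Cmod mu * Cmod v * r ^ n <= Cmod mu * D1)%R).
    { rewrite Rmult_assoc. apply Rmult_le_compat_l; auto. }
    assert (m3 : (Cmod ((- [m] - h) * u - mu * v) * r ^ n <= (1 + Cmod h) * (/ (2 * r) * D) + Cmod mu * D1)%R).
    { apply Rle_trans with ((Cmod (- [m] - h) * Cmod u + Cmod mu * Cmod v) * r ^ n)%R; [apply Rmult_le_compat_r; lra|]. lra. }
    apply Rle_trans with (Cmod s * (2 * Cmod omega * ((1 + Cmod h) * (/ (2 * r) * D) + Cmod mu * D1)))%R; [|lra].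
    replace (Cmod s * (2 * Cmod omega * Cmod ((- [m] - h) * u - mu * v)) * r ^ n)%R
      with (Cmod s * (2 * Cmod omega * (Cmod ((- [m] - h) * u - mu * v) * r ^ n)))%R by ring.
    apply Rmult_le_compat_l; auto. apply Rmult_le_compat_l; [lra|]. exact m3.
- destruct hxn as [k hk]. exists (Z.of_nat k - 1)%Z. rewrite aA by lia.
  unfold A, decaying. replace (Z.to_nat (Z.of_nat k - 1 + 1)) with k by lia.
  apply Cmult_neq_0; auto. apply gain_neq_0; auto.
Qed.
End Condition.

(** * Continuation of solutions *)

(** A locally constant property: at the supremum of the initial segments on which it holds, it
    extends further unless the supremum is 1. *)
Lemma unit_interval_connected (P : R -> Prop) : P 0%R ->
  (forall t, (0 <= t <= 1)%R -> exists d, (0 < d)%R /\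
     forall s, (0 <= s <= 1)%R -> (Rabs (s - t) < d)%R -> (P s <-> P t)) ->
  forall t, (0 <= t <= 1)%R -> P t.
Proof.
intros P0 H.
set (S := fun t => (0 <= t <= 1)%R /\ forall s, (0 <= s <= t)%R -> P s).
destruct (completeness S) as [m [m1 m2]].
- exists 1%R. intros t [ht _]. lra.
- exists 0%R. split. lra. intros s hs. replace s with 0%R by lra. exact P0.
- assert (m0 : (0 <= m)%R).
  { apply m1. split. lra. intros s hs. replace s with 0%R by lra. exact P0. }
  assert (mle : (m <= 1)%R) by (apply m2; intros t [ht _]; lra).
  destruct (H m ltac:(lra)) as [d [hd Hd]].
  assert (exists t, S t /\ (m - d < t)%R) as [t [[ht1 ht2] ht3]].
  { destruct (Classical_Prop.classic (exists t, S t /\ (m - d < t)%R)) as [q|q]; [exact q|exfalso].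
    assert (m <= m - d)%R; [|lra]. apply m2. intros t ht. apply Rnot_lt_le. intros k. apply q. exists t. auto. }
  assert (tm : (t <= m)%R) by (apply m1; split; auto).
  assert (Pm : P m).
  { apply (Hd t); [lra|apply Rabs_def1; lra|]. apply ht2. lra. }
  assert (S' : S (Rmin 1 (m + d / 2))).
  { assert (a := Rmin_l 1 (m + d / 2)). assert (b := Rmin_r 1 (m + d / 2)).
    assert (c : (0 <= Rmin 1 (m + d / 2))%R) by (apply Rmin_glb; lra).
    split. lra. intros s hs. destruct (Rle_dec s t). apply ht2; lra.
    apply (Hd s); [lra|apply Rabs_def1; lra|exact Pm]. }
  assert (k := m1 _ S').
  assert (e : m = 1%R).
  { unfold Rmin in k. destruct (Rle_dec 1 (m + d / 2)); lra. }
  assert (k2 : Rmin 1 (m + d / 2) = 1%R) by (apply Rmin_left; lra).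
  rewrite k2 in S'. intros u hu. apply S'. lra.
Qed.

Definition ode (lambda mu n : C) (f : C -> C) (z : C) : C :=
  z ^ 2 * C_derive (C_derive f) z + (n * z + mu * (RtoC 1 - z ^ 2)) * C_derive f z
  + (lambda - mu * n * z) * f z.

Lemma holomorphic_ball_near (z0 : C) (f : C -> C) :
  holomorphic_near z0 f <-> exists d, (0 < d)%R /\ holomorphic_on_ball f z0 d.
Proof. apply locally_Cmod. Qed.

Lemma holomorphic_on_subball (f : C -> C) (c p : C) (R0 r : R) :
  (Cmod (p - c) + r <= R0)%R -> holomorphic_on_ball f c R0 -> holomorphic_on_ball f p r.
Proof.
intros h H z hz. apply H.
replace (z - c) with ((z - p) + (p - c)) by ring. eapply Rle_lt_trans; [apply Cmod_triangle|]. lra.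
Qed.

Lemma C_derive_ball_ext (f g : C -> C) (c : C) (r : R) : holomorphic_on_ball f c r ->
  (forall z, (Cmod (z - c) < r)%R -> f z = g z) ->
  holomorphic_on_ball g c r /\ forall z, (Cmod (z - c) < r)%R -> C_derive f z = C_derive g z.
Proof.
intros hf e.
assert (k : forall z, (Cmod (z - c) < r)%R -> exists l, Cderiv f z l /\ Cderiv g z l).
{ intros z hz. destruct (hf z hz) as [l hl]. exists l. split. exact hl.
  apply (Cderiv_ext_loc f _ z _ (r - Cmod (z - c))%R); [lra| |exact hl].
  intros y hy. apply e. replace (y - c) with ((y - z) + (z - c)) by ring.
  eapply Rle_lt_trans; [apply Cmod_triangle|]. lra. }
split; intros z hz; destruct (k z hz) as [l [h1 h2]].
- exists l. exact h2.
- rewrite (Cderiv_unique _ _ _ h1), (Cderiv_unique _ _ _ h2). reflexivity.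
Qed.

(** The second derivative comes from [holomorphic_derive], so only f itself has to be known
    holomorphic. *)
Lemma solution_near_iff (lambda mu n z0 : C) (f : C -> C) :
  solution_near lambda mu n z0 f <->
  exists d, (0 < d)%R /\ holomorphic_on_ball f z0 d /\
    forall z, (Cmod (z - z0) < d)%R -> ode lambda mu n f z = RtoC 0.
Proof.
split; intros H.
- apply locally_Cmod in H. destruct H as [d [hd H]]. exists d. split. exact hd. split.
  intros z hz. apply (H z hz). intros z hz. apply (H z hz).
- destruct H as [d [hd [h1 h2]]]. apply locally_Cmod. exists d. split. exact hd.
  intros z hz. split. exact (h1 z hz). split. exact (holomorphic_derive f z0 d hd h1 z hz). exact (h2 z hz).
Qed.

Lemma holomorphic_ode (lambda mu n : C) (f : C -> C) (c : C) (r : R) : (0 < r)%R ->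
  holomorphic_on_ball f c r -> holomorphic_on_ball (ode lambda mu n f) c r.
Proof.
intros hr hf z hz.
assert (h1 := holomorphic_derive f c r hr hf). assert (h2 := holomorphic_derive _ c r hr h1).
destruct (hf z hz) as [l hl]. destruct (h1 z hz) as [l1 hl1]. destruct (h2 z hz) as [l2 hl2].
assert (sq : Cderiv (fun z => z ^ 2) z (RtoC 2 * z)).
{ apply (Cderiv_ext_loc (fun z => z * z) _ z _ 1). lra. intros; ring.
  eapply Cderiv_eq. apply Cderiv_mult; apply Cderiv_id. cbv beta.
  replace (RtoC 2) with (RtoC 1 + RtoC 1) by (rewrite <- RtoC_plus; f_equal; ring). ring. }
eexists. unfold ode. apply Cderiv_plus. apply Cderiv_plus.
- apply Cderiv_mult. exact sq. exact hl2.
- apply Cderiv_mult. apply Cderiv_plus. apply Cderiv_mult. apply Cderiv_const. apply Cderiv_id.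
  apply Cderiv_mult. apply Cderiv_const. apply Cderiv_minus. apply Cderiv_const. exact sq. exact hl1.
- apply Cderiv_mult. apply Cderiv_minus. apply Cderiv_const. apply Cderiv_mult. apply Cderiv_const. apply Cderiv_id. exact hl.
Qed.

Lemma solution_near_germ (lambda mu n z0 : C) (f g : C -> C) :
  germ_eq z0 f g -> solution_near lambda mu n z0 f -> solution_near lambda mu n z0 g.
Proof.
intros e H. apply locally_Cmod in e. destruct e as [d1 [hd1 e]].
apply solution_near_iff in H. destruct H as [d2 [hd2 [H1 H2]]].
assert (m1 := Rmin_l d1 d2). assert (m2 := Rmin_r d1 d2). assert (hm := Rmin_pos d1 d2 hd1 hd2).
set (d := Rmin d1 d2) in *.
assert (hf : holomorphic_on_ball f z0 d) by (intros z hz; apply H1; lra).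
destruct (C_derive_ball_ext f g z0 d hf) as [hg ed]. { intros z hz. apply e. lra. }
destruct (C_derive_ball_ext (C_derive f) (C_derive g) z0 d (holomorphic_derive f z0 d hm hf) ed) as [_ ed2].
apply solution_near_iff. exists d. split. exact hm. split. exact hg.
intros z hz. rewrite <- (H2 z ltac:(lra)). unfold ode. rewrite <- ed2, <- ed, e by lra. reflexivity.
Qed.

(** The identity theorem for the left side of the equation. With p and q within r/4 of the centre,
    the disc of radius r/2 about p lies in the domain and contains q. *)
Lemma solution_near_transfer (lambda mu n c p q : C) (f : C -> C) (r : R) :
  holomorphic_on_ball f c r -> (Cmod (p - c) < r / 4)%R -> (Cmod (q - c) < r / 4)%R ->
  solution_near lambda mu n p f -> solution_near lambda mu n q f.
Proof.
intros hf hp hq H. assert (hr : (0 < r)%R) by (assert (k := Cmod_ge_0 (p - c)); lra).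
apply solution_near_iff in H. destruct H as [d [hd [_ H]]].
assert (hfp : holomorphic_on_ball f p (r / 2)) by (apply (holomorphic_on_subball f c p r); [lra|exact hf]).
assert (z0 := identity_near (ode lambda mu n f) p (r / 2) d ltac:(lra) hd (holomorphic_ode _ _ _ f p (r / 2) ltac:(lra) hfp) H).
assert (hqp : (Cmod (q - p) < r / 2)%R).
{ replace (q - p) with ((q - c) - (p - c)) by ring. eapply Rle_lt_trans; [apply Cmod_triangle_minus|]. lra. }
apply solution_near_iff. exists (r / 2 - Cmod (q - p))%R. split. lra. split.
- apply (holomorphic_on_subball f p q (r / 2)); [lra|exact hfp].
- intros z hz. apply z0. replace (z - p) with ((z - q) + (q - p)) by ring.
  eapply Rle_lt_trans; [apply Cmod_triangle|]. lra.
Qed.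

Lemma circuit_exp (z0 w0 : C) (t : R) : Cexp w0 = z0 -> circuit z0 t = Cexp (w0 + RtoC t * tpi).
Proof.
intros e. unfold circuit. rewrite Cexp_plus, e. f_equal. f_equal. rewrite !RtoC_mult. ring.
Qed.

Lemma circuit_0 (z0 : C) : circuit z0 0 = z0.
Proof. unfold circuit. rewrite Rmult_0_r, Cmult_0_l, Cexp_0. ring. Qed.

Lemma circuit_1 (z0 : C) : circuit z0 1 = z0.
Proof. unfold circuit. rewrite Rmult_1_r, Cexp_2PI. ring. Qed.

Lemma circuit_cont (z0 : C) (t eps : R) : z0 <> RtoC 0 -> (0 < eps)%R -> exists d, (0 < d)%R /\
  forall s, (Rabs (s - t) < d)%R -> (Cmod (circuit z0 s - circuit z0 t) < eps)%R.
Proof.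
intros hz he. destruct (Cexp_surj z0 hz) as [w0 e].
destruct (Ccont_eps (fun s => Cexp (w0 + RtoC s * tpi)) t (Ccont_exp w0 tpi t) eps he) as [d [hd H]].
exists d. split. exact hd. intros s hs. rewrite !(circuit_exp z0 w0) by exact e. exact (H s hs).
Qed.

(** Solving the equation is a locally constant property of t: neighbouring germs come from one
    holomorphic function, along which it transfers. *)
Lemma continuation_solution (lambda mu n z0 : C) (F : R -> C -> C) : z0 <> RtoC 0 ->
  (forall t, (0 <= t <= 1)%R -> holomorphic_near (circuit z0 t) (F t)) ->
  (forall t, (0 <= t <= 1)%R -> locally t (fun s => (0 <= s <= 1)%R -> germ_eq (circuit z0 s) (F s) (F t))) ->
  solution_near lambda mu n (circuit z0 0) (F 0%R) ->
  forall t, (0 <= t <= 1)%R -> solution_near lambda mu n (circuit z0 t) (F t).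
Proof.
intros hz H1 H2 H0.
apply (unit_interval_connected (fun t => solution_near lambda mu n (circuit z0 t) (F t)) H0).
intros t ht. destruct (proj1 (holomorphic_ball_near _ _) (H1 t ht)) as [r [hr hf]].
destruct (H2 t ht) as [d1 Hd1]. destruct (circuit_cont z0 t (r / 4) hz ltac:(lra)) as [d2 [hd2 Hd2]].
assert (hd1 := cond_pos d1). assert (m1 := Rmin_l d1 d2). assert (m2 := Rmin_r d1 d2).
exists (Rmin d1 d2). split. apply Rmin_pos; auto.
intros s hs hst.
assert (g : germ_eq (circuit z0 s) (F s) (F t)).
{ apply Hd1; auto. change (Rabs (s - t) < d1)%R. lra. }
assert (g' : germ_eq (circuit z0 s) (F t) (F s)).
{ apply locally_Cmod in g. destruct g as [e [he g]]. apply locally_Cmod. exists e. split; auto. intros y hy. symmetry; auto. }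
assert (k : (Cmod (circuit z0 s - circuit z0 t) < r / 4)%R) by (apply Hd2; lra).
assert (k0 : (Cmod (circuit z0 t - circuit z0 t) < r / 4)%R).
{ replace (circuit z0 t - circuit z0 t) with (RtoC 0) by ring. rewrite Cmod_0. lra. }
split; intros q.
- apply (solution_near_transfer lambda mu n (circuit z0 t) (circuit z0 s) _ (F t) r); auto.
  apply (solution_near_germ _ _ _ _ (F s)); auto.
- apply (solution_near_germ _ _ _ _ (F t)); auto.
  apply (solution_near_transfer lambda mu n (circuit z0 t) (circuit z0 t) _ (F t) r); auto.
Qed.

(** * From an eigenfunction to a solution of the recurrence *)

(** The germs of a continuation are constrained only for t in [0, 1]. Freezing the germ beyond the
    ends gives two-sided derivatives at 0 and 1. *)
Definition clamp (t : R) : R := Rmax 0 (Rmin 1 t).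

Lemma clamp_id (t : R) : (0 <= t <= 1)%R -> clamp t = t.
Proof. intros h. unfold clamp. rewrite Rmin_right, Rmax_right; lra. Qed.

(** The weight z^(h - k) at z = e^w, against which the coefficient a_k is extracted. *)
Definition kexp (h : C) (k : Z) (w : C) : C := Cexp (- (([k] - h) * w)).

Lemma kexp_shift (h : C) (k : Z) (w : C) :
  kexp h (k + 1) w = / Cexp w * kexp h k w /\ kexp h (k - 1) w = Cexp w * kexp h k w.
Proof.
unfold kexp. rewrite <- Cexp_opp, <- !Cexp_plus, plus_IZR, minus_IZR, RtoC_plus, RtoC_minus.
split; f_equal; ring.
Qed.

Lemma Cderiv_kexp (h : C) (k : Z) (w : C) : Cderiv (kexp h k) w (- ([k] - h) * kexp h k w).
Proof.
eapply Cderiv_eq. apply (Cderiv_comp Cexp (fun w => - (([k] - h) * w))). apply Cderiv_Cexp.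
apply Cderiv_opp. apply Cderiv_mult. apply Cderiv_const. apply Cderiv_id.
unfold kexp. ring.
Qed.

(** The multiplier is the inverse of the eigenvalue e^(-2 pi i h) = e^(-pi i l), so an eigenfunction
    times this weight is periodic along the circuit. *)
Lemma kexp_period (h w : C) (k : Z) : kexp h k (w + tpi) = Cexp (h * tpi) * kexp h k w.
Proof.
unfold kexp. replace (- (([k] - h) * (w + tpi))) with (h * tpi + - (([k] - h) * w) - [k] * tpi) by ring.
rewrite Cexp_minus, Cexp_Z, Cexp_plus. field.
Qed.

Lemma eigenfunction_recurrence (lambda mu h n z0 : C) (E : C -> C) :
  n = RtoC 2 * h + RtoC 1 -> z0 <> RtoC 0 ->
  solution_near lambda mu n z0 E -> ~ germ_eq z0 E (fun _ => RtoC 0) ->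
  monodromy z0 E (fun z => Cexp (- (h * tpi)) * E z) ->
  exists (a : Z -> C) (K r : R), (1 <= r)%R /\ (forall k, recurrence_at lambda mu h a k) /\
    (forall m, (Cmod (a m) <= K * r ^ Z.abs_nat m)%R) /\ exists m, a m <> RtoC 0.
Proof.
intros en hz sE nE [F [H1 [H2 [H3 H4]]]].
destruct (Cexp_surj z0 hz) as [w0 ew].
set (W := fun t : R => w0 + RtoC t * tpi).
assert (gW : forall t, circuit z0 t = Cexp (W t)) by (intros t; apply circuit_exp, ew).
assert (sol := continuation_solution lambda mu n z0 F hz H1 H2
  ltac:(rewrite circuit_0 in *; apply (solution_near_germ _ _ _ _ E); auto)).
(* The continued eigenfunction along the circuit and, as [u1], its derivative z E' with respect to w
   = log z. *)
set (u := fun t : R => F (clamp t) (Cexp (W t))).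
set (u1 := fun t : R => Cexp (W t) * C_derive (F (clamp t)) (Cexp (W t))).
(* Near t the varying germ may be replaced by the fixed one [F t], which makes differentiation in
   the parameter possible. *)
assert (loc : forall t, (0 <= t <= 1)%R -> exists d, (0 < d)%R /\ forall s, (Rabs (s - t) < d)%R ->
   u s = F t (Cexp (W s)) /\ u1 s = Cexp (W s) * C_derive (F t) (Cexp (W s))).
{ intros t ht. destruct (H2 t ht) as [d Hd].
  destruct (proj1 (holomorphic_ball_near _ _) (H1 t ht)) as [r [hr hf]].
  destruct (circuit_cont z0 t r hz hr) as [d2 [hd2 Hd2]].
  assert (exists d3, (0 < d3)%R /\ forall s, (Rabs (s - t) < d3)%R -> (0 <= s <= 1)%R \/ clamp s = t) as [d3 [hd3 Hd3]].
  { destruct (Rle_lt_or_eq_dec 0 t ltac:(lra)) as [t0|t0]; destruct (Rle_lt_or_eq_dec t 1 ltac:(lra)) as [t1|t1].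
    - exists (Rmin t (1 - t)). split. apply Rmin_pos; lra. intros s hs. left.
      assert (a := Rmin_l t (1 - t)). assert (b := Rmin_r t (1 - t)). apply Rabs_def2 in hs. lra.
    - exists 1%R. split. lra. intros s hs. apply Rabs_def2 in hs. destruct (Rle_dec s 1). left; lra.
      right. unfold clamp. rewrite Rmin_left, Rmax_right; lra.
    - exists 1%R. split. lra. intros s hs. apply Rabs_def2 in hs. destruct (Rle_dec 0 s). left; lra.
      right. unfold clamp. rewrite Rmin_right, Rmax_left; lra.
    - lra. }
  exists (Rmin (Rmin d d2) d3). split. { repeat apply Rmin_pos; auto. apply cond_pos. }
  intros s hs. assert (m1 := Rmin_l (Rmin d d2) d3). assert (m2 := Rmin_r (Rmin d d2) d3).
  assert (m3 := Rmin_l d d2). assert (m4 := Rmin_r d d2).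
  destruct (Hd3 s ltac:(lra)) as [hs1|hs1]; unfold u, u1.
  - rewrite clamp_id by exact hs1.
    assert (g : germ_eq (circuit z0 s) (F s) (F t)).
    { apply Hd; auto. change (Rabs (s - t) < d)%R. lra. }
    apply locally_Cmod in g. destruct g as [e [he g]]. rewrite gW in g.
    assert (c0 : (Cmod (Cexp (W s) - Cexp (W s)) < e)%R).
    { replace (Cexp (W s) - Cexp (W s)) with (RtoC 0) by ring. rewrite Cmod_0. exact he. }
    split. apply g, c0. f_equal.
    specialize (Hd2 s ltac:(lra)). rewrite !gW in Hd2. rewrite gW in hf.
    destruct (hf _ Hd2) as [l hl]. rewrite (Cderiv_unique _ _ _ hl). apply Cderiv_unique.
    apply (Cderiv_ext_loc (F t) _ _ _ e); auto. intros y hy. symmetry. apply g, hy.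
  - rewrite hs1. split; reflexivity. }
(* The second derivative with respect to log z, expressed by the equation; n - 1 = 2 h is the
   coefficient of the first derivative. *)
set (u2 := fun t : R => - (RtoC 2 * h * u1 t + mu * (/ Cexp (W t) - Cexp (W t)) * u1 t + (lambda - mu * n * Cexp (W t)) * u t)).
assert (der : forall k t, (0 <= t <= 1)%R ->
   Rderiv (fun s => u s * kexp h k (W s)) t (tpi * ((u1 t - ([k] - h) * u t) * kexp h k (W t))) /\
   Rderiv (fun s => u1 s * kexp h k (W s)) t (tpi * ((u2 t - ([k] - h) * u1 t) * kexp h k (W t)))).
{ intros k t ht. destruct (loc t ht) as [d [hd Hd]].
  assert (hs := proj1 (solution_near_iff _ _ _ _ _) (sol t ht)). destruct hs as [r [hr [hf ho]]].
  rewrite gW in hf, ho.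
  assert (c0 : (Cmod (Cexp (W t) - Cexp (W t)) < r)%R).
  { replace (Cexp (W t) - Cexp (W t)) with (RtoC 0) by ring. rewrite Cmod_0. exact hr. }
  destruct (hf _ c0) as [l1 hl1]. destruct (holomorphic_derive _ _ _ hr hf _ c0) as [l2 hl2].
  specialize (ho _ c0). unfold ode in ho. rewrite (Cderiv_unique _ _ _ hl2), (Cderiv_unique _ _ _ hl1) in ho.
  destruct (Hd t) as [v0 v1]. { rewrite Rminus_diag, Rabs_R0. exact hd. }
  rewrite (Cderiv_unique _ _ _ hl1) in v1.
  split.
  - apply (Rderiv_ext_loc (fun s => F t (Cexp (W s)) * kexp h k (W s)) _ t d _ hd).
    { intros s hs. destruct (Hd s hs) as [-> _]. reflexivity. }
    apply (Rderiv_line (fun w => F t (Cexp w) * kexp h k w)). fold (W t).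
    eapply Cderiv_eq. apply Cderiv_mult. apply (Cderiv_comp (F t) Cexp). exact hl1. apply Cderiv_Cexp. apply Cderiv_kexp.
    cbv beta. rewrite v0, v1. ring.
  - apply (Rderiv_ext_loc (fun s => Cexp (W s) * C_derive (F t) (Cexp (W s)) * kexp h k (W s)) _ t d _ hd).
    { intros s hs. destruct (Hd s hs) as [_ ->]. reflexivity. }
    apply (Rderiv_line (fun w => Cexp w * C_derive (F t) (Cexp w) * kexp h k w)). fold (W t).
    eapply Cderiv_eq. apply Cderiv_mult. apply Cderiv_mult. apply Cderiv_Cexp.
    apply (Cderiv_comp (C_derive (F t)) Cexp). exact hl2. apply Cderiv_Cexp. apply Cderiv_kexp.
    cbv beta. unfold u2. rewrite v0, v1, (Cderiv_unique _ _ _ hl1).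
    set (z := Cexp (W t)) in *. assert (z1 : z <> RtoC 0) by apply Cexp_neq_0.
    assert (e2 : z * l1 + z * (z * l2) = - (RtoC 2 * h * (z * l1) + mu * (/ z - z) * (z * l1) + (lambda - mu * n * z) * F t z)).
    { apply Ceq_minus. rewrite <- ho, en. field. exact z1. }
    rewrite <- e2. ring. }
assert (bdry : u 1%R = Cexp (- (h * tpi)) * u 0%R /\ u1 1%R = Cexp (- (h * tpi)) * u1 0%R).
{ assert (g0 := proj1 (locally_Cmod _ _) H3). destruct g0 as [d0 [hd0 g0]]. rewrite circuit_0 in g0.
  assert (g1 := proj1 (locally_Cmod _ _) H4). destruct g1 as [d1 [hd1 g1]]. rewrite circuit_1 in g1.
  assert (e0 : Cexp (W 0%R) = z0) by (rewrite <- gW; apply circuit_0).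
  assert (e1 : Cexp (W 1%R) = z0) by (rewrite <- gW; apply circuit_1).
  unfold u, u1. rewrite !clamp_id, e0, e1 by lra.
  assert (c0 : Cmod (z0 - z0) = 0%R) by (replace (z0 - z0) with (RtoC 0) by ring; apply Cmod_0).
  split. { rewrite <- (g0 z0), (g1 z0) by lra. reflexivity. }
  destruct (proj1 (holomorphic_ball_near _ _) (H1 0%R ltac:(lra))) as [r [hr hf]]. rewrite circuit_0 in hf.
  destruct (hf z0 ltac:(lra)) as [l hl]. rewrite (Cderiv_unique _ _ _ hl).
  rewrite (Cderiv_unique (F 1%R) z0 (Cexp (- (h * tpi)) * l)). ring.
  apply (Cderiv_ext_loc (fun z => Cexp (- (h * tpi)) * F 0%R z) _ _ _ (Rmin d0 d1)).
  apply Rmin_pos; auto.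
  { intros y hy. assert (m1 := Rmin_l d0 d1). assert (m2 := Rmin_r d0 d1). rewrite g1, g0 by lra. reflexivity. }
  eapply Cderiv_eq. apply Cderiv_mult. apply Cderiv_const. exact hl. cbv beta. ring. }
assert (kc : forall k t, Ccont (fun s => kexp h k (W s)) t).
{ intros k t. apply (Ccont_line (kexp h k) w0 tpi t _ (Cderiv_kexp h k _)). }
assert (ec : forall t, Ccont (fun s => Cexp (W s)) t) by (intros t; apply Ccont_exp).
assert (ec' : forall t, Ccont (fun s => / Cexp (W s)) t).
{ intros t. apply (Ccont_ext_loc (fun s => Cexp (- w0 + RtoC s * (- tpi))) _ t 1). lra.
  intros s _. rewrite <- Cexp_opp. f_equal. unfold W. ring. apply Ccont_exp. }
(* The weight never vanishes and can be divided out, so the derivatives of the weighted functions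
   also yield continuity of u and u1. *)
assert (strip : forall f k t, Ccont (fun s => f s * kexp h k (W s)) t -> Ccont f t).
{ intros f k t hfk. apply (Ccont_ext_loc (fun s => f s * kexp h k (W s) * Cexp (([k] - h) * w0 + RtoC s * (([k] - h) * tpi))) _ t 1). lra.
  - intros s _. unfold kexp. rewrite <- Cmult_assoc, <- Cexp_plus.
    replace (- (([k] - h) * W s) + (([k] - h) * w0 + RtoC s * (([k] - h) * tpi))) with (RtoC 0) by (unfold W; ring).
    rewrite Cexp_0. ring.
  - apply Ccont_mult. exact hfk. apply Ccont_exp. }
assert (cu : Ccont_on u 0 1).
{ intros t ht. apply (strip u 0%Z). exact (Rderiv_Ccont _ _ _ (proj1 (der 0%Z t ht))). }
assert (cu1 : Ccont_on u1 0 1).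
{ intros t ht. apply (strip u1 0%Z). exact (Rderiv_Ccont _ _ _ (proj2 (der 0%Z t ht))). }
assert (cu2 : Ccont_on u2 0 1).
{ intros t ht. unfold u2.
  apply (Ccont_ext_loc (fun t => RtoC (-1) * (RtoC 2 * h * u1 t + mu * (/ Cexp (W t) - Cexp (W t)) * u1 t + (lambda - mu * n * Cexp (W t)) * u t)) _ t 1). lra.
  intros s _. ring.
  apply Ccont_mult. apply Ccont_const. apply Ccont_plus. apply Ccont_plus.
  apply Ccont_mult. apply Ccont_const. apply cu1, ht.
  apply Ccont_mult. apply Ccont_mult. apply Ccont_const. apply Ccont_minus; auto. apply cu1, ht.
  apply Ccont_mult. apply Ccont_minus. apply Ccont_const. apply Ccont_mult. apply Ccont_const. apply ec. apply cu, ht. }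
assert (pc : forall f k, Ccont_on f 0 1 -> Ccont_on (fun t => f t * kexp h k (W t)) 0 1).
{ intros f k hf t ht. apply Ccont_mult; auto. }
(* Integration by parts; the boundary terms cancel because the eigenvalue and the multiplier of the
   weight are inverse to each other. *)
assert (parts : forall f f' k, Ccont_on f 0 1 -> Ccont_on f' 0 1 ->
   f 1%R = Cexp (- (h * tpi)) * f 0%R ->
   (forall t, (0 <= t <= 1)%R -> Rderiv (fun s => f s * kexp h k (W s)) t (tpi * ((f' t - ([k] - h) * f t) * kexp h k (W t)))) ->
   CInt (fun t => f' t * kexp h k (W t)) 0 1 = ([k] - h) * CInt (fun t => f t * kexp h k (W t)) 0 1).
{ intros f f' k hf hf' e D.
  assert (q := CInt_derive (fun s => f s * kexp h k (W s)) (fun t => tpi * ((f' t - ([k] - h) * f t) * kexp h k (W t))) 0 1 ltac:(lra) D).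
  assert (c1 : Ccont_on (fun t => (f' t - ([k] - h) * f t) * kexp h k (W t)) 0 1).
  { apply pc. intros t ht. apply Ccont_minus; auto. apply Ccont_mult. apply Ccont_const. auto. }
  assert (c2 : Ccont_on (fun t => tpi * ((f' t - ([k] - h) * f t) * kexp h k (W t))) 0 1).
  { intros t ht. apply Ccont_mult. apply Ccont_const. apply c1, ht. }
  specialize (q c2). rewrite CInt_scal in q by (auto; lra).
  replace (W 1%R) with (W 0%R + tpi) in q by (unfold W; ring).
  rewrite kexp_period, e in q.
  replace (Cexp (- (h * tpi)) * f 0%R * (Cexp (h * tpi) * kexp h k (W 0%R)) - f 0%R * kexp h k (W 0%R)) with (RtoC 0) in q.
  2:{ replace (Cexp (- (h * tpi)) * f 0%R * (Cexp (h * tpi) * kexp h k (W 0%R))) with (Cexp (- (h * tpi)) * Cexp (h * tpi) * (f 0%R * kexp h k (W 0%R))) by ring.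
    rewrite Cexp_opp_mult. ring. }
  assert (q2 : CInt (fun t => (f' t - ([k] - h) * f t) * kexp h k (W t)) 0 1 = RtoC 0).
  { destruct (Ceq_dec (CInt (fun t => (f' t - ([k] - h) * f t) * kexp h k (W t)) 0 1) (RtoC 0)) as [z|z]; [exact z|exfalso].
    exact (Cmult_neq_0 _ _ tpi_neq_0 z q). }
  rewrite (CInt_ext _ (fun t => f' t * kexp h k (W t) - ([k] - h) * (f t * kexp h k (W t)))) in q2 by (try lra; intros; ring).
  rewrite CInt_minus, CInt_scal in q2; auto; try lra.
  - apply Ceq_minus. exact q2.
  - intros t ht. apply Ccont_mult. apply Ccont_const. apply (pc f k hf t ht). }
set (c := fun k => CInt (fun t => u t * kexp h k (W t)) 0 1).
set (c1 := fun k => CInt (fun t => u1 t * kexp h k (W t)) 0 1).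
assert (ec1 : forall k, c1 k = ([k] - h) * c k).
{ intros k. exact (parts u u1 k cu cu1 (proj1 bdry) (fun t ht => proj1 (der k t ht))). }
assert (ec2 : forall k, CInt (fun t => u2 t * kexp h k (W t)) 0 1 = ([k] - h) * c1 k).
{ intros k. exact (parts u1 u2 k cu1 cu2 (proj2 bdry) (fun t ht => proj2 (der k t ht))). }
(* The equation is integrated against the weight of index k: the factor 1/z shifts this index to k +
   1, the factor z to k - 1. *)
assert (rec : forall k, recurrence_at lambda mu h c k).
{ intros k.
  assert (e : CInt (fun t => u2 t * kexp h k (W t)) 0 1 =
    - (RtoC 2 * h) * c1 k + (- mu) * c1 (k + 1)%Z + mu * c1 (k - 1)%Z + (- lambda) * c k + (mu * n) * c (k - 1)%Z).
  { set (g1 := fun t => - (RtoC 2 * h) * (u1 t * kexp h k (W t))).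
    set (g2 := fun t => g1 t + (- mu) * (u1 t * kexp h (k + 1) (W t))).
    set (g3 := fun t => g2 t + mu * (u1 t * kexp h (k - 1) (W t))).
    set (g4 := fun t => g3 t + (- lambda) * (u t * kexp h k (W t))).
    set (g5 := fun t => g4 t + (mu * n) * (u t * kexp h (k - 1) (W t))).
    assert (lin : forall g x f j, Ccont_on g 0 1 -> Ccont_on f 0 1 ->
      Ccont_on (fun t => g t + x * (f t * kexp h j (W t))) 0 1 /\
      CInt (fun t => g t + x * (f t * kexp h j (W t))) 0 1 = CInt g 0 1 + x * CInt (fun t => f t * kexp h j (W t)) 0 1).
    { intros g x f j hg hf.
      assert (k1 := pc f j hf).
      assert (k2 : Ccont_on (fun t => x * (f t * kexp h j (W t))) 0 1).
      { intros t ht. apply Ccont_mult. apply Ccont_const. apply k1, ht. }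
      split. intros t ht. apply Ccont_plus; auto.
      rewrite (CInt_plus g (fun t => x * (f t * kexp h j (W t))) 0 1 ltac:(lra) hg k2).
      f_equal. apply CInt_scal. lra. exact k1. }
    assert (i1 : Ccont_on g1 0 1 /\ CInt g1 0 1 = - (RtoC 2 * h) * c1 k).
    { split. intros t ht. apply Ccont_mult. apply Ccont_const. apply (pc u1 k cu1 t ht).
      apply CInt_scal. lra. exact (pc u1 k cu1). }
    assert (i2 := lin g1 (- mu) u1 (k + 1)%Z (proj1 i1) cu1).
    assert (i3 := lin g2 mu u1 (k - 1)%Z (proj1 i2) cu1).
    assert (i4 := lin g3 (- lambda) u k (proj1 i3) cu).
    assert (i5 := lin g4 (mu * n) u (k - 1)%Z (proj1 i4) cu).
    transitivity (CInt g5 0 1).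
    - apply CInt_ext. lra. intros t _. unfold g5, g4, g3, g2, g1.
      destruct (kexp_shift h k (W t)) as [-> ->]. unfold u2. ring.
    - rewrite (proj2 i5 : CInt g5 0 1 = _), (proj2 i4 : CInt g4 0 1 = _), (proj2 i3 : CInt g3 0 1 = _),
        (proj2 i2 : CInt g2 0 1 = _), (proj2 i1). reflexivity. }
  rewrite ec2, !ec1 in e. unfold recurrence_at.
  apply Ceq_minus in e. rewrite plus_IZR, minus_IZR, RtoC_plus, RtoC_minus, en in e.
  rewrite <- e. ring. }
destruct (Ccont_on_bounded u 0 1 ltac:(lra) cu) as [M HM].
assert (hM : (0 <= M)%R) by (eapply Rle_trans; [apply Cmod_ge_0|apply (HM 0%R); lra]).
(* A bound for |w| on the segment over the circuit, so the weight is at most e^(|k - h| rho). *)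
set (rho := (Cmod w0 + 2 * PI)%R).
assert (hpi := PI_RGT_0). assert (hw := Cmod_ge_0 w0). assert (hrho : (0 <= rho)%R) by (unfold rho; lra).
exists c, (M * exp (Cmod h * rho))%R, (exp rho).
split. apply exp_ge_1, hrho. split. exact rec. split.
- intros k. replace (M * exp (Cmod h * rho) * exp rho ^ Z.abs_nat k)%R with ((1 - 0) * (M * (exp rho ^ Z.abs_nat k * exp (Cmod h * rho))))%R by ring.
  apply CInt_norm_le_const. lra. apply pc, cu.
  intros t ht. rewrite Cmod_mult. apply Rmult_le_compat; try apply Cmod_ge_0. auto.
  unfold kexp. rewrite Cmod_Cexp.
  replace (exp rho ^ Z.abs_nat k * exp (Cmod h * rho))%R with (exp ((INR (Z.abs_nat k) + Cmod h) * rho)).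
  2:{ rewrite Rmult_plus_distr_r, exp_plus, exp_INR. reflexivity. }
  apply exp_le. eapply Rle_trans; [apply re_le_Cmod'|]. rewrite Cmod_opp, Cmod_mult.
  apply Rmult_le_compat; try apply Cmod_ge_0.
  + eapply Rle_trans; [apply Cmod_triangle_minus|]. apply Rplus_le_compat_r. rewrite Cmod_R, INR_IZR_INZ, <- abs_IZR.
    right. f_equal. lia.
  + unfold W, rho. eapply Rle_trans; [apply Cmod_triangle|]. apply Rplus_le_compat_l.
    rewrite !Cmod_mult, Cmod_Ci, !Cmod_R, !Rabs_pos_eq by lra. nra.
- destruct (Classical_Prop.classic (exists m, c m <> RtoC 0)) as [q|q]; [exact q|exfalso].
  assert (cz : forall k, c k = RtoC 0).
  { intros k. destruct (Ceq_dec (c k) (RtoC 0)) as [z|z]; [exact z|]. exfalso; apply q; exists k; exact z. }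
  (* Multiplying by z^h leaves a function whose ordinary Fourier coefficients are, up to nonzero
     factors, the c_k. *)
  set (v := fun t : R => u t * Cexp (h * w0 + RtoC t * (h * tpi))).
  assert (cv : Ccont_on v 0 1).
  { intros t ht. apply Ccont_mult. apply cu, ht. apply Ccont_exp. }
  assert (vz : forall t, (0 <= t <= 1)%R -> v t = RtoC 0).
  { apply fourier_unique. exact cv. intros k.
    transitivity (CInt (fun t => Cexp (- ([k] * w0)) * (u t * kexp h (- k) (W t))) 0 1).
    - apply CInt_ext. lra. intros t _. unfold v, fexp, kexp, W.
      transitivity (u t * (Cexp (h * w0 + RtoC t * (h * tpi)) * Cexp (RtoC t * ([k] * tpi)))). ring.
      transitivity (u t * (Cexp (- ([k] * w0)) * Cexp (- (([(- k)%Z] - h) * (w0 + RtoC t * tpi))))); [|ring].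
      rewrite <- !Cexp_plus. do 2 f_equal. rewrite opp_IZR, RtoC_opp. ring.
    - rewrite CInt_scal. fold (c (- k)%Z). rewrite cz. ring. lra. apply pc, cu. }
  assert (uz : forall t, (0 <= t <= 1)%R -> u t = RtoC 0).
  { intros t ht. specialize (vz t ht). unfold v in vz.
    destruct (Ceq_dec (u t) (RtoC 0)) as [z|z]; [exact z|exfalso].
    exact (Cmult_neq_0 _ _ z (Cexp_neq_0 _) vz). }
  apply nE.
  destruct (proj1 (holomorphic_ball_near _ _) (H1 0%R ltac:(lra))) as [r [hr hf]]. rewrite circuit_0 in hf.
  destruct (loc 0%R ltac:(lra)) as [d [hd Hd]].
  (* The germ vanishes on an arc of the circuit starting at z0. Its points differ from z0 because
     the exponents differ by less than 2 pi i, so these zeros accumulate at z0. *)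
  assert (Fz : forall z, (Cmod (z - z0) < r)%R -> F 0%R z = RtoC 0).
  { apply (isolated_zeros (F 0%R) z0 r hr hf). intros e he.
    destruct (circuit_cont z0 0 e hz he) as [d2 [hd2 Hd2]].
    set (s := (Rmin (Rmin d d2) 1 / 2)%R).
    assert (m := Rmin_pos _ _ (Rmin_pos _ _ hd hd2) Rlt_0_1). assert (m1 := Rmin_l (Rmin d d2) 1). assert (m2 := Rmin_r (Rmin d d2) 1).
    assert (m3 := Rmin_l d d2). assert (m4 := Rmin_r d d2).
    assert (hs : (0 < s)%R) by (unfold s; lra). assert (hs1 : (s < 1)%R) by (unfold s; lra).
    assert (as0 : (Rabs (s - 0) < d /\ Rabs (s - 0) < d2)%R).
    { rewrite Rminus_0_r, Rabs_pos_eq by lra. unfold s; lra. }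
    exists (circuit z0 s). split.
    - split.
      + apply Cmod_gt_0. intros z. apply Ceq_minus in z. rewrite <- (circuit_0 z0) in z at 2. rewrite !gW in z.
        apply Cexp_eq in z.
        * unfold W in z. assert (z' : RtoC s * tpi = RtoC 0).
          { transitivity (w0 + RtoC s * tpi - (w0 + RtoC 0 * tpi)). ring. rewrite z. ring. }
          refine (Cmult_neq_0 _ _ _ tpi_neq_0 z'). intros w. apply RtoC_inj in w. lra.
        * unfold W. replace (Im (w0 + RtoC s * tpi) - Im (w0 + RtoC 0 * tpi))%R with (2 * PI * s)%R.
          rewrite Rabs_pos_eq by nra. nra.
          destruct w0 as [xx yy]. unfold RtoC, Ci, Cmult, Cplus, Im. simpl. ring.
      + rewrite <- (circuit_0 z0) at 2. apply Hd2, as0.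
    - rewrite gW. destruct (Hd s (proj1 as0)) as [<- _]. apply uz. lra. }
  apply locally_Cmod in H3. destruct H3 as [d0 [hd0 g0]]. rewrite circuit_0 in g0.
  apply locally_Cmod. exists (Rmin d0 r). split. apply Rmin_pos; auto.
  intros y hy. assert (m1 := Rmin_l d0 r). assert (m2 := Rmin_r d0 r). rewrite g0 by lra. apply Fz. lra.
Qed.

(** * From a solution of the recurrence to an eigenfunction *)

(** The monomial z^(k - h) at z = e^w. *)
Definition bexp (h : C) (k : Z) (w : C) : C := Cexp (([k] - h) * w).

Lemma Cmod_Z_minus (h : C) (k : Z) : (Cmod ([k] - h) <= INR (Z.abs_nat k) + Cmod h)%R.
Proof.
eapply Rle_trans; [apply Cmod_triangle_minus|]. apply Rplus_le_compat_r. rewrite Cmod_R, INR_IZR_INZ, <- abs_IZR.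
right. f_equal. lia.
Qed.

(** The decay is used at the rate 2 e^rho: e^rho pays for the exponential, and 2^(-|k|) is left for
    summation. *)
Lemma superdecay_exp (h : C) (a : Z -> C) (rho : R) : superdecay a -> (0 <= rho)%R ->
  exists K, (0 <= K)%R /\ forall k, (Cmod (a k) * exp (Cmod ([k] - h) * rho) <= K * (1 / 2) ^ Z.abs_nat k)%R.
Proof.
intros ha hr. destruct (ha (2 * exp rho)%R) as [K HK]. { assert (q := exp_pos rho). lra. }
assert (hK : (0 <= K)%R).
{ specialize (HK 0%Z). simpl in HK. assert (q := Cmod_ge_0 (a 0%Z)). lra. }
assert (eh := exp_pos (Cmod h * rho)).
exists (K * exp (Cmod h * rho))%R. split. apply Rmult_le_pos; lra.
intros k. specialize (HK k). set (j := Z.abs_nat k) in *.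
assert (p2 : (0 < 2 ^ j)%R) by (apply pow_lt; lra).
rewrite Rpow_mult_distr in HK.
assert (e : (exp (Cmod ([k] - h) * rho) <= exp rho ^ j * exp (Cmod h * rho))%R).
{ rewrite <- exp_INR, <- exp_plus, <- Rmult_plus_distr_r. apply exp_le. apply Rmult_le_compat_r; auto. apply Cmod_Z_minus. }
apply Rle_trans with (Cmod (a k) * (exp rho ^ j * exp (Cmod h * rho)))%R. { apply Rmult_le_compat_l; auto. apply Cmod_ge_0. }
replace (1 / 2)%R with (/ 2)%R by field. rewrite pow_inv.
apply Rmult_le_reg_l with (2 ^ j)%R; auto.
replace (2 ^ j * (K * exp (Cmod h * rho) * / 2 ^ j))%R with (K * exp (Cmod h * rho))%R by (field; lra).
replace (2 ^ j * (Cmod (a k) * (exp rho ^ j * exp (Cmod h * rho))))%R with (Cmod (a k) * (2 ^ j * exp rho ^ j) * exp (Cmod h * rho))%R by ring.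
apply Rmult_le_compat_r; lra.
Qed.

Lemma superdecay_mult (h : C) (a : Z -> C) : superdecay a -> superdecay (fun k => ([k] - h) * a k).
Proof.
intros ha r hr. destruct (ha (2 * r)%R ltac:(lra)) as [K HK].
assert (hh := Cmod_ge_0 h). exists ((1 + Cmod h) * K)%R. intros k. specialize (HK k).
assert (b := Cmod_Z_minus h k). set (j := Z.abs_nat k) in *.
rewrite Cmod_mult. rewrite Rpow_mult_distr in HK.
assert (p2 := INR_lt_pow2 j).
assert (hj := pos_INR j). assert (ca := Cmod_ge_0 (a k)). assert (rp : (0 < r ^ j)%R) by (apply pow_lt; lra).
apply Rle_trans with ((1 + Cmod h) * (Cmod (a k) * (2 ^ j * r ^ j)))%R; [|apply Rmult_le_compat_l; lra].
replace (Cmod ([k] - h) * Cmod (a k) * r ^ j)%R with (Cmod ([k] - h) * (Cmod (a k) * r ^ j))%R by ring.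
replace ((1 + Cmod h) * (Cmod (a k) * (2 ^ j * r ^ j)))%R with ((1 + Cmod h) * 2 ^ j * (Cmod (a k) * r ^ j))%R by ring.
apply Rmult_le_compat_r. apply Rmult_le_pos; lra. nra.
Qed.

Definition lterm (h : C) (a : Z -> C) (n : nat) (w : C) : C :=
  a (Z.of_nat n) * bexp h (Z.of_nat n) w + a (- Z.of_nat n - 1)%Z * bexp h (- Z.of_nat n - 1) w.

(* The Laurent series z^(-h) sum_k a_k z^k at z = e^w, summed over k = n and k = - n - 1. *)
Definition laurent (h : C) (a : Z -> C) (w : C) : C := CSeries (fun n => lterm h a n w).

Lemma pair_bound (f : Z -> C) (K : R) (n : nat) : (0 <= K)%R ->
  (forall k, (Cmod (f k) <= K * (1 / 2) ^ Z.abs_nat k)%R) ->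
  (Cmod (f (Z.of_nat n) + f (- Z.of_nat n - 1)%Z) <= 2 * K * (1 / 2) ^ n)%R.
Proof.
intros hK H. eapply Rle_trans; [apply Cmod_triangle|].
assert (h1 := H (Z.of_nat n)). assert (h2 := H (- Z.of_nat n - 1)%Z).
replace (Z.abs_nat (Z.of_nat n)) with n in h1 by lia.
replace (Z.abs_nat (- Z.of_nat n - 1)) with (S n) in h2 by lia. simpl pow in h2.
assert (0 < (1 / 2) ^ n)%R by (apply pow_lt; lra).
assert (0 <= K * (1 / 2) ^ n)%R by (apply Rmult_le_pos; lra). lra.
Qed.

Lemma bexp_bound (h : C) (k : Z) (w : C) (rho : R) : (Cmod w <= rho)%R ->
  (Cmod (bexp h k w) <= exp (Cmod ([k] - h) * rho))%R.
Proof.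
intros hw. unfold bexp. rewrite Cmod_Cexp. apply exp_le. eapply Rle_trans; [apply re_le_Cmod'|].
rewrite Cmod_mult. apply Rmult_le_compat_l; auto. apply Cmod_ge_0.
Qed.

Lemma lterm_bound (h : C) (a : Z -> C) (rho : R) : superdecay a -> (0 <= rho)%R ->
  exists K, (0 <= K)%R /\ forall w, (Cmod w <= rho)%R ->
    (forall k, (Cmod (a k * bexp h k w) <= K * (1 / 2) ^ Z.abs_nat k)%R) /\
    forall n, (Cmod (lterm h a n w) <= 2 * K * (1 / 2) ^ n)%R.
Proof.
intros ha hr. destruct (superdecay_exp h a rho ha hr) as [K [hK HK]]. exists K. split. exact hK.
intros w hw.
assert (b : forall k, (Cmod (a k * bexp h k w) <= K * (1 / 2) ^ Z.abs_nat k)%R).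
{ intros k. rewrite Cmod_mult. eapply Rle_trans; [|apply HK]. apply Rmult_le_compat_l. apply Cmod_ge_0. apply bexp_bound, hw. }
split. exact b. intros n. apply (pair_bound (fun k => a k * bexp h k w)); auto.
Qed.

Lemma laurent_correct (h : C) (a : Z -> C) (w : C) : superdecay a -> Cser (fun n => lterm h a n w) (laurent h a w).
Proof.
intros ha. destruct (lterm_bound h a (Cmod w) ha (Cmod_ge_0 w)) as [K [hK HK]].
apply (CSeries_correct _ (2 * K) (1 / 2)). lra. apply (HK w). lra.
Qed.

Lemma Cderiv_laurent (h : C) (a : Z -> C) (w : C) : superdecay a ->
  Cderiv (laurent h a) w (laurent h (fun k => ([k] - h) * a k) w).
Proof.
intros ha. assert (hw := Cmod_ge_0 w).
(* Besides e^(c |w|), with c = |k - h|, two factors e^c are reserved: one for an increment of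
   modulus below 1, one for c^2 <= 4 e^c in the quadratic remainder. The latter gives 10 x 4 = 40,
   doubled in [L] by pairing indices. *)
destruct (superdecay_exp h a (Cmod w + 2) ha ltac:(lra)) as [K [hK HK]].
set (L := (80 * K)%R).
assert (sq : forall x, (0 <= x)%R -> (x ^ 2 <= 4 * exp x)%R).
{ intros x hx. assert (e1 := exp_ineq1_le (x / 2)).
  replace (exp x) with (exp (x / 2) * exp (x / 2))%R by (rewrite <- exp_plus; f_equal; field). nra. }
assert (gp : forall n : nat, (0 < (1 / 2) ^ n)%R) by (intros; apply pow_lt; lra).
assert (base : forall k v c, (Cmod v <= c * exp (Cmod ([k] - h) * (Cmod w + 2)))%R -> (0 <= c)%R ->
   (Cmod (a k * v) <= c * K * (1 / 2) ^ Z.abs_nat k)%R).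
{ intros k v c hv hc. rewrite Cmod_mult.
  apply Rle_trans with (Cmod (a k) * (c * exp (Cmod ([k] - h) * (Cmod w + 2))))%R. apply Rmult_le_compat_l; auto. apply Cmod_ge_0.
  replace (Cmod (a k) * (c * exp (Cmod ([k] - h) * (Cmod w + 2))))%R with (c * (Cmod (a k) * exp (Cmod ([k] - h) * (Cmod w + 2))))%R by ring.
  rewrite (Rmult_assoc c K). apply Rmult_le_compat_l; auto. }
apply (Cderiv_CSeries (lterm h a) (lterm h (fun k => ([k] - h) * a k)) w (1 / 2) L 1).
- lra.
- lra.
- intros n v hv.
  eapply Rle_trans. apply (pair_bound (fun k => a k * bexp h k (w + v)) (1 * K)); [lra|].
  + intros k. apply base; [|lra]. rewrite Rmult_1_l. apply bexp_bound.
    eapply Rle_trans; [apply Cmod_triangle|]. lra.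
  + apply Rmult_le_compat_r. left; auto. unfold L; lra.
- intros n.
  eapply Rle_trans. apply (pair_bound (fun k => ([k] - h) * a k * bexp h k w) (1 * K)); [lra|].
  + intros k. replace (([k] - h) * a k * bexp h k w) with (a k * (([k] - h) * bexp h k w)) by ring.
    apply base; [|lra]. rewrite Cmod_mult, Rmult_1_l.
    assert (b := bexp_bound h k w (Cmod w) (Rle_refl _)). assert (c0 := Cmod_ge_0 ([k] - h)).
    replace (Cmod ([k] - h) * (Cmod w + 2))%R with (Cmod ([k] - h) * 2 + Cmod ([k] - h) * Cmod w)%R by ring. rewrite exp_plus.
    apply Rmult_le_compat; auto. apply Cmod_ge_0.
    assert (q := exp_ineq1_le (Cmod ([k] - h) * 2)). lra.
  + apply Rmult_le_compat_r. left; auto. unfold L; lra.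
- intros n v hv.
  set (g := fun k => a k * (bexp h k (w + v) - bexp h k w - v * (([k] - h) * bexp h k w))).
  replace (lterm h a n (w + v) - lterm h a n w - v * lterm h (fun k => ([k] - h) * a k) n w)
    with (g (Z.of_nat n) + g (- Z.of_nat n - 1)%Z) by (unfold g, lterm; ring).
  assert (v0 := Cmod_ge_0 v). assert (v2 : (0 <= Cmod v ^ 2)%R) by apply pow2_ge_0.
  eapply Rle_trans. apply (pair_bound g (40 * Cmod v ^ 2 * K)). { repeat apply Rmult_le_pos; lra. }
  + intros k. apply base; [|lra].
    replace (bexp h k (w + v) - bexp h k w - v * (([k] - h) * bexp h k w))
      with (bexp h k w * (Cexp (([k] - h) * v) - RtoC 1 - ([k] - h) * v)).
    2:{ unfold bexp. replace (([k] - h) * (w + v)) with (([k] - h) * w + ([k] - h) * v) by ring. rewrite Cexp_plus. ring. }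
    rewrite Cmod_mult. assert (b := bexp_bound h k w (Cmod w) (Rle_refl _)). assert (c0 := Cmod_ge_0 ([k] - h)).
    assert (q := Cexp_quad (([k] - h) * v)). rewrite Cmod_mult in q.
    set (c := Cmod ([k] - h)) in *.
    assert (s := sq c c0).
    assert (m1 : (exp (c * Cmod v) <= exp c)%R) by (apply exp_le; nra).
    replace (exp (c * (Cmod w + 2))) with (exp (c * Cmod w) * (exp c * exp c))%R by (rewrite <- !exp_plus; f_equal; ring).
    apply Rle_trans with (exp (c * Cmod w) * (10 * (c * Cmod v) ^ 2 * exp (c * Cmod v)))%R.
    { apply Rmult_le_compat; auto; apply Cmod_ge_0. }
    replace (40 * Cmod v ^ 2 * (exp (c * Cmod w) * (exp c * exp c)))%R with (exp (c * Cmod w) * (10 * Cmod v ^ 2 * (4 * exp c) * exp c))%R by ring.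
    apply Rmult_le_compat_l. left; apply exp_pos.
    assert (e2 := exp_pos (c * Cmod v)).
    apply Rmult_le_compat; try lra. { apply Rmult_le_pos; [lra|apply pow2_ge_0]. }
    replace (10 * (c * Cmod v) ^ 2)%R with (10 * Cmod v ^ 2 * c ^ 2)%R by ring. apply Rmult_le_compat_l; lra.
  + right. unfold L. ring.
Qed.

Lemma bexp_period (h : C) (k : Z) (w : C) : bexp h k (w + tpi) = Cexp (- (h * tpi)) * bexp h k w.
Proof.
unfold bexp. replace (([k] - h) * (w + tpi)) with (- (h * tpi) + ([k] - h) * w + [k] * tpi) by ring.
rewrite !Cexp_plus, Cexp_Z. ring.
Qed.

Lemma laurent_period (h : C) (a : Z -> C) (w : C) : superdecay a ->
  laurent h a (w + tpi) = Cexp (- (h * tpi)) * laurent h a w.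
Proof.
intros ha. apply CSeries_unique.
apply (Cser_ext (fun n => Cexp (- (h * tpi)) * lterm h a n w)).
- intros n. unfold lterm. rewrite !bexp_period. ring.
- apply Cser_scal, laurent_correct, ha.
Qed.

Lemma laurent_ode (lambda mu h n : C) (a : Z -> C) (w : C) : n = RtoC 2 * h + RtoC 1 ->
  superdecay a -> (forall k, recurrence_at lambda mu h a k) ->
  let a1 := fun k => ([k] - h) * a k in let a2 := fun k => ([k] - h) * a1 k in
  laurent h a2 w + RtoC 2 * h * laurent h a1 w + mu * (/ Cexp w - Cexp w) * laurent h a1 w
  + (lambda - mu * n * Cexp w) * laurent h a w = RtoC 0.
Proof.
intros en ha H a1 a2.
assert (ha1 := superdecay_mult h a ha). fold a1 in ha1.
assert (ha2 := superdecay_mult h a1 ha1). fold a2 in ha2.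
set (z := Cexp w). assert (hz : z <> RtoC 0) by apply Cexp_neq_0.
(* The terms that 1/z and z move to neighbouring powers. By the recurrence the k-th terms of the
   equation reduce to differences of [T] and [U], so the partial sums telescope to the boundary
   terms [P]. *)
set (T := fun k => mu * / z * (a1 k * bexp h k w)).
set (U := fun k => - (mu * z) * (a1 k * bexp h k w + n * (a k * bexp h k w))).
assert (bs : forall k, bexp h (k + 1) w = z * bexp h k w).
{ intros k. unfold bexp, z. rewrite plus_IZR, RtoC_plus, <- Cexp_plus. f_equal. ring. }
assert (bs' : forall k, bexp h (k - 1) w = / z * bexp h k w).
{ intros k. unfold bexp, z. rewrite minus_IZR, RtoC_minus, <- Cexp_opp, <- Cexp_plus. f_equal. ring. }
set (G := fun k => a2 k * bexp h k w + RtoC 2 * h * (a1 k * bexp h k w) + mu * (/ z - z) * (a1 k * bexp h k w) + (lambda - mu * n * z) * (a k * bexp h k w)).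
assert (GT : forall k, G k = T k - T (k + 1)%Z + U k - U (k - 1)%Z).
{ intros k. unfold G, T, U. rewrite bs, bs'. specialize (H k). unfold recurrence_at in H.
  unfold a2, a1. rewrite plus_IZR, minus_IZR, RtoC_plus, RtoC_minus.
  apply Ceq_minus.
  transitivity (bexp h k w * (([k] ^ 2 - h ^ 2 + lambda) * a k + mu * ([k] + RtoC 1 - h) * a (k + 1)%Z - mu * ([k] + h) * a (k - 1)%Z)).
  rewrite en. field. exact hz. rewrite H. ring. }
set (P := fun m : nat => T (- Z.of_nat m)%Z - T (Z.of_nat m) + U (Z.of_nat m - 1)%Z - U (- Z.of_nat m - 1)%Z).
assert (cs : forall m, csum (fun n => G (Z.of_nat n) + G (- Z.of_nat n - 1)%Z) m = P m).
{ induction m.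
  - unfold P. simpl. ring.
  - simpl csum. rewrite IHm, !GT. unfold P. rewrite Nat2Z.inj_succ.
    replace (Z.succ (Z.of_nat m)) with (Z.of_nat m + 1)%Z by lia.
    replace (- Z.of_nat m - 1 + 1)%Z with (- Z.of_nat m)%Z by lia.
    replace (- (Z.of_nat m + 1))%Z with (- Z.of_nat m - 1)%Z by lia.
    replace (Z.of_nat m + 1 - 1)%Z with (Z.of_nat m) by lia. ring. }
assert (ser : Cser (fun n => G (Z.of_nat n) + G (- Z.of_nat n - 1)%Z)
   (laurent h a2 w + RtoC 2 * h * laurent h a1 w + mu * (/ z - z) * laurent h a1 w + (lambda - mu * n * z) * laurent h a w)).
{ apply (Cser_ext (fun n0 => lterm h a2 n0 w + RtoC 2 * h * lterm h a1 n0 w + mu * (/ z - z) * lterm h a1 n0 w + (lambda - mu * n * z) * lterm h a n0 w)).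
  - intros j. unfold G, lterm. ring.
  - apply Cser_plus. apply Cser_plus. apply Cser_plus.
    apply laurent_correct; auto. apply Cser_scal, laurent_correct; auto. apply Cser_scal, laurent_correct; auto. apply Cser_scal, laurent_correct; auto. }
apply (Clim_unique (csum (fun n => G (Z.of_nat n) + G (- Z.of_nat n - 1)%Z))). exact ser.
apply (Clim_ext P). { intros m; symmetry; apply cs. }
destruct (lterm_bound h a (Cmod w) ha (Cmod_ge_0 w)) as [K [hK HK]].
destruct (lterm_bound h a1 (Cmod w) ha1 (Cmod_ge_0 w)) as [K1 [hK1 HK1]].
destruct (HK w (Rle_refl _)) as [b _]. destruct (HK1 w (Rle_refl _)) as [b1 _]. clear HK HK1.
set (cT := Cmod (mu * / z)). set (cU := Cmod (mu * z)).
assert (cT0 : (0 <= cT)%R) by apply Cmod_ge_0. assert (cU0 : (0 <= cU)%R) by apply Cmod_ge_0. assert (cn := Cmod_ge_0 n).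
set (Q := (cT * K1 + cU * (K1 + Cmod n * K))%R).
assert (hQ : (0 <= Q)%R). { unfold Q. repeat first [apply Rplus_le_le_0_compat | apply Rmult_le_pos]; auto. }
assert (bT : forall k, (Cmod (T k) <= Q * (1 / 2) ^ Z.abs_nat k)%R).
{ intros k. unfold T. rewrite Cmod_mult. fold cT.
  apply Rle_trans with (cT * (K1 * (1 / 2) ^ Z.abs_nat k))%R. apply Rmult_le_compat_l; auto.
  rewrite <- Rmult_assoc. apply Rmult_le_compat_r. apply pow_le; lra. unfold Q.
  assert (0 <= cU * (K1 + Cmod n * K))%R by (repeat first [apply Rplus_le_le_0_compat | apply Rmult_le_pos]; auto). lra. }
assert (bU : forall k, (Cmod (U k) <= Q * (1 / 2) ^ Z.abs_nat k)%R).
{ intros k. unfold U. rewrite Cmod_mult, Cmod_opp. fold cU.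
  apply Rle_trans with (cU * ((K1 + Cmod n * K) * (1 / 2) ^ Z.abs_nat k))%R.
  { apply Rmult_le_compat_l; auto. eapply Rle_trans; [apply Cmod_triangle|]. rewrite (Cmod_mult n).
    assert (Cmod n * Cmod (a k * bexp h k w) <= Cmod n * (K * (1 / 2) ^ Z.abs_nat k))%R by (apply Rmult_le_compat_l; auto).
    specialize (b1 k). lra. }
  rewrite <- Rmult_assoc. apply Rmult_le_compat_r. apply pow_le; lra. unfold Q.
  assert (0 <= cT * K1)%R by (apply Rmult_le_pos; auto). lra. }
intros eps he.
assert (L : is_lim_seq (fun m => (8 * Q * (1 / 2) ^ m)%R) 0%R).
{ replace (Finite 0) with (Rbar_mult (Finite (8 * Q)%R) (Finite 0)) by (simpl; f_equal; ring).
  apply is_lim_seq_scal_l, is_lim_seq_geom. apply Rabs_def1; lra. }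
apply is_lim_seq_spec in L. destruct (L (mkposreal eps he)) as [N hN]. exists N. intros m hm.
specialize (hN m hm). simpl in hN. rewrite Rminus_0_r in hN.
eapply Rle_lt_trans; [|eapply Rle_lt_trans; [apply Rle_abs|exact hN]].
assert (gm : (0 < (1 / 2) ^ m)%R) by (apply pow_lt; lra).
(* All four boundary indices have modulus at least m - 1, which costs a factor 2 each; hence the
   constant 8. *)
assert (near : forall k, (m <= S (Z.abs_nat k))%nat -> (Q * (1 / 2) ^ Z.abs_nat k <= 2 * Q * (1 / 2) ^ m)%R).
{ intros k hk.
  assert (q : ((1 / 2) ^ Z.abs_nat k <= 2 * (1 / 2) ^ m)%R).
  { replace (1 / 2)%R with (/ 2)%R by field. rewrite !pow_inv.
    apply Rmult_le_reg_r with (2 ^ Z.abs_nat k * 2 ^ m)%R. apply Rmult_lt_0_compat; apply pow_lt; lra.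
    replace (/ 2 ^ Z.abs_nat k * (2 ^ Z.abs_nat k * 2 ^ m))%R with (2 ^ m)%R by (field; apply pow_nonzero; lra).
    replace (2 * / 2 ^ m * (2 ^ Z.abs_nat k * 2 ^ m))%R with (2 ^ S (Z.abs_nat k))%R by (simpl; field; apply pow_nonzero; lra).
    apply Rle_pow; [lra|exact hk]. }
  replace (2 * Q * (1 / 2) ^ m)%R with (Q * (2 * (1 / 2) ^ m))%R by ring. apply Rmult_le_compat_l; auto. }
assert (t1 := bT (- Z.of_nat m)%Z). assert (t2 := bT (Z.of_nat m)). assert (t3 := bU (Z.of_nat m - 1)%Z). assert (t4 := bU (- Z.of_nat m - 1)%Z).
assert (n1 := near (- Z.of_nat m)%Z ltac:(lia)). assert (n2 := near (Z.of_nat m) ltac:(lia)).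
assert (n3 := near (Z.of_nat m - 1)%Z ltac:(lia)). assert (n4 := near (- Z.of_nat m - 1)%Z ltac:(lia)).
unfold P. set (x1 := T (- Z.of_nat m)%Z) in *. set (x2 := T (Z.of_nat m)) in *. set (x3 := U (Z.of_nat m - 1)%Z) in *. set (x4 := U (- Z.of_nat m - 1)%Z) in *.
replace (x1 - x2 + x3 - x4 - RtoC 0) with ((x1 - x2) + (x3 - x4)) by ring.
assert (k1 := Cmod_triangle (x1 - x2) (x3 - x4)). assert (k2 := Cmod_triangle_minus x1 x2). assert (k3 := Cmod_triangle_minus x3 x4).
lra.
Qed.

(** The identity theorem makes the series vanish on the whole w-plane; integrating it along the
    segment from 0 to 2 pi i against e^(- (m - h) w) isolates a_m. *)
Lemma laurent_zero (h : C) (a : Z -> C) (w0 : C) (d : R) : superdecay a -> (0 < d)%R ->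
  (forall w, (Cmod (w - w0) < d)%R -> laurent h a w = RtoC 0) -> forall m, a m = RtoC 0.
Proof.
intros ha hd H m.
assert (Z0 : forall w, laurent h a w = RtoC 0).
{ intros w. assert (c0 := Cmod_ge_0 (w - w0)).
  apply (identity_near (laurent h a) w0 (Cmod (w - w0) + 1) d); auto; try lra.
  intros y _. eexists. apply Cderiv_laurent, ha. }
set (f := fun (n : nat) t => a (Z.of_nat n) * fexp (Z.of_nat n - m) t + a (- Z.of_nat n - 1)%Z * fexp (- Z.of_nat n - 1 - m) t).
destruct (superdecay_exp h a 0 ha (Rle_refl 0)) as [K [hK HK]].
assert (fe : forall k t, fexp (k - m) t = bexp h k (RtoC t * tpi) * Cexp (- (([m] - h) * (RtoC t * tpi)))).
{ intros k t. unfold fexp, bexp. rewrite <- Cexp_plus, minus_IZR, RtoC_minus. f_equal. ring. }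
assert (fc : forall n, Ccont_on (f n) 0 1).
{ intros n t _. apply Ccont_plus; (apply Ccont_mult; [apply Ccont_const|apply Ccont_fexp]). }
assert (s : Cser (fun n => CInt (f n) 0 1) (CInt (fun _ => RtoC 0) 0 1)).
{ apply (CInt_Cser f (fun _ => RtoC 0) (2 * K) (1 / 2)); auto.
  - lra.
  - intros t _. apply Ccont_const.
  - intros n t _. apply (pair_bound (fun k => a k * fexp (k - m) t)); auto. intros k.
    rewrite Cmod_mult, Cmod_fexp. specialize (HK k). rewrite Rmult_0_r, exp_0 in HK. exact HK.
  - intros t _. apply (Cser_ext (fun n => Cexp (- (([m] - h) * (RtoC t * tpi))) * lterm h a n (RtoC t * tpi))).
    + intros n. unfold f, lterm. rewrite !fe. ring.
    + replace (RtoC 0) with (Cexp (- (([m] - h) * (RtoC t * tpi))) * laurent h a (RtoC t * tpi)) by (rewrite Z0; ring).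
      apply Cser_scal, laurent_correct, ha. }
rewrite CInt_const in s.
assert (i0 : CInt (fexp 0) 0 1 = RtoC 1).
{ rewrite <- (CInt_const (RtoC 1)). apply CInt_ext. lra. intros; apply fexp_0. }
assert (fi : forall n, CInt (f n) 0 1 = a (Z.of_nat n) * CInt (fexp (Z.of_nat n - m)) 0 1 + a (- Z.of_nat n - 1)%Z * CInt (fexp (- Z.of_nat n - 1 - m)) 0 1).
{ intros n. assert (c : forall k, Ccont_on (fexp k) 0 1) by (intros k t _; apply Ccont_fexp).
  rewrite <- !CInt_scal; try lra; auto. apply CInt_plus; try lra; intros t _; (apply Ccont_mult; [apply Ccont_const|apply Ccont_fexp]). }
(* The number of the pair {j, - j - 1} that contains m. *)
set (j := if Z_le_dec 0 m then Z.to_nat m else Z.to_nat (- m - 1)).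
assert (oth : forall n, n <> j -> CInt (f n) 0 1 = RtoC 0).
{ intros n hn. rewrite fi, !CInt_fexp. ring. all: unfold j in hn; destruct (Z_le_dec 0 m); lia. }
rewrite <- (Clim_unique _ _ _ (Cser_single (fun n => CInt (f n) 0 1) j oth) s). cbv beta. rewrite fi.
unfold j. destruct (Z_le_dec 0 m).
- replace (Z.of_nat (Z.to_nat m) - m)%Z with 0%Z by lia. rewrite i0, CInt_fexp by lia.
  replace (Z.of_nat (Z.to_nat m)) with m by lia. ring.
- replace (- Z.of_nat (Z.to_nat (- m - 1)) - 1)%Z with m by lia. rewrite Z.sub_diag, i0, CInt_fexp by lia. ring.
Qed.

(** * Branches of the logarithm along the circuit *)

Lemma Cmod_circuit (z0 : C) (t : R) : Cmod (circuit z0 t) = Cmod z0.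
Proof.
unfold circuit. rewrite Cmod_mult, Cmod_Cexp.
replace (Re (RtoC (2 * PI * t) * Ci)) with 0%R by (unfold RtoC, Ci, Cmult, Re; simpl; ring).
rewrite exp_0. ring.
Qed.

(** The quotient lies in the unit disc about 1, hence where [Clog] inverts the exponential. *)
Lemma Re_div_pos (z g : C) : (Cmod (z - g) < Cmod g)%R -> (0 < Re (z / g))%R.
Proof.
intros h. assert (h0 := Cmod_ge_0 (z - g)).
assert (hg : g <> RtoC 0) by (apply Cmod_gt_0; lra).
assert (e : Cmod (z / g - RtoC 1) = (Cmod (z - g) / Cmod g)%R).
{ rewrite <- Cmod_div by exact hg. f_equal. field. exact hg. }
assert (q := re_le_Cmod (z / g - RtoC 1)). rewrite e in q.
assert (d := div_lt_1 (Cmod (z - g)) (Cmod g) ltac:(lra)).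
replace (Re (z / g - RtoC 1)) with (Re (z / g) - 1)%R in q by (destruct (z / g); reflexivity).
apply Rabs_le_between in q. lra.
Qed.

Section Eigenfunction.
Context (lambda mu h n z0 w0 : C) (a : Z -> C).
Context (en : n = RtoC 2 * h + RtoC 1) (ew : Cexp w0 = z0).
Context (ha : superdecay a) (hrec : forall k, recurrence_at lambda mu h a k).

(** The branch of the logarithm near the point of the circuit at time t, normalised to be w0 + 2 pi
    i t there; it gains 2 pi i over the full turn. *)
Let W (t : R) (z : C) : C := w0 + RtoC t * tpi + Clog (z / circuit z0 t).
Let Phi := laurent h a.
Let Phi1 := laurent h (fun k => ([k] - h) * a k).
Let Phi2 := laurent h (fun k => ([k] - h) * (([k] - h) * a k)).

Lemma circuit_neq_0 (t : R) : circuit z0 t <> RtoC 0.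
Proof. rewrite (circuit_exp z0 w0 t ew). apply Cexp_neq_0. Qed.

Lemma Cexp_branch (t : R) (z : C) : (Cmod (z - circuit z0 t) < Cmod z0)%R -> Cexp (W t z) = z.
Proof.
intros hz. unfold W. rewrite Cexp_plus, <- (circuit_exp z0 w0 t ew), Cexp_Clog.
field. apply circuit_neq_0. apply Re_div_pos. rewrite Cmod_circuit. exact hz.
Qed.

Lemma Cderiv_branch (t : R) (z : C) : (Cmod (z - circuit z0 t) < Cmod z0)%R -> Cderiv (W t) z (/ z).
Proof.
intros hz. assert (hg := circuit_neq_0 t).
assert (hp : (0 < Re (z / circuit z0 t))%R) by (apply Re_div_pos; rewrite Cmod_circuit; exact hz).
assert (z1 : z <> RtoC 0).
{ intros e. rewrite e in hz. replace (RtoC 0 - circuit z0 t) with (- circuit z0 t) in hz by ring.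
  rewrite Cmod_opp, Cmod_circuit in hz. lra. }
eapply Cderiv_eq. unfold W. apply Cderiv_plus. apply Cderiv_const.
apply (Cderiv_comp Clog (fun z => z / circuit z0 t)). apply Cderiv_Clog, hp.
apply Cderiv_mult. apply Cderiv_id. apply Cderiv_const.
cbv beta. field. split; assumption.
Qed.

(** Both values are logarithms of z, and their imaginary parts differ by less than 2 pi / 4 + pi < 2
    pi. *)
Lemma branch_eq (s t : R) (z : C) : (Cmod (z - circuit z0 s) < Cmod z0)%R -> (Cmod (z - circuit z0 t) < Cmod z0)%R ->
  (Rabs (s - t) < 1 / 4)%R -> W s z = W t z.
Proof.
intros hs ht hst. apply Cexp_eq. rewrite !Cexp_branch by assumption. reflexivity.
assert (i1 := Im_Clog (z / circuit z0 s)). assert (i2 := Im_Clog (z / circuit z0 t)).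
assert (e : forall r, Im (W r z) = (Im w0 + 2 * PI * r + Im (Clog (z / circuit z0 r)))%R).
{ intros r. unfold W. generalize (Clog (z / circuit z0 r)). intros [p q]. destruct w0 as [p' q'].
  unfold RtoC, Ci, Cmult, Cplus, Im. simpl. ring. }
rewrite !e. apply Rabs_def2 in hst.
apply Rabs_def1; nra.
Qed.

Lemma eigenfunction_exists : (exists m, a m <> RtoC 0) ->
  exists E, solution_near lambda mu n z0 E /\ ~ germ_eq z0 E (fun _ => RtoC 0) /\
    monodromy z0 E (fun z => Cexp (- (h * tpi)) * E z).
Proof.
intros [m hm].
assert (hz0 : z0 <> RtoC 0) by (rewrite <- ew; apply Cexp_neq_0).
assert (hc := proj1 (Cmod_gt_0 z0) hz0).
assert (ha1 := superdecay_mult h a ha).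
assert (d0 : forall t z, (Cmod (z - circuit z0 t) < Cmod z0)%R -> Cderiv (fun z => Phi (W t z)) z (/ z * Phi1 (W t z))).
{ intros t z hz. apply (Cderiv_comp Phi (W t)). apply Cderiv_laurent, ha. apply Cderiv_branch, hz. }
assert (d1 : forall t z, (Cmod (z - circuit z0 t) < Cmod z0)%R -> Cderiv (fun z => Phi1 (W t z)) z (/ z * Phi2 (W t z))).
{ intros t z hz. apply (Cderiv_comp Phi1 (W t)). apply (Cderiv_laurent h _ _ ha1). apply Cderiv_branch, hz. }
assert (zn : forall t z, (Cmod (z - circuit z0 t) < Cmod z0)%R -> z <> RtoC 0).
{ intros t z hz e. rewrite e in hz. replace (RtoC 0 - circuit z0 t) with (- circuit z0 t) in hz by ring.
  rewrite Cmod_opp, Cmod_circuit in hz. lra. }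
exists (fun z => Phi (W 0 z)). split; [|split].
- apply solution_near_iff. exists (Cmod z0). split. exact hc. split.
  + intros z hz. eexists. apply d0. rewrite circuit_0. exact hz.
  + intros z hz. assert (hz' : (Cmod (z - circuit z0 0) < Cmod z0)%R) by (rewrite circuit_0; exact hz).
    assert (z1 := zn 0%R z hz').
    assert (c1 : forall y, (Cmod (y - z0) < Cmod z0)%R -> C_derive (fun z => Phi (W 0 z)) y = / y * Phi1 (W 0 y)).
    { intros y hy. apply Cderiv_unique, d0. rewrite circuit_0. exact hy. }
    assert (c2 : C_derive (C_derive (fun z => Phi (W 0 z))) z = - / (z * z) * Phi1 (W 0 z) + / z * (/ z * Phi2 (W 0 z))).
    { apply Cderiv_unique. apply (Cderiv_ext_loc (fun y => / y * Phi1 (W 0 y)) _ z _ (Cmod z0 - Cmod (z - z0))%R). lra.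
      - intros y hy. symmetry. apply c1. replace (y - z0) with ((y - z) + (z - z0)) by ring.
        eapply Rle_lt_trans; [apply Cmod_triangle|]. lra.
      - exact (Cderiv_mult Cinv (fun y => Phi1 (W 0 y)) z _ _ (Cderiv_inv z z1) (d1 0%R z hz')). }
    unfold ode. rewrite c2, c1 by exact hz.
    assert (k := laurent_ode lambda mu h n a (W 0 z) en ha hrec). cbv zeta in k.
    rewrite (Cexp_branch 0 z hz') in k. fold Phi Phi1 Phi2 in k.
    rewrite <- k, en. field. exact z1.
- intros g. apply locally_Cmod in g. destruct g as [d [hd g]].
  destruct (Cderiv_Cmod_cont Cexp w0 _ (Cderiv_Cexp w0) d hd) as [d' [hd' Hd']].
  (* Near w0 the branch at time 0 inverts the exponential, so the germ vanishes only if the series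
     does; a radius of at most 1 < pi/2 keeps w - w0 in the range of [Clog_Cexp]. *)
  apply hm. apply (laurent_zero h a w0 (Rmin d' 1) ha). apply Rmin_pos; lra.
  intros w hw. assert (m1 := Rmin_l d' 1). assert (m2 := Rmin_r d' 1).
  specialize (Hd' w ltac:(lra)). rewrite ew in Hd'. specialize (g _ Hd'). cbv beta in g. rewrite <- g. unfold Phi. f_equal.
  unfold W. rewrite circuit_0, <- ew, <- Cexp_minus, Clog_Cexp. ring.
  assert (i := im_le_Cmod (w - w0)). assert (p := PI2_1).
  assert (Rabs (Im (w - w0)) < 1)%R by lra. apply Rabs_def2 in H. lra.
- exists (fun t z => Phi (W t z)). split; [|split; [|split]].
  + intros t _. apply holomorphic_ball_near. exists (Cmod z0). split. exact hc.
    intros z hz. eexists. apply d0, hz.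
  + intros t ht. destruct (circuit_cont z0 t (Cmod z0 / 2) hz0 ltac:(lra)) as [d [hd Hd]].
    exists (mkposreal (Rmin d (1 / 4)) ltac:(apply Rmin_pos; lra)). intros s hs _.
    change (Rabs (s - t) < Rmin d (1 / 4))%R in hs.
    assert (m1 := Rmin_l d (1 / 4)). assert (m2 := Rmin_r d (1 / 4)).
    apply locally_Cmod. exists (Cmod z0 / 2)%R. split. lra. intros z hz.
    f_equal. apply branch_eq; try lra.
    specialize (Hd s ltac:(lra)).
    replace (z - circuit z0 t) with ((z - circuit z0 s) + (circuit z0 s - circuit z0 t)) by ring.
    eapply Rle_lt_trans; [apply Cmod_triangle|]. lra.
  + apply locally_Cmod. exists 1%R. split. lra. intros; reflexivity.
  + apply locally_Cmod. exists 1%R. split. lra. intros z _.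
    (* The final branch exceeds the initial one by 2 pi i, and the Laurent series responds with the
       eigenvalue. *)
    replace (W 1 z) with (W 0 z + tpi). apply laurent_period, ha.
    unfold W. rewrite circuit_0, circuit_1. ring.
Qed.

End Eigenfunction.

Theorem theorem5p14 :
  forall (lambda mu omega l n z0 : C),
    lambda + mu ^ 2 = RtoC 1 / (RtoC 4 * omega ^ 2) ->
    omega <> RtoC 0 ->
    mu <> RtoC 0 ->
    n = l + RtoC 1 ->
    (forall k : Z, l <> RtoC 2 * RtoC (IZR k)) ->
    z0 <> RtoC 0 ->
    (monodromy_eigenvalue lambda mu n z0 (Cexp (- (RtoC PI * Ci * l)))
     <->
     (Rinf lambda mu l 0 2 1
        + omega * l * (Rinf lambda mu l 0 2 1 - Rinf lambda mu l 0 1 1) = RtoC 0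
      \/
      Rinf lambda mu l 0 2 1
        - omega * l * (Rinf lambda mu l 0 2 1 - Rinf lambda mu l 0 1 1) = RtoC 0)).
Proof.
intros lambda mu omega l n z0 hlm ho hmu hn hl hz0.
set (h := l / RtoC 2).
assert (lh : l = RtoC 2 * h) by (unfold h; field).
assert (hh : nonresonant h) by (intros k; exact (half_neq l k hl)).
assert (en : n = RtoC 2 * h + RtoC 1) by (rewrite hn, lh; reflexivity).
(* The eigenvalue is the factor that z^(-h) acquires on one turn. *)
assert (ee : Cexp (- (RtoC PI * Ci * l)) = Cexp (- (h * tpi))).
{ f_equal. rewrite lh, RtoC_mult. ring. }
destruct (Rinf_spec lambda mu l hl) as [x [e0 [e1 [hx [[Kx bx] xn]]]]].
rewrite e0, e1, ee.
assert (hx' : forall k : nat, x k = (RtoC 1 + lambda / (RtoC (INR k) ^ 2 - h ^ 2)) * x (S k)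
   + mu ^ 2 / (RtoC (INR k) ^ 2 - h ^ 2) * x (S (S k))).
{ intros k. replace (RtoC (INR k) ^ 2 - h ^ 2) with (den l k). apply hx. unfold den, h. field. }
assert (c1 : determinant_condition omega h (RtoC 1) (x 0%nat) (x 1%nat) <->
  x 1%nat + omega * l * (x 1%nat - x 0%nat) = RtoC 0).
{ unfold determinant_condition. rewrite lh.
  replace (x 1%nat + RtoC 1 * omega * (RtoC 2 * h) * (x 1%nat - x 0%nat)) with (x 1%nat + omega * (RtoC 2 * h) * (x 1%nat - x 0%nat)) by ring.
  reflexivity. }
assert (c2 : determinant_condition omega h (RtoC (-1)) (x 0%nat) (x 1%nat) <->
  x 1%nat - omega * l * (x 1%nat - x 0%nat) = RtoC 0).
{ unfold determinant_condition. rewrite lh.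
  replace (x 1%nat + RtoC (-1) * omega * (RtoC 2 * h) * (x 1%nat - x 0%nat)) with (x 1%nat - omega * (RtoC 2 * h) * (x 1%nat - x 0%nat)) by ring.
  reflexivity. }
rewrite <- c1, <- c2. split.
- intros [E [sE [nE mE]]].
  destruct (eigenfunction_recurrence lambda mu h n z0 E en hz0 sE nE mE) as [a [K [r [hr [H1 [H2 H3]]]]]].
  exact (bounded_solution_condition lambda mu omega h x Kx hlm ho hmu hh hx' bx a K r hr H1 H2 H3).
- intros H.
  assert (exists a : Z -> C, (forall k, recurrence_at lambda mu h a k) /\ superdecay a /\ exists m, a m <> RtoC 0) as [a [H1 [H2 H3]]].
  { destruct H as [H|H].
    - apply (condition_eigensequence lambda mu omega h x Kx hlm ho hmu hh hx' bx (RtoC 1)); auto. ring.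
    - apply (condition_eigensequence lambda mu omega h x Kx hlm ho hmu hh hx' bx (RtoC (-1))); auto.
      rewrite <- RtoC_mult. f_equal. ring. }
  destruct (Cexp_surj z0 hz0) as [w0 ew].
  exact (eigenfunction_exists lambda mu h n z0 w0 a en ew H2 H1 H3).
Qed.
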